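(* Let $\mathsf N$ be a simply connected two-step nilpotent Lie group with invariant spacetime $g=-N(t)^2\mathrm dt^2+h_t$ on $(t_-,t_+)\times\mathsf N$ as in the context, and let $T\in(t_-,t_+)$. If $\kappa_{\rm opt}(T)\le\tfrac12$, then $(t_-,T)\times\mathsf N$ is future one-connected. No additional bound on $L_t$ or on the condition number of $A_t$ is required. Moreover $\kappa_{\rm opt}(T)\le\kappa_{\rm an}(T)\le\kappa_{\rm Sch}(T)$, so either $\kappa_{\rm an}(T)\le\tfrac12$ or $\kappa_{\rm Sch}(T)\le\tfrac12$ also suffices.
   Context: $\mathfrak n$ is a finite-dimensional real nilpotent Lie algebra of step exactly two with center $Z$, $V=\mathfrak n/Z$, induced bracket $\mathsf b:\Lambda^2V\to Z$. Choosing a linear section $V\to\mathfrak n$, $\mathsf N\cong V\oplus Z$ via exp with product $(v,z)(v',z')=(v+v',z+z'+\frac12\mathsf b(v,v'))$, and $\Theta=\mathrm dz-\frac12\mathsf b(v,\mathrm dv)$. $-\infty\le t_-<t_+\le\infty$; $N>0$ and $t\mapsto h_t$ are smooth, $h_t$ left-invariant Riemannian, $\partial_t$ future directed. Schur form: $h_t=H_t(\mathrm dv,\mathrm dv)+A_t(\Theta+L_t\mathrm dv,\Theta+L_t\mathrm dv)$ with $H_t,A_t$ positive definite on $V,Z$, $L_t:V\to Z$ linear. For compact $I=[a,b]\subset(t_-,T)$ and $\xi\in W_0^{1,2}(I;V)$, $Q_I(\xi)=\frac12\int_I\mathsf b(\xi,\dot\xi)\,\mathrm dt$. Define (with $\sup\varnothing=0$)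 $$\kappa_{\rm opt}(T)=\sup_I\sup_{\xi\ne0}\sup_{0\ne\lambda\in Z^*}\frac{|\lambda(Q_I(\xi))|}{\int_I\frac{H_t(\dot\xi,\dot\xi)}{N(t)}\sqrt{A_t^{-1}(\lambda,\lambda)}\,\mathrm dt},$$ $$\kappa_{\rm an}(T)=\sup_I\sup_{Q_I(\xi)\ne0}\left(\int_I\frac{H_t(\dot\xi,\dot\xi)}{N(t)\sqrt{A_t(Q_I(\xi),Q_I(\xi))}}\,\mathrm dt\right)^{-1},$$ and, for a fixed inner-product norm $|\cdot|_*$ on $Z$ and $a_+(t)=\sup_{z\ne0}\sqrt{A_t(z,z)}/|z|_*$, $$\kappa_{\rm Sch}(T)=\sup_I\sup_{\xi\ne0}\frac{|Q_I(\xi)|_*}{\int_I\frac{H_t(\dot\xi,\dot\xi)}{N(t)a_+(t)}\,\mathrm dt}.$$ Future one-connected: any two piecewise $C^1$ future-directed timelike curves with the same endpoints are joined by a continuous fixed-endpoint homotopy through piecewise $C^1$ future-directed timelike curves. *)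

(* Defs.v *)
From HB Require Import structures.
From mathcomp Require Import all_boot all_order all_algebra.
From mathcomp Require Import all_classical all_reals all_analysis.

Set Implicit Arguments.
Unset Strict Implicit.
Unset Printing Implicit Defensive.

Import Order.TTheory GRing.Theory Num.Theory.
Import numFieldNormedType.Exports.

Local Open Scope classical_set_scope.
Local Open Scope ring_scope.

Definition is_lie_bracket (R : realType) (n : vectType R) (br : n -> n -> n) :
    Prop :=
  [/\ forall x, linear (br x),
      forall y, linear (br^~ y),
      forall x, br x x = 0 &
      forall x y z, br x (br y z) + br y (br z x) + br z (br x y) = 0].

Definition lie_center (R : realType) (n : vectType R) (br : n -> n -> n) :
    set n :=
  [set x | forall y, br x y = 0].

(* nilpotent of step exactly two *)
Definition two_step (R : realType) (n : vectType R) (br : n -> n -> n) : Prop :=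
  (forall x y z, br (br x y) z = 0) /\ (exists x y, br x y <> 0).

(* [iota] is a linear parametrization of the centre Z by R^q.  The condition
   that (v, z) |-> sigma v + iota z is bijective says that v |-> [sigma v] is a
   linear isomorphism from R^p onto n / Z, so that [sigma] is a linear section
   of n -> n / Z under this identification of V = n / Z with R^p.
   [b] is the bracket V x V -> Z induced by [br]. *)
Definition central_splitting (R : realType) (n : vectType R)
    (br : n -> n -> n) (p q : nat)
    (sigma : 'rV[R]_p -> n) (iota : 'rV[R]_q -> n)
    (b : 'rV[R]_p -> 'rV[R]_p -> 'rV[R]_q) : Prop :=
  [/\ linear sigma,
      linear iota,
      bijective (fun x : 'rV[R]_p * 'rV[R]_q => sigma x.1 + iota x.2),
      range iota = lie_center br &
      forall v w, iota (b v w) = br (sigma v) (sigma w)].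

(* The group N = V (+) Z in exponential coordinates. *)
Definition gmul (R : realType) (p q : nat)
    (b : 'rV[R]_p -> 'rV[R]_p -> 'rV[R]_q)
    (x y : 'rV[R]_p * 'rV[R]_q) : 'rV[R]_p * 'rV[R]_q :=
  (x.1 + y.1, x.2 + y.2 + 2^-1 *: b x.1 y.1).

(* The Z-valued one-form Theta = dz - b(v, dv)/2 at [x], on the tangent
   vector [u]. *)
Definition Theta (R : realType) (p q : nat)
    (b : 'rV[R]_p -> 'rV[R]_p -> 'rV[R]_q)
    (x u : 'rV[R]_p * 'rV[R]_q) : 'rV[R]_q :=
  u.2 - 2^-1 *: b x.1 u.1.

Definition is_inner_product (R : realType) (E : lmodType R)
    (B : E -> E -> R) : Prop :=
  [/\ forall k u u' w, B (k *: u + u') w = k * B u w + B u' w,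
      forall u w, B u w = B w u &
      forall u, u != 0 -> 0 < B u u].

(* [m x u w] is the value at the point [x] on the tangent vectors [u], [w]. *)
Definition left_invariant_metric (R : realType) (p q : nat)
    (b : 'rV[R]_p -> 'rV[R]_p -> 'rV[R]_q)
    (m : 'rV[R]_p * 'rV[R]_q -> 'rV[R]_p * 'rV[R]_q ->
         'rV[R]_p * 'rV[R]_q -> R) : Prop :=
  (forall x, is_inner_product (m x)) /\
  (forall y x u w,
     m (gmul b y x) ('D_u (gmul b y) x) ('D_w (gmul b y) x) = m x u w).

Definition qform (R : realType) (k : nat) (M : 'M[R]_k) (v : 'rV[R]_k) : R :=
  (v *m M *m v^T) 0 0.

Definition posdefmx (R : realType) (k : nat) (M : 'M[R]_k) : Prop :=
  M^T = M /\ (forall v, v != 0 -> 0 < qform M v).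

(* [H] and [A] are Gram matrices on V and Z; the linear map L : V -> Z is
   v |-> v *m L. *)
Definition schur_form (R : realType) (p q : nat)
    (b : 'rV[R]_p -> 'rV[R]_p -> 'rV[R]_q)
    (m : 'rV[R]_p * 'rV[R]_q -> 'rV[R]_p * 'rV[R]_q ->
         'rV[R]_p * 'rV[R]_q -> R)
    (H : 'M[R]_p) (A : 'M[R]_q) (L : 'M[R]_(p, q)) : Prop :=
  [/\ posdefmx H, posdefmx A &
      forall x u, m x u u = qform H u.1 + qform A (Theta b x u + u.1 *m L)].

Definition smooth_on (R : realType) (lo hi : \bar R) (f : R -> R) : Prop :=
  forall (k : nat) (t : R), (lo < t%:E < hi)%E -> derivable (derive1n k f) t 1.

(* W_0^{1,2}([a, c]; V), through absolutely continuous representatives: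
   [dxi] is square integrable on [a, c], [xi] is its primitive vanishing at
   [a], and xi(c) = 0.  Thus [dxi] is the weak (and a.e.) derivative of [xi]. *)
Definition W012 (R : realType) (p : nat) (a c : R) (xi dxi : R -> 'rV[R]_p) :
    Prop :=
  [/\ forall i, measurable_fun `[a, c] (fun t => dxi t 0 i),
      forall i, (@lebesgue_measure R).-integrable `[a, c]
                  (fun t => ((dxi t 0 i) ^+ 2)%:E),
      forall t, t \in `[a, c] ->
        xi t = \row_i (\int[@lebesgue_measure R]_(s in `[a, t]) (dxi s 0 i)) &
      xi c = 0].

Definition Qform (R : realType) (p q : nat)
    (b : 'rV[R]_p -> 'rV[R]_p -> 'rV[R]_q) (a c : R)
    (xi dxi : R -> 'rV[R]_p) : 'rV[R]_q :=
  2^-1 *: \row_j (\int[@lebesgue_measure R]_(t in `[a, c])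
                    (b (xi t) (dxi t) 0 j)).

(* Supremum of a set of nonnegative extended reals, with sup of the empty set
   equal to 0. *)
Definition sup0 (R : realType) (S : set (\bar R)) : \bar R :=
  ereal_sup (0%E |` S).

(* A functional lambda in Z^* is a column vector acting by z |-> z *m lam; the
   form induced by [A] on Z^* then has Gram matrix [invmx A]. *)
Definition kappa_opt (R : realType) (p q : nat)
    (b : 'rV[R]_p -> 'rV[R]_p -> 'rV[R]_q) (tm : \bar R) (T : R)
    (N : R -> R) (H : R -> 'M[R]_p) (A : R -> 'M[R]_q) : \bar R :=
  sup0 [set r | exists (a c : R) (xi dxi : R -> 'rV[R]_p) (lam : 'cV[R]_q),
    [/\ (tm < a%:E)%E /\ a < c < T,
        W012 a c xi dxi,
        exists2 t, t \in `[a, c] & xi t != 0,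
        lam != 0 &
        r = (`| (Qform b a c xi dxi *m lam) 0 0 | /
             \int[@lebesgue_measure R]_(t in `[a, c])
               (qform (H t) (dxi t) / N t *
                Num.sqrt (qform (invmx (A t)) lam^T)))%:E]].

Definition kappa_an (R : realType) (p q : nat)
    (b : 'rV[R]_p -> 'rV[R]_p -> 'rV[R]_q) (tm : \bar R) (T : R)
    (N : R -> R) (H : R -> 'M[R]_p) (A : R -> 'M[R]_q) : \bar R :=
  sup0 [set r | exists (a c : R) (xi dxi : R -> 'rV[R]_p),
    [/\ (tm < a%:E)%E /\ a < c < T,
        W012 a c xi dxi,
        Qform b a c xi dxi != 0 &
        r = ((\int[@lebesgue_measure R]_(t in `[a, c])
                (qform (H t) (dxi t) /
                 (N t * Num.sqrt (qform (A t) (Qform b a c xi dxi)))))^-1)%:E]].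

(* [S] is the Gram matrix of the inner product defining the norm on Z. *)
Definition a_plus (R : realType) (q : nat) (S A : 'M[R]_q) : R :=
  sup [set r | exists2 z : 'rV[R]_q, z != 0 &
                 r = Num.sqrt (qform A z) / Num.sqrt (qform S z)].

Definition kappa_Sch (R : realType) (p q : nat)
    (b : 'rV[R]_p -> 'rV[R]_p -> 'rV[R]_q) (tm : \bar R) (T : R)
    (N : R -> R) (H : R -> 'M[R]_p) (A : R -> 'M[R]_q) (S : 'M[R]_q) :
    \bar R :=
  sup0 [set r | exists (a c : R) (xi dxi : R -> 'rV[R]_p),
    [/\ (tm < a%:E)%E /\ a < c < T,
        W012 a c xi dxi,
        exists2 t, t \in `[a, c] & xi t != 0 &
        r = (Num.sqrt (qform S (Qform b a c xi dxi)) /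
             \int[@lebesgue_measure R]_(t in `[a, c])
               (qform (H t) (dxi t) / (N t * a_plus S (A t))))%:E]].

(* g = - N^2 dt^2 + h_t at the point [P] = (t, x), on the tangent vector [w]. *)
Definition spacetime_form (R : realType) (p q : nat) (N : R -> R)
    (h : R -> 'rV[R]_p * 'rV[R]_q -> 'rV[R]_p * 'rV[R]_q ->
         'rV[R]_p * 'rV[R]_q -> R)
    (P w : R * ('rV[R]_p * 'rV[R]_q)) : R :=
  - (N P.1 ^+ 2 * w.1 ^+ 2) + h P.1 P.2 w.2 w.2.

(* A piecewise C^1 future-directed timelike curve in (lo, hi) x N, parametrized
   on [0, 1].  On each closed piece [s i, s (i+1)] it is the restriction of a
   C^1 map of the line, i.e. it is C^1 up to the end points; the velocity there
   (one-sided at break points) is timelike with positive dt-component. *)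
Definition future_timelike_curve (R : realType) (p q : nat) (N : R -> R)
    (h : R -> 'rV[R]_p * 'rV[R]_q -> 'rV[R]_p * 'rV[R]_q ->
         'rV[R]_p * 'rV[R]_q -> R)
    (lo hi : \bar R) (gam : R -> R * ('rV[R]_p * 'rV[R]_q)) : Prop :=
  exists (k : nat) (s : nat -> R),
    [/\ s 0%N = 0, s k = 1 &
        forall i, (i < k)%N ->
          s i < s i.+1 /\
          exists c : R -> R * ('rV[R]_p * 'rV[R]_q),
            [/\ forall u, derivable c u 1,
                continuous (derive1 c) &
                forall u, u \in `[s i, s i.+1] ->
                  [/\ gam u = c u,
                      (lo < ((c u).1)%:E < hi)%E,
                      spacetime_form N h (c u) (derive1 c u) < 0 &
                      0 < (derive1 c u).1]]].

Definition future_one_connected (R : realType) (p q : nat) (N : R -> R)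
    (h : R -> 'rV[R]_p * 'rV[R]_q -> 'rV[R]_p * 'rV[R]_q ->
         'rV[R]_p * 'rV[R]_q -> R)
    (lo hi : \bar R) : Prop :=
  forall gam0 gam1 : R -> R * ('rV[R]_p * 'rV[R]_q),
    future_timelike_curve N h lo hi gam0 ->
    future_timelike_curve N h lo hi gam1 ->
    gam0 0 = gam1 0 -> gam0 1 = gam1 1 ->
    exists G : R * R -> R * ('rV[R]_p * 'rV[R]_q),
      [/\ {within [set P : R * R | P.1 \in `[0, 1] /\ P.2 \in `[0, 1]],
             continuous G},
          forall u, u \in `[0, 1] -> G (0, u) = gam0 u /\ G (1, u) = gam1 u,
          forall s, s \in `[0, 1] ->
            G (s, 0) = gam0 0 /\ G (s, 1) = gam0 1 &
          forall s, s \in `[0, 1] ->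
            future_timelike_curve N h lo hi (fun u => G (s, u))].

(* Main.v *)
(* Parametrized by t, a curve is a pair (v, z), and it is timelike when the
   velocity (v', w), with w = z' - b(v, v')/2, has h_t-norm less than N.  Given
   two curves with the same end points, let xi = v1 - v0.  Interpolating v and w
   affinely with parameter s moves the z-end point by -s(1-s) Q(xi), which is
   compensated by adding s(1-s) eta to w, where the integral of eta is Q(xi).
   Strict convexity of the h_t-norm leaves room s(1-s) H(xi', xi')/(2N) in the
   Z-direction, so it suffices that |eta|_A <= H(xi', xi')/(2N) up to the uniform
   slack of the two given curves.  By duality such an eta exists exactly when
   lam(Q) <= (1/2) int (H(xi', xi')/N) |lam|_{A^-1} for every lam, that is when
   kappa_opt <= 1/2.  Concretely, a near-minimizer lam of the convex functional
   lam |-> int rho sqrt(1 + |lam|^2) - lam(Q) with rho = H(xi', xi')/(2N) yields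
   eta = rho lam^# / sqrt(1 + |lam|^2), whose integral is Q up to an error that
   the slack absorbs.  The matrix L_t never enters because only the sum w + L v'
   is interpolated. *)

(* When [kappa_opt] equals 1/2 the dual functional may approach its infimum only as lam tends to
   infinity, so a minimizer need not exist. This is why a near-minimizer is used and why the two
   curves must first supply a uniform slack. The slack exists because every piece of a curve is C^1
   up to its end points: a strict inequality on finitely many compact pieces is uniform. The 1 under
   the square root makes the functional differentiable at lam = 0 and makes |eta| <= rho automatic.
   The margin kept by the deformation is proportional to s(1-s). It vanishes at s = 0 and s = 1,
   where the given curves themselves are used. The two curves have unrelated subdivisions and
   parametrizations. Their time functions are interpolated too, and the deformed graph is evaluated
   at the interpolated time, so the homotopy begins and ends at the given parametrizations. Since
   division by zero yields 0, a bound on [kappa_opt] controls lam(Q) only once the energy in the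
   denominator is known to be positive. *)
Require Import Defs.
From HB Require Import structures.
From mathcomp Require Import all_boot all_order all_algebra.
From mathcomp Require Import all_classical all_reals all_analysis.
From mathcomp Require Import ring lra measurable_realfun.
Set Implicit Arguments.
Unset Strict Implicit.
Unset Printing Implicit Defensive.
Import Order.TTheory GRing.Theory Num.Theory.
Import numFieldNormedType.Exports.
Local Open Scope classical_set_scope.
Local Open Scope ring_scope.

(** * Calculus of C^1 maps *)

Section is_derive_vector.
Context {R : realType} {V W : normedModType R}.
Implicit Types (f : R -> V) (g : R -> R) (x : R).

Lemma is_derive1P f x d :
  is_derive x 1 f d <-> h^-1 *: (f (h + x) - f x) @[h --> 0^'] --> d.
Proof.
have E : (fun h : R => h^-1 *: ((f \o shift x) (h *: 1) - f x)) =
         (fun h => h^-1 *: (f (h + x) - f x)).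
  by apply/funext => h /=; rewrite [h *: 1]mulr1.
split=> [[df <-]|fd].
  by move: df; rewrite /derivable /derive E.
by split; [apply/cvg_ex; exists d; rewrite E|apply/cvg_lim => //; rewrite E].
Qed.

Lemma is_derive_cvg f x d : is_derive x 1 f d -> {for x, continuous f}.
Proof. by move=> [df _]; exact/differentiable_continuous/derivable1_diffP. Qed.

Lemma is_derive_comp1 f g x df dg :
  is_derive (g x) 1 f df -> is_derive x 1 g dg ->
  is_derive x 1 (f \o g) (dg *: df).
Proof.
move=> [/derivable1_diffP dff dfE] [/derivable1_diffP dgg dgE].
have dfg := differentiable_comp dgg dff.
split; first exact/derivable1_diffP.
rewrite deriveE// diff_comp//=.
have -> : 'd g x 1 = dg *: 1 by rewrite -deriveE// dgE [RHS]mulr1.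
by rewrite linearZ/= -deriveE// dfE.
Qed.

End is_derive_vector.

Section is_derive_vector2.
Context {R : realType} {V W : normedModType R}.
Implicit Types (f : R -> V) (g : R -> R) (x : R).

Lemma is_derive_linear (l : {linear V -> W}) f x d :
  continuous l -> is_derive x 1 f d -> is_derive x 1 (l \o f) (l d).
Proof.
move=> cl /is_derive1P fd; apply/is_derive1P.
have -> : (fun h => h^-1 *: ((l \o f) (h + x) - (l \o f) x)) =
          l \o (fun h => h^-1 *: (f (h + x) - f x)).
  by apply/funext => h /=; rewrite linearZ_LR (linearB l).
exact: (cvg_comp _ _ fd (cl d)).
Qed.

Lemma is_derive_pair f (g : R -> W) x df dg :
  is_derive x 1 f df -> is_derive x 1 g dg ->
  is_derive x 1 (fun y => (f y, g y)) (df, dg).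
Proof.
move=> [/derivable1_diffP dff <-] [/derivable1_diffP dgg <-].
have H : differentiable (fun y => (f y, g y)) x by exact: differentiable_pair.
split; first exact/derivable1_diffP.
by rewrite deriveE // diff_pair//= !deriveE.
Qed.

Lemma is_derive_glue f f2 x d : f x = f2 x ->
  is_derive x 1 f d -> is_derive x 1 f2 d ->
  is_derive x 1 (fun y => if y < x then f y else f2 y) d.
Proof.
move=> e /is_derive1P D1 /is_derive1P D2; apply/is_derive1P => A dA.
have /= := D1 A dA; have /= := D2 A dA.
rewrite !nbhs_filterE/=.
apply: filterS2 => h /=; rewrite ltxx.
by case: ifP => // _; rewrite e.
Qed.

End is_derive_vector2.

Section is_derive_coordinates.
Context {R : realType}.
Implicit Types x : R.

Lemma is_derive_fst {V W : normedModType R} (f : R -> V * W) x d :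
  is_derive x 1 f d -> is_derive x 1 (fun y => (f y).1) d.1.
Proof.
by move=> fd; apply: (@is_derive_linear _ _ _ fst) => // z; exact: cvg_fst.
Qed.

Lemma is_derive_snd {V W : normedModType R} (f : R -> V * W) x d :
  is_derive x 1 f d -> is_derive x 1 (fun y => (f y).2) d.2.
Proof.
by move=> fd; apply: (@is_derive_linear _ _ _ snd) => // z; exact: cvg_snd.
Qed.

Lemma is_derive_rowP n (f : R -> 'rV[R]_n) x d :
  is_derive x 1 f d <-> forall j, is_derive x 1 (fun y => f y 0 j) (d 0 j).
Proof.
split=> [[df <-] j|fd].
  split; first exact: ((derivable_mxP _ _ _).1 df).
  by rewrite derive_mx// mxE.
have df : derivable f x 1.
  by apply/derivable_mxP => i j; rewrite ord1; have [] := fd j.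
split=> //; rewrite derive_mx//; apply/rowP => j; rewrite mxE.
by have [_ ->] := fd j.
Qed.

Lemma cvg_rowP {T} {F : set_system T} {FF : Filter F} n (f : T -> 'rV[R]_n)
    (l : 'rV[R]_n) :
  (f @ F --> l) <-> forall j, f x 0 j @[x --> F] --> l 0 j.
Proof.
split=> [fl j|fl].
  have := @coord_continuous R 1 n 0 j l.
  exact: (@cvg_comp _ _ _ _ _ _ _ _ fl).
move=> A [P lP PA].
have : \forall x \near F, forall j, P 0 j (f x 0 j).
  by apply: filter_forall => j; apply: fl; exact: lP.
by apply: filterS => x Px; apply: PA => i j; rewrite ord1.
Qed.

Lemma continuous_rowP {T : topologicalType} n (f : T -> 'rV[R]_n) :
  continuous f <-> forall j, continuous (fun x : T => f x 0 j).
Proof.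
split=> [cf j x|cf x]; last by apply/cvg_rowP => j; exact: cf.
by have /cvg_rowP := cf x; exact.
Qed.

End is_derive_coordinates.

(** * Continuity of vector- and matrix-valued functions *)

Section global_continuity.
Context {R : realType} {T : topologicalType}.

Lemma cont_id : continuous (fun x : T => x).
Proof. by move=> x; exact: cvg_id. Qed.

Lemma cont_cst {U : topologicalType} (k : U) : continuous (fun _ : T => k).
Proof. by move=> x; exact: cvg_cst. Qed.

Lemma cont_comp {U V : topologicalType} (g : U -> V) (f : T -> U) :
  continuous g -> continuous f -> continuous (fun x => g (f x)).
Proof. by move=> cg cf x; apply: continuous_comp; [exact: cf|exact: cg]. Qed.

Lemma cont_pair {U V : topologicalType} (f : T -> U) (g : T -> V) :
  continuous f -> continuous g -> continuous (fun x => (f x, g x)).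
Proof. by move=> cf cg x; apply: cvg_pair; [exact: cf|exact: cg]. Qed.

Lemma cont_fst {U V : topologicalType} (f : T -> U * V) :
  continuous f -> continuous (fun x => (f x).1).
Proof. by move=> cf x; apply: continuous_comp; [exact: cf|exact: cvg_fst]. Qed.

Lemma cont_snd {U V : topologicalType} (f : T -> U * V) :
  continuous f -> continuous (fun x => (f x).2).
Proof. by move=> cf x; apply: continuous_comp; [exact: cf|exact: cvg_snd]. Qed.

Lemma contD {V : normedModType R} (f g : T -> V) :
  continuous f -> continuous g -> continuous (fun x => f x + g x).
Proof. by move=> cf cg x; apply: cvgD; [exact: cf|exact: cg]. Qed.

Lemma contB {V : normedModType R} (f g : T -> V) :
  continuous f -> continuous g -> continuous (fun x => f x - g x).
Proof. by move=> cf cg x; apply: cvgB; [exact: cf|exact: cg]. Qed.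

Lemma contZ {V : normedModType R} (k : T -> R) (f : T -> V) :
  continuous k -> continuous f -> continuous (fun x => k x *: f x).
Proof. by move=> ck cf x; apply: cvgZ; [exact: ck|exact: cf]. Qed.

Lemma contM (f g : T -> R) :
  continuous f -> continuous g -> continuous (fun x => f x * g x).
Proof. by move=> cf cg x; apply: cvgM; [exact: cf|exact: cg]. Qed.

Lemma contV (f : T -> R) : (forall x, f x != 0) ->
  continuous f -> continuous (fun x => (f x)^-1).
Proof. by move=> f0 cf x; apply: cvgV; [exact: f0|exact: cf]. Qed.

Lemma cont_sqrt (f : T -> R) :
  continuous f -> continuous (fun x => Num.sqrt (f x)).
Proof. exact/cont_comp/sqrt_continuous. Qed.

Lemma cont_sum (I : finType) (P : pred I) {V : normedModType R}
    (f : I -> T -> V) :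
  (forall i, continuous (f i)) -> continuous (fun x => \sum_(i | P i) f i x).
Proof.
move=> cf; have -> : (fun x => \sum_(i | P i) f i x) = \sum_(i | P i) f i.
  by apply/funext => x; rewrite fct_sumE.
elim/big_ind: _ => //; first exact: cont_cst.
by move=> g h cg ch; exact: contD.
Qed.

Lemma cont_prod (I : finType) (P : pred I) (f : I -> T -> R) :
  (forall i, continuous (f i)) -> continuous (fun x => \prod_(i | P i) f i x).
Proof.
move=> cf; have H (s : seq I) : continuous (fun x => \prod_(i <- s | P i) f i x).
  elim: s => [|i s IH].
    by under eq_fun do rewrite big_nil; exact: cont_cst.
  have [Pi|/negbTE Pi] := boolP (P i); under eq_fun do rewrite big_cons Pi.
    exact: contM.
  exact: IH.
exact: H.
Qed.

Lemma cont_mxP m n (f : T -> 'M[R]_(m, n)) :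
  continuous f <-> forall i j, continuous (fun x => f x i j).
Proof.
split=> [cf i j|cf x A [P lP PA]].
  by apply: (@cont_comp _ _ (fun M : 'M[R]_(m, n) => M i j)) => // M;
    exact: coord_continuous.
have : \forall y \near x, forall i j, P i j (f y i j).
  by apply: filter_forall => i; apply: filter_forall => j; apply: cf; exact: lP.
by apply: filterS => y Px; exact: PA.
Qed.

Lemma cont_mulmx m n k (f : T -> 'M[R]_(m, n)) (g : T -> 'M[R]_(n, k)) :
  continuous f -> continuous g -> continuous (fun x => f x *m g x).
Proof.
move=> /cont_mxP cf /cont_mxP cg; apply/cont_mxP => i j.
under eq_fun do rewrite mxE.
by apply: cont_sum => l; exact: contM.
Qed.

Lemma cont_trmx m n (f : T -> 'M[R]_(m, n)) :
  continuous f -> continuous (fun x => (f x)^T).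
Proof.
move=> /cont_mxP cf; apply/cont_mxP => i j.
by under eq_fun do rewrite mxE; exact: cf.
Qed.

Lemma cont_det n (f : T -> 'M[R]_n) :
  continuous f -> continuous (fun x => \det (f x)).
Proof.
move=> /cont_mxP cf; rewrite /determinant.
apply: cont_sum => s; apply: contM; first exact: cont_cst.
exact: cont_prod.
Qed.

Lemma cont_invmx n (f : T -> 'M[R]_n) : (forall x, f x \in unitmx) ->
  continuous f -> continuous (fun x => invmx (f x)).
Proof.
move=> fu cf; have -> : (fun x => invmx (f x)) =
    (fun x => (\det (f x))^-1 *: \adj (f x)).
  by apply/funext => x; rewrite /invmx fu.
apply: contZ.
  apply: contV => [x|]; last exact: cont_det.
  by have := fu x; rewrite unitmxE unitfE.
apply/cont_mxP => i j; under eq_fun do rewrite mxE /cofactor.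
apply: contM; first exact: cont_cst.
apply: cont_det; apply/cont_mxP => k l; under eq_fun do rewrite !mxE.
by move: cf => /cont_mxP; exact.
Qed.

Lemma cont_qform n (f : T -> 'M[R]_n) (v : T -> 'rV[R]_n) :
  continuous f -> continuous v -> continuous (fun x => qform (f x) (v x)).
Proof.
move=> cf cv; have := cont_mulmx (cont_mulmx cv cf) (cont_trmx cv).
by move=> /cont_mxP; exact.
Qed.

End global_continuity.

Section C1.
Context {R : realType}.
Implicit Types x y u v w : R.

(** The derivative is an argument, so that the derivative of a combination is carried along as a
    formula. *)
Definition C1 {V : normedModType R} (f f' : R -> V) :=
  (forall x, is_derive x 1 f (f' x)) /\ continuous f'.

Lemma C1_derive1 {V : normedModType R} (f f' : R -> V) :
  C1 f f' -> derive1 f = f'.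
Proof. by move=> [df _]; apply/funext => x; rewrite derive1E; have [] := df x. Qed.

Lemma C1_continuous {V : normedModType R} (f f' : R -> V) :
  C1 f f' -> continuous f.
Proof. by move=> [df _] x; exact: is_derive_cvg (df x). Qed.

Lemma C1P {V : normedModType R} (f : R -> V) :
  (forall x, derivable f x 1) -> continuous (derive1 f) -> C1 f (derive1 f).
Proof. by move=> df cf; split => // x; split => //; rewrite derive1E. Qed.

Lemma C1_comp {V : normedModType R} (f f' : R -> V) (g g' : R -> R) :
  C1 f f' -> C1 g g' -> C1 (f \o g) (fun x => g' x *: f' (g x)).
Proof.
move=> [df cf] [dg cg]; split => [x|x].
  exact: is_derive_comp1.
apply: cvgZ; first exact: cg.
by apply: continuous_comp; [exact: is_derive_cvg (dg x)|exact: cf].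
Qed.

Lemma C1_pair {V W : normedModType R} (f f' : R -> V) (g g' : R -> W) :
  C1 f f' -> C1 g g' -> C1 (fun x => (f x, g x)) (fun x => (f' x, g' x)).
Proof.
move=> [df cf] [dg cg]; split => x; first exact: is_derive_pair.
by apply: cvg_pair; [exact: cf|exact: cg].
Qed.

Lemma C1_fst {V W : normedModType R} (f f' : R -> V * W) :
  C1 f f' -> C1 (fun x => (f x).1) (fun x => (f' x).1).
Proof.
move=> [df cf]; split => x; first exact: is_derive_fst.
by apply: continuous_comp; [exact: cf|exact: cvg_fst].
Qed.

Lemma C1_snd {V W : normedModType R} (f f' : R -> V * W) :
  C1 f f' -> C1 (fun x => (f x).2) (fun x => (f' x).2).
Proof.
move=> [df cf]; split => x; first exact: is_derive_snd.
by apply: continuous_comp; [exact: cf|exact: cvg_snd].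
Qed.

Lemma C1D {V : normedModType R} (f f' g g' : R -> V) :
  C1 f f' -> C1 g g' -> C1 (fun x => f x + g x) (fun x => f' x + g' x).
Proof.
move=> [df cf] [dg cg]; split => x; first exact: is_deriveD.
by apply: cvgD; [exact: cf|exact: cg].
Qed.

Lemma C1Z {V : normedModType R} (k : R) (f f' : R -> V) :
  C1 f f' -> C1 (fun x => k *: f x) (fun x => k *: f' x).
Proof.
move=> [df cf]; split => x; first exact: is_deriveZ.
by apply: cvgZr; exact: cf.
Qed.

Lemma C1_cst {V : normedModType R} (k : V) : C1 (fun _ => k) (fun _ => 0).
Proof. by split => x; [exact: is_derive_cst|exact: cvg_cst]. Qed.

Lemma C1_id : C1 (fun x : R => x) (fun _ => 1).
Proof. by split => x; [exact: is_derive_id|exact: cvg_cst]. Qed.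

Lemma C1_scalel {V : normedModType R} (f f' : R -> R) (k : V) :
  C1 f f' -> C1 (fun x => f x *: k) (fun x => f' x *: k).
Proof.
move=> [df cf]; split => x; last by apply: cvgZl; exact: cf.
have := @is_derive_comp1 R V (fun y => y *: k) f x k (f' x).
apply => //; split; first exact/derivable1_diffP/differentiableZl.
by rewrite deriveE ?diffZl//= ?diff_val ?scale1r.
Qed.

Lemma C1_row n (f f' : R -> 'rV[R]_n) :
  (forall j, C1 (fun x => f x 0 j) (fun x => f' x 0 j)) -> C1 f f'.
Proof.
move=> fC; split=> [x|]; first by apply/is_derive_rowP => j; have [] := fC j.
by apply/continuous_rowP => j; have [] := fC j.
Qed.

Lemma C1_coord n (f f' : R -> 'rV[R]_n) j :
  C1 f f' -> C1 (fun x => f x 0 j) (fun x => f' x 0 j).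
Proof.
move=> [df /continuous_rowP cf]; split=> [x|]; last exact: cf.
by have /is_derive_rowP := df x; exact.
Qed.

(** Precomposition with this retraction onto [a, b] turns data controlled only on [a, b] into
    functions on the whole line, to which global continuity statements apply. *)
Definition clamp (a b x : R) : R := Num.max a (Num.min b x).

Lemma clamp_itv a b x : a <= b -> a <= clamp a b x <= b.
Proof. by move=> ab; rewrite /clamp le_max lexx ge_max ab ge_min lexx. Qed.

Lemma clamp_id a b x : a <= x <= b -> clamp a b x = x.
Proof.
by move=> /andP[ax xb]; rewrite /clamp min_r// max_r.
Qed.

Lemma clamp_continuous a b : continuous (clamp a b).
Proof.
move=> x; apply: continuous_max; first exact: cvg_cst.
by apply: continuous_min; [exact: cvg_cst|exact: cvg_id].
Qed.

Lemma near_lt_gt (u x v : R) : u < x < v -> \forall y \near x, u < y < v.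
Proof.
move=> uxv; have : x \in `]u, v[ by rewrite in_itv.
by move=> /near_in_itvoo; apply: filterS => y; rewrite in_itv.
Qed.

Lemma near_lt v x : x < v -> \forall y \near x, y < v.
Proof.
move=> xv; have := @near_lt_gt (x - 1) x v.
by rewrite ltrBlDr ltrDl ltr01 xv => /(_ isT); apply: filterS => y /andP[].
Qed.

Lemma near_gt v x : v < x -> \forall y \near x, v < y.
Proof.
move=> vx; have := @near_lt_gt v x (x + 1).
by rewrite ltrDl ltr01 vx => /(_ isT); apply: filterS => y /andP[].
Qed.

(** Each function is only required to be differentiable on its own closed side, so that a function
    known on an interval can be glued to its tangent line. *)
Lemma is_derive_glue_at {V : normedModType R} (f f' g g' : R -> V) v x :
  f v = g v -> f' v = g' v ->
  (x <= v -> is_derive x 1 f (f' x)) -> (v <= x -> is_derive x 1 g (g' x)) ->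
  is_derive x 1 (fun y => if y < v then f y else g y)
    (if x < v then f' x else g' x).
Proof.
move=> e e' df dg; case: (ltgtP x v) => xv.
- apply: (@near_eq_is_derive _ _ _ f); last exact/df/ltW.
  by have := near_lt xv; apply: filterS => y ->.
- apply: (@near_eq_is_derive _ _ _ g); last exact/dg/ltW.
  by have := near_gt xv; apply: filterS => y vy; rewrite ltNge ltW.
- move: df dg; rewrite xv lexx e' => /(_ isT) df /(_ isT) dg.
  exact: is_derive_glue.
Qed.

Lemma continuous_glue_at {T : topologicalType} (f g : R -> T) v x :
  f v = g v ->
  (x <= v -> {for x, continuous f}) -> (v <= x -> {for x, continuous g}) ->
  {for x, continuous (fun y => if y < v then f y else g y)}.
Proof.
move=> e cf cg; rewrite /prop_for /continuous_at; case: (ltgtP x v) => xv.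
- apply: (cvg_trans (@near_eq_cvg _ _ _ _ f _ _)); last exact/cf/ltW.
  by have := near_lt xv; apply: filterS => y ->.
- apply: (cvg_trans (@near_eq_cvg _ _ _ _ g _ _)); last exact/cg/ltW.
  by have := near_gt xv; apply: filterS => y vy; rewrite ltNge ltW.
- move: cf cg; rewrite xv lexx => /(_ isT) cf /(_ isT) cg.
  move=> A nA; have := cg A nA; have := cf A; rewrite e => /(_ nA).
  rewrite !nbhs_filterE /fmap/= => nf ng; near=> y; rewrite /preimage/=.
  by case: ifP => _; near: y.
Unshelve. all: by end_near. Qed.

End C1.

(** * Extension by tangent lines and inversion of C^1 maps *)

Section C1_extension.
Context {R : realType}.
Implicit Types x y u v w t : R.

Lemma C1_affine {V : normedModType R} (k d : V) u :
  C1 (fun x => k + (x - u) *: d) (fun=> d).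
Proof.
have := C1D (C1_cst k) (C1_scalel d (C1D C1_id (C1_cst (- u)))).
by congr C1; apply/funext => x; rewrite add0r addr0 scale1r.
Qed.

(** The function is continued by its tangent lines at [u] and [v], whence the derivative
    [f' \o clamp u v]. The margins beyond [u] and [v] make the derivatives at these two points
    two-sided. *)
Lemma C1_extend {V : normedModType R} (f f' : R -> V) l u v r :
  l < u -> u <= v -> v < r ->
  (forall x, l < x < r -> is_derive x 1 f (f' x)) ->
  (forall x, l < x < r -> {for x, continuous f'}) ->
  exists F, C1 F (f' \o clamp u v) /\ forall x, u <= x <= v -> F x = f x.
Proof.
move=> lu uv vr df cf.
pose G x := if x < v then f x else f v + (x - v) *: f' v.
pose F x := if x < u then f u + (x - u) *: f' u else G x.
have Gu : G u = f u.
  rewrite /G; case: ltP => // vu; have -> : u = v by apply/le_anti; rewrite uv.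
  by rewrite subrr scale0r addr0.
have E : f' \o clamp u v =
    (fun x => if x < u then f' u else if x < v then f' x else f' v).
  apply/funext => x /=; rewrite /clamp; case: (ltP x u) => xu.
    by rewrite min_r ?max_l ?(le_trans _ uv)// ltW.
  by case: (ltP x v) => xv; rewrite ?min_r ?min_l ?max_r// ltW.
exists F; split; last first.
  move=> x /andP[ux xv]; rewrite /F ltNge ux/= /G; case: ltP => // vx.
  have -> : x = v by apply/le_anti; rewrite xv vx.
  by rewrite subrr scale0r addr0.
have e : f' u = (if u < v then f' u else f' v).
  case: ltP => // vu; congr f'; apply/le_anti; rewrite uv//.
have lr x : u <= x -> x <= v -> l < x < r.
  by move=> ux xv; rewrite (lt_le_trans lu ux) (le_lt_trans xv vr).
have A k (d : V) w x := (C1_affine k d w).1 x.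
rewrite E; split=> x.
  apply: (@is_derive_glue_at _ _ _ (fun=> f' u) G
           (fun x => if x < v then f' x else f' v)) => //.
    by rewrite subrr scale0r addr0 Gu.
  move=> ux; apply: (@is_derive_glue_at _ _ _ _ _ (fun=> f' v)) => //.
    by rewrite subrr scale0r addr0.
  by move=> xv; apply: df; exact: lr.
apply: continuous_glue_at => //; first by move=> _; exact: cvg_cst.
move=> ux; apply: continuous_glue_at => //; last by move=> _; exact: cvg_cst.
by move=> xv; apply: cf; exact: lr.
Qed.

(** Positivity of [f'] is known on [u, v] only. The tangent extension [F] has its derivative bounded
    below by some m > 0 on the whole line, so it is a bijection with Lipschitz inverse, and the
    inverse function rule applies everywhere. *)
Lemma C1_inverse (f f' : R -> R) u v : u <= v -> C1 f f' ->
  (forall x, u <= x <= v -> 0 < f' x) ->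
  exists g g' : R -> R, C1 g g' /\
    forall x, u <= x <= v -> g (f x) = x /\ g' (f x) = (f' x)^-1.
Proof.
move=> uv [df cf] f0.
have [F [[dF cF] Ff]] : exists F : R -> R, C1 F (f' \o clamp u v) /\
    forall x, u <= x <= v -> F x = f x.
  apply: (@C1_extend _ _ _ (u - 1) _ _ (v + 1)) => //.
  - by rewrite ltrBlDr ltrDl.
  - by rewrite ltrDl.
  - by move=> x _; exact: cf.
have [m m0 mF] : exists2 m : R, 0 < m & forall x, m <= f' (clamp u v x).
  have [c /[!in_itv]/= cuv cm] := EVT_min uv (continuous_subspaceT cf).
  exists (f' c); first exact: f0.
  by move=> x; apply: cm; rewrite in_itv/=; exact: clamp_itv.
have Fm x y : x <= y -> m * (y - x) <= F y - F x.
  move=> xy.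
  have [|z _ ->] := @MVT_segment R F (f' \o clamp u v) x y xy (fun z _ => dF z).
  - by apply: continuous_subspaceT => z; exact: is_derive_cvg (dF z).
  - by apply: ler_wpM2r; [rewrite subr_ge0|exact: mF].
have cFF : continuous F by move=> z; exact: is_derive_cvg (dF z).
have surj y : exists x, F x = y.
  (* With slope at least [m], the value [y] is enclosed once one moves the distance |y - F 0| / m to
     both sides of 0. *)
  pose a := - (`|y - F 0| / m); pose b := `|y - F 0| / m.
  have b0 : 0 <= b by rewrite /b divr_ge0// ltW.
  have a0 : a <= 0 by rewrite oppr_le0.
  have mb : m * b = `|y - F 0| by rewrite /b mulrCA mulfV ?mulr1// gt_eqF.
  have [|x _ <-] := @IVT R F a b y (le_trans a0 b0) (continuous_subspaceT cFF).
    have := Fm _ _ a0; have := Fm _ _ b0; rewrite subr0 sub0r opprK mb.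
    have := ler_norm (y - F 0); have := ler_norm (- (y - F 0)); rewrite normrN.
    move=> h1 h2 h3 h4.
    have e1 : F a <= y by lra.
    have e2 : y <= F b by lra.
    by rewrite ge_min e1 le_max e2 orbT.
  by exists x.
pose g y := projT1 (cid (surj y)).
have gK y : F (g y) = y by rewrite /g; case: cid.
have Fgt x y : F x <= F y -> x <= y.
  move=> Fxy; rewrite leNgt; apply/negP => yx.
  have := Fm _ _ (ltW yx); have : 0 < m * (x - y) by rewrite mulr_gt0// subr_gt0.
  by move: Fxy; lra.
have Finj x y : F x = F y -> x = y.
  by move=> e; apply/le_anti/andP; split; apply: Fgt; rewrite e.
have Kg x : g (F x) = x by apply: Finj; rewrite gK.
have glip x y : `|g x - g y| <= m^-1 * `|x - y|.
  wlog xy : x y / g x <= g y.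
    have [xy|/ltW yx] := leP (g x) (g y); first exact.
    by move=> /(_ y x yx); rewrite distrC (distrC y x).
  rewrite mulrC ler_pdivlMr// mulrC.
  have := Fm _ _ xy; rewrite !gK => h.
  rewrite distrC ger0_norm ?subr_ge0//; apply: (le_trans h).
  by rewrite distrC ler_norm.
have cg : continuous g.
  move=> x; apply/cvgrPdist_le => e e0; near=> y.
  apply: (le_trans (glip _ _)); rewrite ler_pdivrMl//.
  near: y; apply/nbhs_ballP; exists (m * e) => /=; first exact: mulr_gt0.
  by move=> y /= /ltW.
have dg x : is_derive x 1 g (f' (clamp u v (g x)))^-1.
  rewrite -{1}(gK x); apply: (@is_derive_inverse _ F).
  - by near=> y; exact: Kg.
  - by near=> y; exact: cFF.
  - by rewrite gt_eqF// (lt_le_trans m0).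
exists g, (fun x => (f' (clamp u v (g x)))^-1); split; first split => //.
  move=> x; apply: cvgV; first by rewrite gt_eqF// (lt_le_trans m0).
  by apply: (@continuous_comp _ _ _ g (f' \o clamp u v)); [exact: cg|exact: cF].
by move=> x xuv; rewrite -(Ff _ xuv) Kg clamp_id.
Unshelve. all: by end_near. Qed.

End C1_extension.

(** * Piecewise C^1 maps through one-sided germs *)

Section interval_induction.
Context {R : realType}.
Implicit Types x y z u v w t d : R.

(** This is compactness of [a, b] for properties of subintervals that can be concatenated. The
    supremum of the points reached from [a] is reached, by the left germ there, and would be passed,
    by the right germ, if it were below [b]. *)
Lemma interval_induction (P : R -> R -> Prop) a b : a < b ->
  (forall x y z, a <= x -> x < y -> y < z -> z <= b ->
    P x y -> P y z -> P x z) ->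
  (forall u, a <= u < b ->
    exists2 d : R, 0 < d & forall w, u < w <= u + d -> w <= b -> P u w) ->
  (forall u, a < u <= b ->
    exists2 d : R, 0 < d & forall w, u - d <= w < u -> a <= w -> P w u) ->
  P a b.
Proof.
move=> ab Ptr Pr Pl.
pose S := [set y | a < y <= b /\ P a y].
have ubS : ubound S b by move=> y [/andP[]].
have hub : has_ubound S by exists b.
have leS y : S y -> y <= sup S by move=> Sy; exact: (ub_le_sup hub).
have [y0 Sy0] : S !=set0.
  have [|d d0 H] := Pr a; first by rewrite lexx.
  exists (Num.min b (a + d)) => /=; split.
    by rewrite lt_min ab ltrDl d0 ge_min lexx.
  by apply: H; rewrite ?lt_min ?ab ?ltrDl ?d0 ?ge_min ?lexx ?orbT.
have hS : has_sup S by split; [exists y0|exists b].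
have sb : sup S <= b by apply: ge_sup => //; exists y0.
have as_ : a < sup S.
  apply: (@lt_le_trans _ _ y0); first by case: Sy0 => /andP[].
  exact: leS.
have Ps : P a (sup S).
  have [|d d0 H] := Pl (sup S); first by rewrite as_.
  have [y Sy sy] := sup_adherent d0 hS.
  have ys : y <= sup S by exact: leS.
  move: ys; rewrite le_eqVlt => /predU1P[<-|ys]; first by case: Sy.
  have [/andP[ay yb] Pay] := Sy.
  apply: (Ptr _ y) => //; apply: H; last exact: ltW.
  by rewrite ys ltW.
move: sb; rewrite le_eqVlt => /predU1P[<-//|sb].
have [|d d0 H] := Pr (sup S); first by rewrite sb ltW.
pose w := Num.min b (sup S + d).
have sw : sup S < w by rewrite lt_min sb ltrDl.
have wb : w <= b by rewrite ge_min lexx.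
have : S w.
  split; first by rewrite (lt_trans as_ sw).
  apply: (Ptr _ (sup S)) => //; apply: H => //.
  by rewrite sw ge_min lexx orbT.
by move=> /leS; rewrite leNgt sw.
Qed.

End interval_induction.

Section piecewise.
Context {R : realType}.
Implicit Types x y z u v w t d : R.

(* Piecewise C^1 maps are described by their one-sided germs, which makes
   refinements of subdivisions unnecessary when such maps are combined. *)
Definition pwC1 {V : normedModType R} (C : R -> V -> V -> Prop)
    (f : R -> V) (a b : R) :=
  (forall u, a <= u < b -> exists (d : R) (c c' : R -> V),
    [/\ 0 < d, u + d <= b, C1 c c' &
        forall w, u <= w <= u + d -> f w = c w /\ C w (c w) (c' w)]) /\
  (forall u, a < u <= b -> exists (d : R) (c c' : R -> V),
    [/\ 0 < d, a <= u - d, C1 c c' &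
        forall w, u - d <= w <= u -> f w = c w /\ C w (c w) (c' w)]).

(** The left germ at [u] leaves out [u] itself: at a break point the value is the one coming from
    the right. The right derivative of a piecewise C^1 map has exactly this regularity. *)
Definition pcont {T : topologicalType} (f : R -> T) (a b : R) :=
  (forall u, a <= u < b -> exists (d : R) (e : R -> T),
    [/\ 0 < d, u + d <= b, continuous e &
        forall w, u <= w < u + d -> f w = e w]) /\
  (forall u, a < u <= b -> exists (d : R) (e : R -> T),
    [/\ 0 < d, a <= u - d, continuous e &
        forall w, u - d <= w < u -> f w = e w]).

(** The right derivative selects one velocity at each break point. At the right end of an interval
    it depends on values outside, so it is only used for [u < b]. *)
Definition rderive {V : normedModType R} (f : R -> V) (u : R) : V :=
  lim (h^-1 *: (f (h + u) - f u) @[h --> (0:R)^'+]).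

Lemma rderiveE {V : normedModType R} (f c : R -> V) u d k : 0 < d ->
  is_derive u 1 c k -> (forall w, u <= w < u + d -> f w = c w) ->
  rderive f u = k.
Proof.
move=> d0 /is_derive1P ck fc; apply: cvg_lim => //.
have : h^-1 *: (c (h + u) - c u) @[h --> 0^'+] --> k.
  apply: cvg_trans ck; apply: cvg_app.
  by apply: (@within_subset R) => h /= h0; rewrite gt_eqF.
apply: cvg_trans; apply: near_eq_cvg; near=> h.
have h0 : 0 < h by [].
rewrite !fc//; first by rewrite lexx ltrDl.
rewrite lerDr (ltW h0) addrC ltrD2l/=.
by near: h; exact: nbhs_right_lt.
Unshelve. all: by end_near. Qed.

Lemma pwC1_sub {V : normedModType R} (C : R -> V -> V -> Prop) f a b x y :
  a <= x -> y <= b -> pwC1 C f a b -> pwC1 C f x y.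
Proof.
move=> ax yb [fr fl]; split=> u /andP[xu uy].
- have [|d [c [c' [d0 db cc' fc]]]] := fr u.
    by rewrite (le_trans ax xu) (lt_le_trans uy yb).
  exists (Num.min d (y - u)), c, c'; split => //.
  + by rewrite lt_min d0 subr_gt0.
  + by rewrite -lerBrDl ge_min lexx orbT.
  + move=> w /andP[uw wd]; apply: fc; rewrite uw (le_trans wd)// lerD2l.
    by rewrite ge_min lexx.
- have [|d [c [c' [d0 db cc' fc]]]] := fl u.
    by rewrite (le_lt_trans ax xu) (le_trans uy yb).
  exists (Num.min d (u - x)), c, c'; split => //.
  + by rewrite lt_min d0 subr_gt0.
  + by rewrite lerBrDr -lerBrDl ge_min lexx orbT.
  + move=> w /andP[uw wd]; apply: fc; rewrite wd andbT (le_trans _ uw)//.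
    by rewrite lerB// ge_min lexx.
Qed.

Lemma pwC1_impl {V : normedModType R} (C D : R -> V -> V -> Prop) f a b :
  (forall u p q, a <= u <= b -> C u p q -> D u p q) ->
  pwC1 C f a b -> pwC1 D f a b.
Proof.
move=> CD [fr fl]; split=> u /andP[xu uy].
- have [|d [c [c' [d0 db cc' fc]]]] := fr u; first by rewrite xu.
  exists d, c, c'; split => // w wd; have [-> ?] := fc w wd; split => //.
  apply: CD => //; case/andP: wd => uw wd.
  by rewrite (le_trans xu uw) (le_trans wd db).
- have [|d [c [c' [d0 db cc' fc]]]] := fl u; first by rewrite xu.
  exists d, c, c'; split => // w wd; have [-> ?] := fc w wd; split => //.
  apply: CD => //; case/andP: wd => uw wd.
  by rewrite (le_trans db uw) (le_trans wd uy).
Qed.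

Lemma eq_pwC1 {V : normedModType R} (C : R -> V -> V -> Prop) f g a b :
  (forall u, a <= u <= b -> f u = g u) -> pwC1 C f a b -> pwC1 C g a b.
Proof.
move=> fg [fr fl]; split=> u /andP[xu uy].
- have [|d [c [c' [d0 db cc' fc]]]] := fr u; first by rewrite xu.
  exists d, c, c'; split => // w /[dup] wd /andP[w1 w2].
  rewrite -fg; first exact: fc.
  by rewrite (le_trans xu w1) (le_trans w2 db).
- have [|d [c [c' [d0 db cc' fc]]]] := fl u; first by rewrite xu.
  exists d, c, c'; split => // w /[dup] wd /andP[w1 w2].
  rewrite -fg; first exact: fc.
  by rewrite (le_trans db w1) (le_trans w2 uy).
Qed.

(** The bridge to the subdivisions that define timelike curves. Interval induction builds a
    subdivision from germs, concatenation being the gluing of two subdivisions; conversely, the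
    piece around a point is found from the least node beyond it. *)
Lemma pwC1_partition {V : normedModType R} (C : R -> V -> V -> Prop) f a b :
  a < b ->
  pwC1 C f a b <->
  exists (k : nat) (s : nat -> R), [/\ s 0%N = a, s k = b &
    forall i, (i < k)%N -> s i < s i.+1 /\
      exists c c' : R -> V, C1 c c' /\
        forall u, s i <= u <= s i.+1 -> f u = c u /\ C u (c u) (c' u)].
Proof.
move=> ab; split=> [fC|[k [s [s0 sk Hs]]]].
  apply: (@interval_induction R (fun a b =>
    exists (k : nat) (s : nat -> R), [/\ s 0%N = a, s k = b &
    forall i, (i < k)%N -> s i < s i.+1 /\
      exists c c' : R -> V, C1 c c' /\
        forall u, s i <= u <= s i.+1 -> f u = c u /\ C u (c u) (c' u)]) a b) => //.
  - move=> x y z ax xy yz zb [k [s [s0 sk Hs]]] [l [r [r0 rl Hr]]].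
    exists (k + l)%N, (fun i => if (i < k)%N then s i else r (i - k)%N); split.
    + case: k sk {Hs} => [|k] sk; last by rewrite ltn0Sn.
      by rewrite ltnn subnn r0 -sk s0.
    + by rewrite ltnNge leq_addr/= addKn.
    + move=> i ikl; case: (ltnP i k) => ik.
        have := Hs _ ik; case: ltnP => // ki.
        have e : i.+1 = k by apply/eqP; rewrite eqn_leq ik ki.
        by rewrite e subnn r0 -sk.
      rewrite ltnNge (leq_trans ik)//= subSn//.
      by apply: Hr; rewrite ltn_subLR.
  - move=> u uab; have [d [c [c' [d0 db cc' fc]]]] := fC.1 u uab.
    exists d => // w /andP[uw wd] wb.
    exists 1%N, (fun i => if i == 0%N then u else w); split => // i.
    rewrite ltnS leqn0 => /eqP ->; split => //; exists c, c'; split => //= v.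
    by move=> /andP[uv vw]; apply: fc; rewrite uv (le_trans vw).
  - move=> u uab; have [d [c [c' [d0 db cc' fc]]]] := fC.2 u uab.
    exists d => // w /andP[uw wd] wb.
    exists 1%N, (fun i => if i == 0%N then w else u); split => // i.
    rewrite ltnS leqn0 => /eqP ->; split => //; exists c, c'; split => //= v.
    by move=> /andP[uv vw]; apply: fc; rewrite vw (le_trans uw).
have ltk i : (i < k)%N -> s i < s i.+1 by move=> /Hs[].
have lej i j : (i <= j)%N -> (j <= k)%N -> s i <= s j.
  elim: j => [|j IH]; first by rewrite leqn0 => /eqP ->.
  rewrite leq_eqVlt => /predU1P[->//|ij jk].
  by rewrite (le_trans (IH _ (ltnW jk)))// ltW// ltk.
split=> u /andP[au ub].
- have [i ik /andP[siu usi]] : exists2 i, (i < k)%N & s i <= u < s i.+1.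
    have : exists i, u < s i by exists k; rewrite sk.
    move=> /ex_minnP[[|i] ui mi]; first by move: ui; rewrite s0 ltNge au.
    exists i; first by rewrite mi// sk.
    by rewrite ui andbT leNgt; apply/negP => /mi; rewrite ltnn.
  have [_ [c [c' [cc' fc]]]] := Hs i ik.
  exists (s i.+1 - u), c, c'; split => //; first by rewrite subr_gt0.
    by rewrite subrKC -sk lej.
  move=> w /andP[uw]; rewrite subrKC => wi; apply: fc.
  by rewrite (le_trans siu uw).
- have [i ik /andP[siu usi]] : exists2 i, (i < k)%N & s i < u <= s i.+1.
    have : exists i, u <= s i by exists k; rewrite sk.
    move=> /ex_minnP[[|i] ui mi]; first by move: ui; rewrite s0 leNgt au.
    exists i; first by rewrite mi// sk.
    by rewrite ui andbT ltNge; apply/negP => /mi; rewrite ltnn.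
  have [_ [c [c' [cc' fc]]]] := Hs i ik.
  exists (u - s i), c, c'; split => //; first by rewrite subr_gt0.
    by rewrite subKr -s0 lej// ltnW.
  move=> w /andP[]; rewrite subKr => sw wu; apply: fc.
  by rewrite sw (le_trans wu usi).
Qed.

(** Each germ at a point controls [f] on its own side, and both take the value of [f] at the point.
    At [a] and at [b] one of the two sides reduces to the point. *)
Lemma pwC1_clamp_continuous {V : normedModType R} (C : R -> V -> V -> Prop) f
    a b : a < b -> pwC1 C f a b -> continuous (f \o clamp a b).
Proof.
move=> ab [fr fl].
suff H x : a <= x <= b -> forall A, nbhs (f x) A ->
    exists2 d : R, 0 < d & forall y, a <= y <= b -> `|x - y| < d -> A (f y).
  move=> x A /= nA; have [d d0 dA] := H _ (clamp_itv x (ltW ab)) A nA.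
  have := @clamp_continuous _ a b x; move/cvgrPdist_lt => /(_ d d0).
  rewrite !nbhs_filterE /fmap/=; apply: filterS => y xy; rewrite /preimage/=.
  by apply: dA => //; exact/clamp_itv/ltW.
move=> /andP[ax xb] A nA.
have HR : exists2 d : R, 0 < d & forall y, x <= y <= b -> `|x - y| < d -> A (f y).
  move: xb; rewrite le_eqVlt => /predU1P[xb|xb].
    exists 1 => // y; rewrite -xb => /le_anti <- _; exact: nbhs_singleton.
  have [|d [c [c' [d0 db cc' fc]]]] := fr x; first by rewrite ax.
  have fx : f x = c x by have [|//] := fc x; rewrite lexx lerDl ltW.
  have := C1_continuous cc' (x := x) (t := A); rewrite -fx => /(_ nA).
  rewrite nbhs_filterE /fmap/= => /nbhs_ballP[r /= r0 rA].
  exists (Num.min r d); first by rewrite lt_min r0.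
  move=> y /andP[xy yb]; rewrite lt_min => /andP[yr yd].
  have [|-> _] := fc y; last exact: rA.
  by rewrite xy/= -lerBlDl; move: yd; rewrite distrC ger0_norm ?subr_ge0// => /ltW.
have HL : exists2 d : R, 0 < d & forall y, a <= y <= x -> `|x - y| < d -> A (f y).
  move: ax; rewrite le_eqVlt => /predU1P[ax|ax].
    exists 1 => // y; rewrite ax => /le_anti <- _; exact: nbhs_singleton.
  have [|d [c [c' [d0 db cc' fc]]]] := fl x; first by rewrite ax.
  have fx : f x = c x by have [|//] := fc x; rewrite lexx lerBlDr lerDl ltW.
  have := C1_continuous cc' (x := x) (t := A); rewrite -fx => /(_ nA).
  rewrite nbhs_filterE /fmap/= => /nbhs_ballP[r /= r0 rA].
  exists (Num.min r d); first by rewrite lt_min r0.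
  move=> y /andP[xy yb]; rewrite lt_min => /andP[yr yd].
  have [|-> _] := fc y; last exact: rA.
  rewrite yb andbT lerBlDr -lerBlDl.
  by move: yd; rewrite ger0_norm ?subr_ge0// => /ltW.
have [d1 d10 H1] := HR; have [d2 d20 H2] := HL.
exists (Num.min d1 d2); first by rewrite lt_min d10.
move=> y /andP[ay yb]; rewrite lt_min => /andP[y1 y2].
case: (leP x y) => [xy|/ltW yx]; first by apply: H1 => //; rewrite xy.
by apply: H2 => //; rewrite ay.
Qed.

Lemma pwC1_rderive {V : normedModType R} (C : R -> V -> V -> Prop) f a b u :
  pwC1 C f a b -> a <= u < b -> C u (f u) (rderive f u).
Proof.
move=> [fr _] /fr[d [c [c' [d0 db [cc' _] fc]]]].
have [|-> Cu] := fc u; first by rewrite lexx lerDl ltW.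
rewrite (@rderiveE _ _ c u d (c' u))// => w /andP[uw wd].
by have [|//] := fc w; rewrite uw ltW.
Qed.

Lemma pcont_rderive {V : normedModType R} (C : R -> V -> V -> Prop) f a b :
  pwC1 C f a b -> pcont (rderive f) a b.
Proof.
move=> [fr fl]; split=> u uab.
- have [d [c [c' [d0 db [cc' c'c] fc]]]] := fr u uab.
  exists d, c'; split => // w /andP[uw wd].
  apply: (@rderiveE _ _ c w (u + d - w)) => //; first by rewrite subr_gt0.
  move=> t /andP[wt]; rewrite subrKC => td.
  by have [|//] := fc t; rewrite (le_trans uw wt) ltW.
- have [d [c [c' [d0 db [cc' c'c] fc]]]] := fl u uab.
  exists d, c'; split => // w /andP[uw wd].
  apply: (@rderiveE _ _ c w (u - w)) => //; first by rewrite subr_gt0.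
  move=> t /andP[wt]; rewrite subrKC => td.
  by have [|//] := fc t; rewrite (le_trans uw wt) ltW.
Qed.

Lemma pcont_pwC1 {V : normedModType R} (C : R -> V -> V -> Prop) f a b :
  pwC1 C f a b -> pcont f a b.
Proof.
move=> [fr fl]; split=> u uab.
- have [d [c [c' [d0 db cc' fc]]]] := fr u uab.
  exists d, c; split => //; first exact: C1_continuous cc'.
  by move=> w /andP[uw wd]; have [|//] := fc w; rewrite uw ltW.
- have [d [c [c' [d0 db cc' fc]]]] := fl u uab.
  exists d, c; split => //; first exact: C1_continuous cc'.
  by move=> w /andP[uw wd]; have [|//] := fc w; rewrite uw ltW.
Qed.

Lemma pcont_comp {T U : topologicalType} (g : R -> T -> U) (f : R -> T) a b :
  continuous (fun x : R * T => g x.1 x.2) -> pcont f a b ->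
  pcont (fun t => g t (f t)) a b.
Proof.
move=> cg [fr fl]; split=> u uab.
- have [d [e [d0 db ce fe]]] := fr u uab.
  exists d, (fun t => g t (e t)); split => //; last by move=> w /fe ->.
  exact: (cont_comp cg (cont_pair cont_id ce)).
- have [d [e [d0 db ce fe]]] := fl u uab.
  exists d, (fun t => g t (e t)); split => //; last by move=> w /fe ->.
  exact: (cont_comp cg (cont_pair cont_id ce)).
Qed.

Lemma pcont_pair {T U : topologicalType} (f : R -> T) (g : R -> U) a b :
  pcont f a b -> pcont g a b -> pcont (fun t => (f t, g t)) a b.
Proof.
move=> [fr fl] [gr gl]; split=> u uab.
- have [d [e [d0 db ce fe]]] := fr u uab.
  have [d' [e' [d'0 d'b ce' fe']]] := gr u uab.
  exists (Num.min d d'), (fun t => (e t, e' t)); split => //.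
  + by rewrite lt_min d0.
  + by rewrite -lerBrDl ge_min lerBrDl db.
  + exact: cont_pair.
  + move=> w /andP[uw]; rewrite -ltrBlDl lt_min !ltrBlDl => /andP[w1 w2].
    by rewrite fe ?fe' ?uw.
- have [d [e [d0 db ce fe]]] := fl u uab.
  have [d' [e' [d'0 d'b ce' fe']]] := gl u uab.
  exists (Num.min d d'), (fun t => (e t, e' t)); split => //.
  + by rewrite lt_min d0.
  + by rewrite lerBrDr -lerBrDl ge_min lerBrDl -lerBrDr db.
  + exact: cont_pair.
  + move=> w /andP[+ wu]; rewrite lerBlDr -lerBlDl le_min !lerBlDl -!lerBlDr.
    by move=> /andP[w1 w2]; rewrite fe ?fe' ?wu ?andbT.
Qed.

End piecewise.

(** * Integrals and primitives of piecewise continuous functions *)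

Section integral_piecewise.
Context {R : realType}.
Implicit Types x y z u v w t d : R.
Local Notation mu := (@lebesgue_measure R).

Lemma itv_integrable (f : R -> R) x y (M : R) : measurable_fun `[x, y] f ->
  (forall t, x <= t <= y -> `|f t| <= M) ->
  mu.-integrable `[x, y] (EFin \o f).
Proof.
move=> mf fM; apply: measurable_bounded_integrable => //.
  exact: (compact_finite_measure (@segment_compact _ _ _)).
exists M; split; first exact: num_real.
move=> N MN t /=; rewrite in_itv/= => /fM h; exact: (le_trans h (ltW MN)).
Qed.

Lemma continuous_bounded (e : R -> R) x y : x <= y -> continuous e ->
  exists M : R, forall t, x <= t <= y -> `|e t| <= M.
Proof.
move=> xy ce.
have cn : continuous (fun t => `|e t|).
  by move=> t; apply: cvg_norm; exact: ce.
have [c _ cM] := EVT_max xy (continuous_subspaceT cn).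
by exists `|e c| => t txy; apply: cM; rewrite in_itv.
Qed.

Lemma continuous_itv_integrable (e : R -> R) x y : continuous e ->
  mu.-integrable `[x, y] (EFin \o e).
Proof.
move=> ce; have [xy|yx] := leP x y; last first.
  by rewrite set_itv_ge ?bnd_simp -?ltNge//; exact: integrable_set0.
have [M eM] := continuous_bounded xy ce.
apply: itv_integrable eM; apply: measurable_funTS.
exact: continuous_measurable_fun.
Qed.

Lemma pcont_bounded_measurable (f : R -> R) a b : a < b -> pcont f a b ->
  measurable_fun `[a, b] f /\ exists M : R, forall t, a <= t <= b -> `|f t| <= M.
Proof.
move=> ab [fr fl].
pose P x y := measurable_fun `[x, y] f /\
              exists M : R, forall t, x <= t <= y -> `|f t| <= M.
(* The germ agrees with [f] on the half-open interval only; the value at [y] is added as a singleton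
   and as a second term of the maximum. *)
have loc x y (e : R -> R) : x < y -> continuous e ->
    (forall w, x <= w < y -> f w = e w) -> P x y.
  move=> xy ce fe; split.
    rewrite -(@setUitv1 _ _ _ _ true) ?bnd_simp ?(ltW xy)//.
    apply/measurable_funU => //; split; last exact: measurable_fun_set1.
    apply: (@eq_measurable_fun _ _ _ _ _ e).
      by move=> t; rewrite inE/= in_itv/= => /fe ->.
    by apply: measurable_funTS; exact: continuous_measurable_fun.
  have [M eM] := continuous_bounded (ltW xy) ce.
  exists (Num.max M `|f y|) => t /andP[xt].
  rewrite le_eqVlt => /predU1P[->|ty]; first by rewrite le_max lexx orbT.
  by rewrite fe ?xt// le_max eM// xt ltW.
apply: (@interval_induction R P a b) => //.
- move=> x y z _ xy yz _ [mx [M1 H1]] [my [M2 H2]]; split.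
    have -> : `[x, z]%classic = `[x, y] `|` `[y, z].
      apply/seteqP; split => t /=; rewrite !in_itv/=.
        case/andP=> xt tz; case: (leP t y) => ty; first by left; rewrite xt.
        by right; rewrite tz ltW.
      case=> /andP[h1 h2]; first by rewrite h1 (le_trans h2)// ltW.
      by rewrite h2 andbT (le_trans _ h1)// ltW.
    by apply/measurable_funU.
  exists (Num.max M1 M2) => t /andP[xt tz].
  case: (leP t y) => ty; first by rewrite le_max H1 ?xt.
  by rewrite le_max H2 ?orbT// tz ltW.
- move=> u /fr[d [e [d0 db ce fe]]]; exists d => // w /andP[uw wd] wb.
  apply: loc ce _ => // t /andP[ut tw]; apply: fe.
  by rewrite ut (lt_le_trans tw).
- move=> u /fl[d [e [d0 db ce fe]]]; exists d => // w /andP[uw wd] wb.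
  apply: loc ce _ => // t /andP[ut tw]; apply: fe.
  by rewrite tw andbT (le_trans uw).
Qed.

Lemma pcont_integrable (f : R -> R) a b x y : a < b -> pcont f a b ->
  a <= x -> y <= b -> mu.-integrable `[x, y] (EFin \o f).
Proof.
move=> ab /(pcont_bounded_measurable ab)[mf [M fM]] ax yb.
apply: (integrableS _ _ _ (itv_integrable mf fM)) => //.
by apply: subset_itv; rewrite bnd_simp.
Qed.

Lemma Rintegral_itv_split (f : R -> R) x y z : x <= y -> y <= z ->
  mu.-integrable `[x, z] (EFin \o f) ->
  \int[mu]_(t in `[x, z]) f t =
  \int[mu]_(t in `[x, y]) f t + \int[mu]_(t in `[y, z]) f t.
Proof.
move=> xy yz fi.
have := @Rintegral_itvB R f (BLeft x) (BRight z) y fi.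
rewrite !bnd_simp => /(_ xy yz) h.
rewrite -[X in _ + X]Rintegral_itv_obnd_cbnd; first by rewrite -h subrKC.
by apply: integrableS fi => //; apply: subset_itv; rewrite bnd_simp.
Qed.

(** The right end point is a null set; it is excluded because germs and right derivatives say
    nothing there. *)
Lemma eq_Rintegral_co (f g : R -> R) x y : x <= y ->
  mu.-integrable `[x, y] (EFin \o f) -> mu.-integrable `[x, y] (EFin \o g) ->
  (forall t, x <= t < y -> f t = g t) ->
  \int[mu]_(t in `[x, y]) f t = \int[mu]_(t in `[x, y]) g t.
Proof.
move=> xy fi gi fg.
have S : `[x, y[ `<=` `[x, y] by apply: subset_itv; rewrite bnd_simp.
rewrite -!Rintegral_itv_bndo_bndc; last 2 first.
- by apply: integrableS gi.
- by apply: integrableS fi.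
by apply: eq_Rintegral => t; rewrite inE/= in_itv/= => /fg.
Qed.

Lemma C1_Rintegral (F f : R -> R) x y : x <= y -> C1 F f ->
  \int[mu]_(t in `[x, y]) f t = F y - F x.
Proof.
rewrite le_eqVlt => /predU1P[->|xy] [dF cf].
  by rewrite set_itv1 Rintegral_set1 subrr.
have cF : continuous F by exact: C1_continuous (conj dF cf).
rewrite /Rintegral (@continuous_FTC2 _ f F)//.
- exact: continuous_subspaceT.
- split.
  + by move=> t _; have [] := dF t.
  + exact: cvg_at_right_filter (cF x).
  + exact: cvg_at_left_filter (cF y).
- by move=> t _; rewrite derive1E; have [] := dF t.
Qed.

Lemma C1_primitive (e : R -> R) u v : u <= v -> continuous e ->
  exists F, C1 F (e \o clamp u v).
Proof.
move=> uv ce.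
(* Integration starts at [u - 1] because the fundamental theorem gives derivatives at interior
   points, and [u] has to be one of them. *)
pose f x := \int[mu]_(t in `[u - 1, x]) e t.
have [|||||F [cF _]] := @C1_extend R _ f e (u - 1) u v (v + 1).
- by rewrite ltrBlDr ltrDl.
- exact: uv.
- by rewrite ltrDl.
- move=> x /andP[ux xv].
  have := @continuous_FTC1_closed R e (u - 1) x (v + 1) xv.
  case=> //; first exact: continuous_itv_integrable.
  - exact: ce.
  - by move=> df <-; rewrite derive1E; exact: derivableP.
- by move=> x _; exact: ce.
by exists F.
Qed.

(** Both sides are additive in the interval, so interval induction reduces the formula to the C^1
    case on a germ. *)
Lemma pwC1_Rintegral (C : R -> R -> R -> Prop) (f : R -> R) a b t :
  a < b -> pwC1 C f a b -> a <= t <= b ->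
  \int[mu]_(s in `[a, t]) rderive f s = f t - f a.
Proof.
move=> ab fC /andP[]; rewrite le_eqVlt => /predU1P[->|at_ tb].
  by rewrite set_itv1 Rintegral_set1 subrr.
have pc := pcont_rderive fC.
have fC' := pwC1_sub (lexx a) tb fC.
apply: (@interval_induction R (fun x y =>
  \int[mu]_(s in `[x, y]) rderive f s = f y - f x) a t) => //.
- move=> x y z ax xy yz zt h1 h2.
  rewrite (@Rintegral_itv_split _ x y z) ?ltW ?h1 ?h2//; first by ring.
  exact: (pcont_integrable ab pc ax (le_trans zt tb)).
- move=> u /[dup] /andP[au _] /fC'.1[d [c [c' [d0 db cc' fc]]]].
  exists d => // w /andP[uw wd] wt.
  rewrite (proj1 (fc w _)) ?(ltW uw)// (proj1 (fc u _)) ?lexx ?lerDl ?ltW//.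
  rewrite -(C1_Rintegral (ltW uw) cc'); apply: eq_Rintegral_co.
  + exact: ltW.
  + exact: (pcont_integrable ab pc au (le_trans wt tb)).
  + by apply: continuous_itv_integrable; case: cc'.
  move=> s /andP[us sw]; apply: (@rderiveE _ _ _ c s (w - s)).
  + by rewrite subr_gt0.
  + exact: cc'.1.
  + move=> r /andP[sr]; rewrite subrKC => rw; apply: (proj1 (fc r _)).
    by rewrite (le_trans us sr) (le_trans (ltW rw) wd).
- move=> u /[dup] /andP[_ ut] /fC'.2[d [c [c' [d0 db cc' fc]]]].
  exists d => // w /andP[uw wd] wt.
  rewrite (proj1 (fc w _)) ?uw ?ltW//.
  rewrite (proj1 (fc u _)); last by rewrite lexx lerBlDr lerDl ltW.
  rewrite -(C1_Rintegral (ltW wd) cc'); apply: eq_Rintegral_co.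
  + exact: ltW.
  + exact: (pcont_integrable ab pc wt (le_trans ut tb)).
  + by apply: continuous_itv_integrable; case: cc'.
  move=> s /andP[us sw]; apply: (@rderiveE _ _ _ c s (u - s)).
  + by rewrite subr_gt0.
  + exact: cc'.1.
  + move=> r /andP[sr]; rewrite subrKC => rw; apply: (proj1 (fc r _)).
    by rewrite (le_trans uw (le_trans us sr)) ltW.
Qed.

Lemma pcont_coord n (f : R -> 'rV[R]_n) j a b :
  pcont f a b -> pcont (fun t => f t 0 j) a b.
Proof.
apply: (@pcont_comp R _ _ (fun _ (v : 'rV[R]_n) => v 0 j)).
apply: (@cont_comp _ _ _ (fun v : 'rV[R]_n => v 0 j)); last exact/cont_snd/cont_id.
by move=> v; exact: coord_continuous.
Qed.

Definition row_primitive n (f : R -> 'rV[R]_n) a t : 'rV[R]_n :=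
  \row_j \int[mu]_(s in `[a, t]) f s 0 j.

(** On a germ the integrand agrees with a continuous function off one end point, so the primitive is
    a constant plus a C^1 primitive. Right derivatives give back [f] at every point before [b], not
    merely almost everywhere. *)
Lemma pwC1_row_primitive n (f : R -> 'rV[R]_n) a b : a < b -> pcont f a b ->
  pwC1 (fun _ _ _ => True) (row_primitive f a) a b /\
  forall t, a <= t < b -> rderive (row_primitive f a) t = f t.
Proof.
move=> ab fp.
have loc u v (e : R -> 'rV[R]_n) : a <= u -> u < v -> v <= b -> continuous e ->
    (forall w, u <= w < v -> f w = e w) ->
    exists c c' : R -> 'rV[R]_n, [/\ C1 c c',
      forall w, u <= w <= v -> row_primitive f a w = c w &
      forall w, u <= w < v -> c' w = f w].
  move=> au uv vb ce fe.
  have cj j : continuous (fun t => e t 0 j) by have /continuous_rowP := ce.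
  have /choice[F FC] j := C1_primitive (ltW uv) (cj j).
  exists (fun w => row_primitive f a u + \row_j (F j w - F j u)),
         (fun w => e (clamp u v w)); split.
  - apply: C1_row => j.
    have := C1D (C1_cst (row_primitive f a u 0 j - F j u)) (FC j).
    congr C1; apply/funext => t; rewrite ?add0r// !mxE.
    by rewrite addrAC addrA.
  - move=> w /andP[uw wv]; apply/rowP => j; rewrite !mxE.
    have fi x y : a <= x -> y <= b ->
        mu.-integrable `[x, y] (EFin \o (fun s => f s 0 j)).
      by apply: pcont_integrable => //; exact: pcont_coord.
    rewrite (@Rintegral_itv_split (fun s => f s 0 j) a u w)//; last first.
      by apply: fi => //; exact: le_trans wv vb.
    congr (_ + _); rewrite -(C1_Rintegral uw (FC j)).
    apply: eq_Rintegral_co => //.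
    + by apply: fi => //; exact: le_trans wv vb.
    + by apply: continuous_itv_integrable; case: (FC j).
    + move=> t /andP[ut tw] /=; rewrite clamp_id ?ut; last first.
        by rewrite (ltW (lt_le_trans tw wv)).
      by rewrite fe// ut (lt_le_trans tw wv).
  - by move=> w /andP[uw wv]; rewrite clamp_id ?uw ?ltW// fe// uw wv.
have R1 u : a <= u < b -> exists (d : R) (c c' : R -> 'rV[R]_n),
    [/\ 0 < d, u + d <= b, C1 c c',
        forall w, u <= w <= u + d -> row_primitive f a w = c w &
        forall w, u <= w < u + d -> c' w = f w].
  move=> /[dup] /andP[au ub] /fp.1[d [e [d0 db ce fe]]].
  have [|c [c' [cc' h1 h2]]] := loc u (u + d) e au _ db ce fe.
    by rewrite ltrDl.
  by exists d, c, c'; split.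
split.
  split=> u uab.
    have [d [c [c' [d0 db cc' h1 h2]]]] := R1 u uab.
    by exists d, c, c'; split => // w /h1.
  have /andP[au ub] := uab.
  have [d [e [d0 db ce fe]]] := fp.2 u uab.
  have [|c [c' [cc' h1 h2]]] := loc (u - d) u e db _ ub ce fe.
    by rewrite ltrBlDr ltrDl.
  by exists d, c, c'; split => // w /h1.
move=> t tab; have [d [c [c' [d0 db cc' h1 h2]]]] := R1 t tab.
rewrite -h2; last by rewrite lexx ltrDl.
apply: (@rderiveE _ _ _ c t d) => //; first exact: cc'.1.
by move=> w /andP[tw wd]; apply: h1; rewrite tw ltW.
Qed.

Lemma closed_left_limit (f : R -> R) x y : x < y -> continuous f ->
  (forall w, x <= w < y -> f w <= 0) -> f y <= 0.
Proof.
move=> xy cf f0; rewrite leNgt; apply/negP => fy.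
have /cvgrPdist_lt/(_ _ fy) := cf y.
move=> /nbhs_ballP[r /= r0 rf].
pose w := Num.max x (y - r / 2).
have wy : w < y by rewrite gt_max xy/= ltrBlDr ltrDl divr_gt0.
have xw : x <= w by rewrite le_max lexx.
have := rf w; rewrite /ball/= ger0_norm ?subr_ge0; last exact: ltW.
have h : y - w < r.
  rewrite ltrBlDr -ltrBlDl lt_max; apply/orP; right.
  by rewrite ltrD2l ltrN2 ltr_pdivrMr// ltr_pMr// ltr1n.
move=> /(_ h); rewrite ltr_norml => /andP[_]; have := f0 w.
by rewrite xw wy => /(_ isT); lra.
Qed.

(** An inequality on the right velocities extends by continuity to the closed germs on both sides,
    in particular to the left velocity at a break point. Only a non-strict inequality survives this
    limit, so a strict one has to be applied with a margin. *)
Lemma pwC1_closed {V : normedModType R} (C : R -> V -> V -> Prop)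
    (Phi : R -> V -> V -> R) f a b :
  continuous (fun x : R * (V * V) => Phi x.1 x.2.1 x.2.2) ->
  pwC1 C f a b ->
  (forall t, a <= t < b -> Phi t (f t) (rderive f t) <= 0) ->
  pwC1 (fun t p q => C t p q /\ Phi t p q <= 0) f a b.
Proof.
move=> cPhi [fr fl] fP; split=> u /[dup] uab /andP[au ub].
- have [d [c [c' [d0 db cc' fc]]]] := fr u uab.
  (* Halving keeps the closed end of the germ below [u + d], where the right derivative of [f] is
     still that of [c]. *)
  exists (d / 2), c, c'.
  have d2 : d / 2 < d by rewrite ltr_pdivrMr// ltr_pMr// ltr1n.
  split => //; first by rewrite divr_gt0.
    by rewrite (le_trans _ db)// lerD2l ltW.
  move=> w /andP[uw wd].
  have wd' : w < u + d by rewrite (le_lt_trans wd)// ltrD2l.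
  have [|-> Cw] := fc w; first by rewrite uw ltW.
  split => //; split => //.
  have [|<- _] := fc w; first by rewrite uw ltW.
  suff <- : rderive f w = c' w.
    by apply: fP; rewrite (le_trans au uw) (lt_le_trans wd' db).
  apply: (@rderiveE _ _ f c w (u + d - w)).
  + by rewrite subr_gt0.
  + exact: cc'.1.
  + move=> r /andP[wr]; rewrite subrKC => rd; apply: (proj1 (fc r _)).
    by rewrite (le_trans uw wr) ltW.
- have [d [c [c' [d0 db cc' fc]]]] := fl u uab.
  exists d, c, c'; split => // w /[dup] wud /andP[uw wu].
  have [-> Cw] := fc w wud; split => //; split => //.
  have H r : u - d <= r < u -> Phi r (c r) (c' r) <= 0.
    move=> /andP[ur ru].
    have [|<- _] := fc r; first by rewrite ur ltW.
    suff <- : rderive f r = c' r.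
      by apply: fP; rewrite (le_trans db ur) (lt_le_trans ru ub).
    apply: (@rderiveE _ _ f c r (u - r)).
    + by rewrite subr_gt0.
    + exact: cc'.1.
    + move=> s /andP[wr]; rewrite subrKC => rd; apply: (proj1 (fc s _)).
      by rewrite (le_trans ur wr) ltW.
  move: wu; rewrite le_eqVlt => /predU1P[->|wu]; last by apply: H; rewrite uw.
  apply: (@closed_left_limit (fun r => Phi r (c r) (c' r)) (u - d)) => //.
    by rewrite ltrBlDr ltrDl.
  have cc := cont_pair cont_id (cont_pair (C1_continuous cc') cc'.2).
  by have := cont_comp cPhi cc.
Qed.

End integral_piecewise.

(** * Positive definite forms *)

Section quadratic_forms.
Context {R : realType}.

Definition bform n (M : 'M[R]_n) (u v : 'rV[R]_n) : R := (u *m M *m v^T) 0 0.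

Definition nsq n (v : 'rV[R]_n) : R := \sum_i v 0 i ^+ 2.

Variable n : nat.
Implicit Types (M : 'M[R]_n) (u v w : 'rV[R]_n) (k : R).

Lemma bform_qform M u : bform M u u = qform M u. Proof. by []. Qed.

Lemma bformDl M u v w : bform M (u + v) w = bform M u w + bform M v w.
Proof. by rewrite /bform !mulmxDl mxE. Qed.

Lemma bformDr M u v w : bform M w (u + v) = bform M w u + bform M w v.
Proof. by rewrite /bform linearD/= mulmxDr mxE. Qed.

Lemma bformZl M k u v : bform M (k *: u) v = k * bform M u v.
Proof. by rewrite /bform -!scalemxAl mxE. Qed.

Lemma bformZr M k u v : bform M u (k *: v) = k * bform M u v.
Proof. by rewrite /bform linearZ/= -scalemxAr mxE. Qed.

Lemma bformC M u v : M^T = M -> bform M u v = bform M v u.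
Proof.
move=> sM; rewrite /bform.
have -> : (u *m M *m v^T) 0 0 = (u *m M *m v^T)^T 0 0 by rewrite [RHS]mxE.
by rewrite !trmx_mul trmxK sM mulmxA.
Qed.

Lemma qformZ M k u : qform M (k *: u) = k ^+ 2 * qform M u.
Proof. by rewrite -!bform_qform bformZl bformZr mulrA. Qed.

Lemma qform0 M : qform M 0 = 0.
Proof. by rewrite /qform !mul0mx mxE. Qed.

Lemma qformD M u v : M^T = M ->
  qform M (u + v) = qform M u + qform M v + 2 * bform M u v.
Proof.
move=> sM; rewrite -!bform_qform bformDl !bformDr (bformC v u sM); ring.
Qed.

Lemma qformB M u v : M^T = M ->
  qform M (u - v) = qform M u + qform M v - 2 * bform M u v.
Proof.
move=> sM; rewrite -scaleN1r (qformD _ _ sM) qformZ bformZr sqrrN expr1n mul1r.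
by rewrite mulN1r mulrN.
Qed.

(** The exact convexity defect. Its last term is the room of order s(1-s) that the deformation
    spends. *)
Lemma qform_convex M (s : R) u v : M^T = M ->
  qform M ((1 - s) *: u + s *: v) =
  (1 - s) * qform M u + s * qform M v - s * (1 - s) * qform M (v - u).
Proof.
move=> sM; rewrite [LHS](qformD _ _ sM) (qformB _ _ sM) !qformZ bformZl bformZr.
rewrite (bformC v u sM); ring.
Qed.

Lemma qform_ge0 M u : posdefmx M -> 0 <= qform M u.
Proof.
move=> [_ pM]; have [->|/pM/ltW//] := eqVneq u 0; by rewrite qform0.
Qed.

Lemma qform_eq0 M u : posdefmx M -> qform M u <= 0 -> u = 0.
Proof.
by move=> [_ pM]; have [//|/pM] := eqVneq u 0; rewrite ltNge => /negbTE ->.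
Qed.

(** Minkowski's inequality in terms of squared radii. Positivity of the form at [s *: u - r *: v]
    bounds the mixed term after division by r s, so a zero radius is treated apart. *)
Lemma qform_triangle M (r s : R) u v : posdefmx M -> 0 <= r -> 0 <= s ->
  qform M u <= r ^+ 2 -> qform M v <= s ^+ 2 -> qform M (u + v) <= (r + s) ^+ 2.
Proof.
move=> pM r0 s0 ur vs; have sM := pM.1.
have [r00|rn0] := eqVneq r 0.
  move: ur; rewrite r00 expr0n/= => /(qform_eq0 pM) ->.
  by rewrite !add0r.
have [s00|sn0] := eqVneq s 0.
  move: vs; rewrite s00 expr0n/= => /(qform_eq0 pM) ->.
  by rewrite !addr0.
have rp : 0 < r by rewrite lt_def rn0.
have sp : 0 < s by rewrite lt_def sn0.
have h : 0 <= qform M (s *: u - r *: v) by exact: qform_ge0.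
rewrite (qformB _ _ sM) !qformZ bformZl bformZr in h.
have h2 : 2 * bform M u v <= 2 * r * s.
  have : r * s * (2 * bform M u v) <= r * s * (2 * r * s).
    have e1 := ler_wpM2l (sqr_ge0 s) ur; have e2 := ler_wpM2l (sqr_ge0 r) vs.
    nra.
  by rewrite ler_pM2l// mulr_gt0.
by rewrite (qformD _ _ sM); nra.
Qed.

Lemma bform_cauchy M u v : posdefmx M ->
  bform M u v ^+ 2 <= qform M u * qform M v.
Proof.
move=> pM; have sM := pM.1.
have [->|u0] := eqVneq u 0.
  by rewrite qform0 mul0r /bform !mul0mx mxE expr0n.
have qu := pM.2 _ u0.
have : 0 <= qform M (qform M u *: v - bform M u v *: u) by exact: qform_ge0.
rewrite (qformB _ _ sM) !qformZ bformZl bformZr (bformC v u sM) => h.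
have : 0 <= qform M u * (qform M u * qform M v - bform M u v ^+ 2) by nra.
by rewrite pmulr_rge0// subr_ge0.
Qed.

Lemma posdefmx_unit M : posdefmx M -> M \in unitmx.
Proof.
move=> [sM pM]; rewrite -row_free_unit -kermx_eq0; apply/eqP/row_matrixP => i.
rewrite row0; apply/eqP; apply/negPn/negP => /pM.
by rewrite /qform -row_mul mulmx_ker row0 mul0mx mxE ltxx.
Qed.

Lemma trmx_invmx M : posdefmx M -> (invmx M)^T = invmx M.
Proof. by move=> [sM _]; rewrite trmx_inv sM. Qed.

Lemma qform_invmx M u : posdefmx M -> qform M (u *m invmx M) = qform (invmx M) u.
Proof.
move=> pM; rewrite /qform trmx_mul (trmx_invmx pM) -!mulmxA.
by rewrite (mulmxA M) mulmxV ?posdefmx_unit// mul1mx.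
Qed.

Lemma posdefmx_inv M : posdefmx M -> posdefmx (invmx M).
Proof.
move=> pM; split; first exact: trmx_invmx.
move=> v v0; rewrite -qform_invmx//; apply: pM.2.
apply: contra v0 => /eqP h.
by rewrite -[v](mulmxKV (posdefmx_unit pM)) h mul0mx.
Qed.

(** The functional is represented by the vector [lam^T *m invmx M], to which Cauchy-Schwarz for [M]
    applies. *)
Lemma dual_pairing_le M (lam : 'cV[R]_n) u : posdefmx M ->
  `|(u *m lam) 0 0| <=
  Num.sqrt (qform (invmx M) lam^T) * Num.sqrt (qform M u).
Proof.
move=> pM.
have -> : (u *m lam) 0 0 = bform M u (lam^T *m invmx M).
  rewrite /bform trmx_mul trmxK (trmx_invmx pM) -mulmxA (mulmxA M).
  by rewrite mulmxV ?posdefmx_unit// mul1mx.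
rewrite -sqrtr_sqr -sqrtrM; last by apply/qform_ge0/posdefmx_inv.
by rewrite ler_wsqrtr// -qform_invmx// mulrC; exact: bform_cauchy.
Qed.

Lemma qformE M u : qform M u = \sum_i \sum_j u 0 i * M i j * u 0 j.
Proof.
rewrite /qform mxE exchange_big/=; apply: eq_bigr => j _.
by rewrite !mxE mulr_suml.
Qed.

Lemma nsq_ge0 u : 0 <= nsq u.
Proof. by apply: sumr_ge0 => i _; exact: sqr_ge0. Qed.

Lemma nsqE u : nsq u = (u *m u^T) 0 0.
Proof. by rewrite mxE; apply: eq_bigr => i _; rewrite mxE expr2. Qed.

Lemma nsq_eq0 u : nsq u = 0 -> u = 0.
Proof.
move=> h; apply/rowP => i; rewrite mxE; apply/eqP; rewrite -sqrf_eq0.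
have := @psumr_eq0P _ _ predT (fun i => u 0 i ^+ 2).
by move=> /(_ (fun i _ => sqr_ge0 _) h i isT) ->.
Qed.

Lemma coord_nsq u i : u 0 i ^+ 2 <= nsq u.
Proof.
rewrite /nsq (bigD1 i)//= lerDl; apply: sumr_ge0 => j _; exact: sqr_ge0.
Qed.

Lemma qform_le_nsq M u : qform M u <= (\sum_i \sum_j `|M i j|) * nsq u.
Proof.
rewrite qformE mulr_suml; apply: ler_sum => i _.
rewrite mulr_suml; apply: ler_sum => j _.
have h : `|u 0 i * u 0 j| <= nsq u.
  have := coord_nsq u i; have := coord_nsq u j.
  rewrite ler_norml; set a := u 0 i; set b := u 0 j => h1 h2.
  have h3 := sqr_ge0 (a - b); have h4 := sqr_ge0 (a + b).
  by apply/andP; split; nra.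
rewrite mulrAC mulrC (le_trans (ler_norm _))// normrM.
by apply: ler_wpM2l.
Qed.

(** Cauchy-Schwarz for [u] and [u *m invmx M], whose [M]-product is the Euclidean square of [u]. The
    constant is explicit in the entries of the inverse, so it can be bounded uniformly along a
    continuous family. *)
Lemma nsq_le_qform M u : posdefmx M ->
  nsq u <= (\sum_i \sum_j `|invmx M i j|) * qform M u.
Proof.
move=> pM; have [/eqP|n0] := eqVneq (nsq u) 0.
  move=> /eqP/nsq_eq0 ->; rewrite qform0 mulr0.
  by rewrite /nsq big1// => i _; rewrite mxE expr0n.
have np : 0 < nsq u by rewrite lt_def n0 nsq_ge0.
have h : nsq u ^+ 2 <= qform M u * qform (invmx M) u.
  rewrite -qform_invmx// nsqE.
  have -> : (u *m u^T) 0 0 = bform M u (u *m invmx M).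
    rewrite /bform trmx_mul (trmx_invmx pM) -mulmxA (mulmxA M).
    by rewrite mulmxV ?posdefmx_unit// mul1mx.
  exact: bform_cauchy.
rewrite -(ler_pM2r np) -expr2 (le_trans h)// [leRHS]mulrAC [leRHS]mulrC.
apply: ler_wpM2l; first exact: qform_ge0.
exact: qform_le_nsq.
Qed.

End quadratic_forms.

Section uniform_bounds.
Context {R : realType} {n : nat}.

Lemma entries_bounded (A : R -> 'M[R]_n) (a c : R) : a <= c -> continuous A ->
  exists2 K : R, 0 < K & forall t, a <= t <= c ->
    \sum_i \sum_j `|A t i j| <= K.
Proof.
move=> ac cA.
have cS : continuous (fun t => \sum_i \sum_j `|A t i j|).
  apply: cont_sum => i; apply: cont_sum => j t; apply: cvg_norm.
  by have /cont_mxP := cA; apply.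
have [K HK] := continuous_bounded ac cS.
exists (Num.max 1 K); first by rewrite lt_max ltr01.
by move=> t /HK h; rewrite le_max (le_trans (ler_norm _) h) orbT.
Qed.

Lemma qform_upper (A : R -> 'M[R]_n) (a c : R) : a <= c -> continuous A ->
  exists2 K : R, 0 < K & forall t z, a <= t <= c -> qform (A t) z <= K * nsq z.
Proof.
move=> ac cA; have [K K0 HK] := entries_bounded ac cA.
exists K => // t z /HK h; apply: (le_trans (qform_le_nsq _ _)).
by apply: ler_wpM2r; [exact: nsq_ge0|].
Qed.

Lemma qform_lower (A : R -> 'M[R]_n) (a c : R) : a <= c -> continuous A ->
  (forall t, posdefmx (A t)) ->
  exists2 K : R, 0 < K & forall t z, a <= t <= c -> nsq z <= K * qform (A t) z.
Proof.
move=> ac cA pA.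
have ci : continuous (fun t => invmx (A t)).
  by apply: cont_invmx => // t; exact: posdefmx_unit.
have [K K0 HK] := entries_bounded ac ci.
exists K => // t z /HK h; apply: (le_trans (nsq_le_qform _ (pA t))).
by apply: ler_wpM2r; [exact: qform_ge0|].
Qed.

End uniform_bounds.

(** * The energy of W_0^{1,2} maps *)

Section integrable_itv.
Context {R : realType}.
Local Notation mu := (@lebesgue_measure R).
Variables (x y : R).
Implicit Types f g : R -> R.

Lemma integrable_itvD f g :
  mu.-integrable `[x, y] (EFin \o f) -> mu.-integrable `[x, y] (EFin \o g) ->
  mu.-integrable `[x, y] (EFin \o (fun t => f t + g t)).
Proof.
move=> fi gi; have -> : EFin \o (fun t => f t + g t) =
  ((EFin \o f) \+ (EFin \o g))%E by apply/funext => t /=; rewrite EFinD.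
exact: integrableD.
Qed.

Lemma integrable_itvZ (k : R) f :
  mu.-integrable `[x, y] (EFin \o f) ->
  mu.-integrable `[x, y] (EFin \o (fun t => k * f t)).
Proof.
move=> fi; have -> : EFin \o (fun t => k * f t) =
  (fun t => k%:E * (EFin \o f) t)%E by apply/funext => t /=; rewrite EFinM.
exact: integrableZl.
Qed.

Lemma integrable_itv_le f g :
  measurable_fun `[x, y] f -> (forall t, x <= t <= y -> `|f t| <= g t) ->
  mu.-integrable `[x, y] (EFin \o g) -> mu.-integrable `[x, y] (EFin \o f).
Proof.
move=> mf fg gi; apply: le_integrable gi => //; first exact/measurable_EFinP.
move=> t /=; rewrite in_itv/= => /fg h; rewrite lee_fin.
exact: (le_trans h (ler_norm _)).
Qed.

Lemma Rintegral_itv_cst (k : R) : x <= y ->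
  \int[mu]_(t in `[x, y]) k = k * (y - x).
Proof.
move=> xy; have := C1_Rintegral xy (C1Z k C1_id).
rewrite -[in RHS]mulrBr => <-; by apply: eq_Rintegral => t _; rewrite [RHS]mulr1.
Qed.

End integrable_itv.

Section weighted_energy.
Context {R : realType}.
Local Notation mu := (@lebesgue_measure R).
Variables (p : nat) (a c : R) (xi dxi : R -> 'rV[R]_p).
Hypotheses (ac : a < c) (Wxi : W012 a c xi dxi).

Local Notation D := `[a, c]%classic.

Let mdxi i : measurable_fun D (fun t => dxi t 0 i).
Proof. by case: Wxi. Qed.

Let nsq_integrable : mu.-integrable D (EFin \o (fun t => nsq (dxi t))).
Proof.
have -> : EFin \o (fun t => nsq (dxi t)) =
    (fun t => \sum_(i < p) ((dxi t 0 i) ^+ 2)%:E)%E.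
  by apply/funext => t /=; rewrite sumEFin.
apply: integrable_sum => // i _; by case: Wxi.
Qed.

(** On a bounded interval square integrability is enough, through |x| <= 1 + x^2. *)
Lemma W012_coord_integrable i :
  mu.-integrable D (EFin \o (fun t => dxi t 0 i)).
Proof.
apply: (@integrable_itv_le _ _ _ _ (fun t => 1 + nsq (dxi t))) => //.
- move=> t _; have := coord_nsq (dxi t) i; rewrite -real_normK ?num_real//.
  have := sqr_ge0 (`|dxi t 0 i| - 1); nra.
- apply: integrable_itvD => //.
  exact: continuous_itv_integrable (@cont_cst _ _ (1:R)).
Qed.

Variables (H : R -> 'M[R]_p) (w : R -> R) (w0 w1 : R).
Hypotheses (cH : continuous H) (pH : forall t, posdefmx (H t))
  (mw : measurable_fun D w) (w00 : 0 < w0)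
  (w0w : forall t, a <= t <= c -> w0 <= w t <= w1).

Lemma W012_energy_integrable :
  mu.-integrable D (EFin \o (fun t => qform (H t) (dxi t) * w t)).
Proof.
have [K K0 HK] := qform_upper (ltW ac) cH.
have w10 : 0 <= w1.
  have := w0w (t := a); rewrite lexx (ltW ac) => /(_ isT) /andP[h1 h2].
  by rewrite (le_trans _ (le_trans h1 h2))// ltW.
apply: (@integrable_itv_le _ _ _ _ (fun t => K * w1 * nsq (dxi t))) => //.
- apply: measurable_funM => //.
  have -> : (fun t => qform (H t) (dxi t)) =
      (fun t => \sum_i \sum_j dxi t 0 i * H t i j * dxi t 0 j).
    by apply/funext => t; rewrite qformE.
  apply: measurable_sum => i; apply: measurable_sum => j.
  apply: measurable_funM; last exact: mdxi.
  apply: measurable_funM; first exact: mdxi.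
  apply: measurable_funTS; apply: continuous_measurable_fun.
  by have /cont_mxP := cH.
- move=> t tac; have /andP[h0 h1] := w0w tac.
  have wt : 0 <= w t by rewrite (le_trans _ h0)// ltW.
  have q0 : 0 <= qform (H t) (dxi t) by exact: qform_ge0.
  rewrite ger0_norm; last by rewrite mulr_ge0.
  rewrite mulrAC; apply: ler_pM => //; exact: HK.
- exact: integrable_itvZ.
Qed.

(** Zero energy would force every integral of a coordinate of [dxi] from [a] to vanish, hence [xi]
    as well. Positivity is what allows the quotients in the constants to be cleared of their
    denominators. *)
Lemma W012_energy_gt0 : (exists2 t, t \in `[a, c] & xi t != 0) ->
  0 < \int[mu]_(t in D) (qform (H t) (dxi t) * w t).
Proof.
move=> [t0 t0ac xit0].
have [K K0 HK] := qform_lower (ltW ac) cH pH.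
set E := \int[mu]_(t in D) _.
have E0 : 0 <= E.
  apply: Rintegral_ge0 => t; rewrite /= in_itv/= => tac.
  have /andP[h0 h1] := w0w tac.
  by rewrite mulr_ge0 ?qform_ge0// (le_trans _ h0)// ltW.
rewrite lt_def E0 andbT; apply/eqP => Eeq0; move/eqP: xit0; apply.
have [_ _ xiE _] := Wxi; rewrite xiE//.
apply/rowP => i; rewrite !mxE.
move: t0ac; rewrite in_itv/= => /andP[at0 t0c].
have SD : `[a, t0]%classic `<=` D by apply: subset_itv; rewrite bnd_simp.
have iD f : mu.-integrable D (EFin \o f) -> mu.-integrable `[a, t0]%classic (EFin \o f).
  by move=> h; apply: integrableS h.
have idx := iD _ (W012_coord_integrable i).
(* |x| <= e + x^2/e pointwise, and the x^2 term integrates to 0. *)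
have key (e : R) : 0 < e ->
    `|\int[mu]_(t in `[a, t0]) dxi t 0 i| <= e * (c - a).
  move=> e0.
  apply: (le_trans (le_normr_Rintegral _ idx)) => //.
  have iE := W012_energy_integrable.
  have icst : mu.-integrable D (EFin \o (fun=> e)).
    exact: continuous_itv_integrable (@cont_cst _ _ e).
  have iZ : mu.-integrable D
      (EFin \o (fun t => (K / (w0 * e)) * (qform (H t) (dxi t) * w t))).
    exact: integrable_itvZ.
  have iS : mu.-integrable D
      (EFin \o (fun t => e + (K / (w0 * e)) * (qform (H t) (dxi t) * w t))).
    exact: integrable_itvD icst iZ.
  have iN : mu.-integrable D (EFin \o (fun t => `|dxi t 0 i|)).
    exact: integrable_norm (W012_coord_integrable i).
  apply: (@le_trans _ _ (\int[mu]_(t in D) `|dxi t 0 i|)).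
    rewrite (@Rintegral_itv_split _ _ a t0 c)//= lerDl.
    by apply: Rintegral_ge0.
  apply: (@le_trans _ _ (\int[mu]_(t in D)
      (e + (K / (w0 * e)) * (qform (H t) (dxi t) * w t)))).
    apply: le_Rintegral => // t; rewrite /= in_itv/= => tac.
    have /andP[h0 h1] := w0w tac.
    have q0 : 0 <= qform (H t) (dxi t) by exact: qform_ge0.
    have h2 := coord_nsq (dxi t) i; have h3 := HK t (dxi t) tac.
    have h4 : dxi t 0 i ^+ 2 / e <= K / (w0 * e) * (qform (H t) (dxi t) * w t).
      rewrite ler_pdivrMr//.
      have -> : K / (w0 * e) * (qform (H t) (dxi t) * w t) * e =
                K * qform (H t) (dxi t) * (w t / w0).
        by field; rewrite ?gt_eqF.
      apply: (le_trans (le_trans h2 h3)); rewrite ler_peMr//.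
        by rewrite mulr_ge0// ltW.
      by rewrite ler_pdivlMr// mul1r.
    apply: le_trans (lerD (lexx e) h4).
    rewrite -[dxi t 0 i ^+ 2]real_normK ?num_real//.
    rewrite -(ler_pM2r e0) mulrDl divfK ?gt_eqF//.
    have := sqr_ge0 (`|dxi t 0 i| - e); have := normr_ge0 (dxi t 0 i); nra.
  rewrite RintegralD// RintegralZl// -/E Eeq0 mulr0 addr0.
  by rewrite Rintegral_itv_cst// ltW.
apply/eqP; rewrite -normr_le0; apply/ler_addgt0Pr => e e0; rewrite add0r.
have ca : 0 < c - a by rewrite subr_gt0.
have := key (e / (c - a)); rewrite divr_gt0// => /(_ isT).
by rewrite divfK// gt_eqF.
Qed.

End weighted_energy.

(** * Regularity of the Schur data *)

Section bilinear_map.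
Context {R : realType} {p q : nat}.
Variable b : 'rV[R]_p -> 'rV[R]_p -> 'rV[R]_q.
Hypotheses (bl : forall v, linear (b v)) (br : forall w, linear (b^~ w)).

Lemma blD v w w' : b v (w + w') = b v w + b v w'.
Proof. by have := bl v 1 w w'; rewrite !scale1r. Qed.
Lemma brD v v' w : b (v + v') w = b v w + b v' w.
Proof. by have := br w 1 v v'; rewrite /= !scale1r. Qed.
Lemma bl0 v : b v 0 = 0.
Proof. by apply: (addrI (b v 0)); rewrite -blD !addr0. Qed.
Lemma br0 w : b 0 w = 0.
Proof. by apply: (addrI (b 0 w)); rewrite -brD !addr0. Qed.
Lemma blZ k v w : b v (k *: w) = k *: b v w.
Proof. by have := bl v k w 0; rewrite !addr0 bl0 addr0. Qed.
Lemma brZ k v w : b (k *: v) w = k *: b v w.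
Proof. by have := br w k v 0; rewrite /= !addr0 br0 addr0. Qed.

Lemma bilinear_sum v w : b v w =
  \sum_i \sum_j (v 0 i * w 0 j) *: b (delta_mx 0 i) (delta_mx 0 j).
Proof.
have sumr (I : Type) (s : seq I) f u :
    b u (\sum_(i <- s) f i) = \sum_(i <- s) b u (f i).
  by elim: s => [|i s IH]; rewrite ?big_nil ?bl0// !big_cons blD IH.
have suml (I : Type) (s : seq I) f u :
    b (\sum_(i <- s) f i) u = \sum_(i <- s) b (f i) u.
  by elim: s => [|i s IH]; rewrite ?big_nil ?br0// !big_cons brD IH.
rewrite {1}(row_sum_delta v) {1}(row_sum_delta w) suml.
apply: eq_bigr => i _; rewrite sumr; apply: eq_bigr => j _.
by rewrite brZ blZ scalerA.
Qed.

Lemma bilinear_continuous {T : topologicalType} (v w : T -> 'rV[R]_p) :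
  continuous v -> continuous w -> continuous (fun t => b (v t) (w t)).
Proof.
move=> cv cw; under eq_fun do rewrite bilinear_sum.
apply: cont_sum => i; apply: cont_sum => j; apply: contZ; last exact: cont_cst.
by move/cont_mxP : cv => cv; move/cont_mxP : cw => cw; exact: contM.
Qed.

End bilinear_map.

Section schur_data.
Context {R : realType}.

(** Linearity is inherited from the Lie bracket by injectivity of [iota], itself a consequence of
    the bijectivity of the splitting. *)
Lemma central_splitting_bilinear (n : vectType R) (br : n -> n -> n) p q
    (sigma : 'rV[R]_p -> n) (iota : 'rV[R]_q -> n)
    (b : 'rV[R]_p -> 'rV[R]_p -> 'rV[R]_q) :
  is_lie_bracket br -> central_splitting br sigma iota b ->
  (forall v, linear (b v)) /\ (forall w, linear (b^~ w)).
Proof.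
move=> [brl brr _ _] [ls li bij _ bE].
have iinj : injective iota.
  move=> z z' e; have [g gK _] := bij.
  move: (gK (0, z)) (gK (0, z')) => /= h1 h2; rewrite e h2 in h1.
  by case: h1.
split=> [v|w] k x y; apply: iinj.
  by rewrite li !bE ls brl.
by rewrite li !bE ls brr.
Qed.

Lemma cont_clamp {T : topologicalType} (f : R -> T) (a c : R) : a <= c ->
  (forall t, a <= t <= c -> {for t, continuous f}) ->
  continuous (fun t => f (clamp a c t)).
Proof.
move=> ac cf t; apply: continuous_comp; first exact: clamp_continuous.
by apply: cf; exact: clamp_itv.
Qed.

Lemma bform_delta n (M : 'M[R]_n) i j :
  bform M (delta_mx 0 i) (delta_mx 0 j) = M i j.
Proof.
rewrite /bform -rowE trmx_delta -colE !mxE; by [].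
Qed.

(** Each entry is a combination of three values of the form, by polarization. *)
Lemma cont_symmetric_mx {T : topologicalType} n (M : T -> 'M[R]_n) :
  (forall t, (M t)^T = M t) ->
  (forall z, continuous (fun t => qform (M t) z)) -> continuous M.
Proof.
move=> sM cM; apply/cont_mxP => i j.
have -> : (fun t => M t i j) = (fun t => 2^-1 *
    (qform (M t) (delta_mx 0 i + delta_mx 0 j) - qform (M t) (delta_mx 0 i)
     - qform (M t) (delta_mx 0 j))).
  apply/funext => t; rewrite qformD// bform_delta; by field.
apply: contM; first exact: cont_cst.
by do 2 (apply: contB; last exact: cM); exact: cM.
Qed.

Variables (p q : nat) (b : 'rV[R]_p -> 'rV[R]_p -> 'rV[R]_q).
Hypothesis br : forall w, linear (b^~ w).

Variables (tm tp : \bar R)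
  (h : R -> 'rV[R]_p * 'rV[R]_q -> 'rV[R]_p * 'rV[R]_q ->
       'rV[R]_p * 'rV[R]_q -> R)
  (H : R -> 'M[R]_p) (A : R -> 'M[R]_q) (L : R -> 'M[R]_(p, q)).
Hypotheses (Hsmooth : forall x u w, smooth_on tm tp (fun t => h t x u w))
  (Hschur : forall t, (tm < t%:E < tp)%E -> schur_form b (h t) (H t) (A t) (L t)).

Lemma smooth_on_clamp (f : R -> R) (a c : R) : a <= c ->
  (tm < a%:E)%E -> (c%:E < tp)%E -> smooth_on tm tp f ->
  continuous (fun t => f (clamp a c t)).
Proof.
move=> ac ta ct fs; apply: cont_clamp => // t /andP[a_t tc].
have /(_ _)/derivable1_diffP/differentiable_continuous := fs 0%N t; apply.
by rewrite (lt_le_trans ta)//= ?lee_fin// (le_lt_trans _ ct)// lee_fin.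
Qed.

Variables (a c : R).
Hypotheses (ac : a <= c) (ta : (tm < a%:E)%E) (ct : (c%:E < tp)%E).
Local Notation cl := (clamp a c).

Lemma clamp_dom t : (tm < (cl t)%:E < tp)%E.
Proof.
have /andP[h1 h2] := clamp_itv t ac.
by rewrite (lt_le_trans ta) ?lee_fin//= (le_lt_trans _ ct)// lee_fin.
Qed.

Let posH t : posdefmx (H (cl t)).
Proof. by have [] := Hschur (clamp_dom t). Qed.

Let posA t : posdefmx (A (cl t)).
Proof. by have [] := Hschur (clamp_dom t). Qed.

Let hE t v z : h (cl t) 0 (v, z) (v, z) =
  qform (H (cl t)) v + qform (A (cl t)) (z + v *m L (cl t)).
Proof.
have [_ _ ->] := Hschur (clamp_dom t).
by rewrite /Theta /= (br0 br) scaler0 subr0.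
Qed.

Let ch u : continuous (fun t => h (cl t) 0 u u).
Proof.
have hs := @smooth_on_clamp (fun t => h t 0 u u) a c ac ta ct (@Hsmooth 0 u u).
by move=> t; apply: hs.
Qed.

(** Smoothness is assumed of [h], not of its Schur data; their continuity is recovered in the order
    [A], [L], [H]. At the identity [Theta] is dz, and vertical vectors see [A] alone. *)
Lemma schur_A_continuous : continuous (fun t => A (cl t)).
Proof.
apply: cont_symmetric_mx => [t|z]; first by have [] := posA t.
have -> : (fun t => qform (A (cl t)) z) = (fun t => h (cl t) 0 (0, z) (0, z)).
  by apply/funext => t; rewrite hE qform0 mul0mx addr0 add0r.
exact: ch.
Qed.

(** Polarizing [h] between horizontal and vertical vectors gives the product of [A] with the
    transpose of [L]; then [A] is inverted. *)
Lemma schur_L_continuous : continuous (fun t => L (cl t)).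
Proof.
have cAL : continuous (fun t => A (cl t) *m (L (cl t))^T).
  apply/cont_mxP => i j.
  have -> : (fun t => (A (cl t) *m (L (cl t))^T) i j) = (fun t => 2^-1 *
      (h (cl t) 0 (delta_mx 0 j, delta_mx 0 i) (delta_mx 0 j, delta_mx 0 i) -
       h (cl t) 0 (delta_mx 0 j, 0) (delta_mx 0 j, 0) -
       h (cl t) 0 (0, delta_mx 0 i) (0, delta_mx 0 i))).
    apply/funext => t; rewrite !hE mul0mx qform0 !add0r addr0.
    rewrite qformD; last by have [] := posA t.
    have -> : bform (A (cl t)) (delta_mx 0 i) (delta_mx 0 j *m L (cl t)) =
        (A (cl t) *m (L (cl t))^T) i j.
      rewrite /bform trmx_mul trmx_delta mulmxA -colE -!mulmxA -rowE.
      by rewrite !mxE; apply: eq_bigr => k _; rewrite !mxE.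
    by field.
  apply: contM; first exact: cont_cst.
  by do 2 (apply: contB; last exact: ch); exact: ch.
have -> : (fun t => L (cl t)) =
    (fun t => (invmx (A (cl t)) *m (A (cl t) *m (L (cl t))^T))^T).
  apply/funext => t; rewrite mulmxA mulVmx ?mul1mx ?trmxK//.
  exact: posdefmx_unit.
apply: cont_trmx; apply: cont_mulmx => //.
apply: cont_invmx; last exact: schur_A_continuous.
by move=> t; exact: posdefmx_unit.
Qed.

Lemma schur_H_continuous : continuous (fun t => H (cl t)).
Proof.
apply: cont_symmetric_mx => [t|v]; first by have [] := posH t.
have -> : (fun t => qform (H (cl t)) v) = (fun t =>
    h (cl t) 0 (v, 0) (v, 0) - qform (A (cl t)) (v *m L (cl t))).
  by apply/funext => t; rewrite hE add0r addrK.
apply: contB; first exact: ch.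
apply: cont_qform; first exact: schur_A_continuous.
by apply: cont_mulmx; [exact: cont_cst|exact: schur_L_continuous].
Qed.

End schur_data.

Section a_plus.
Context {R : realType} {q : nat}.
Variables (S : 'M[R]_q).
Hypothesis pS : posdefmx S.

Lemma a_plus_bounded (A : 'M[R]_q) (K : R) : 0 <= K ->
  (forall z, qform A z <= K * qform S z) ->
  ubound [set r | exists2 z : 'rV[R]_q, z != 0 &
                 r = Num.sqrt (qform A z) / Num.sqrt (qform S z)] (Num.sqrt K).
Proof.
move=> K0 AK r [z z0 ->].
have S0 := pS.2 _ z0.
by rewrite ler_pdivrMr ?sqrtr_gt0// -sqrtrM// ler_wsqrtr.
Qed.

Lemma le_a_plus (A : 'M[R]_q) (z : 'rV[R]_q) : posdefmx A -> z != 0 ->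
  Num.sqrt (qform A z) / Num.sqrt (qform S z) <= a_plus S A.
Proof.
move=> pA z0; apply: ub_le_sup; last by exists z.
pose K := (\sum_i \sum_j `|A i j|) * (\sum_i \sum_j `|invmx S i j|).
exists (Num.sqrt K); apply: a_plus_bounded.
  by rewrite mulr_ge0//; do 2 apply: sumr_ge0 => ? _.
move=> y; apply: (le_trans (qform_le_nsq _ _)); rewrite -mulrA.
apply: ler_wpM2l; last exact: nsq_le_qform.
by do 2 apply: sumr_ge0 => ? _.
Qed.

Lemma a_plus_le (A : 'M[R]_q) (K : R) : (exists z : 'rV[R]_q, z != 0) ->
  0 <= K -> (forall z, qform A z <= K * qform S z) -> a_plus S A <= Num.sqrt K.
Proof.
move=> [z z0] K0 AK; apply: ge_sup; last exact: a_plus_bounded.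
by exists (Num.sqrt (qform A z) / Num.sqrt (qform S z)), z.
Qed.

(** A supremum of functions continuous in t is lower semicontinuous, hence measurable. A nonzero
    vector is needed for the supremum to be over a nonempty set. *)
Lemma a_plus_measurable (A : R -> 'M[R]_q) : (exists z : 'rV[R]_q, z != 0) ->
  (forall t, posdefmx (A t)) -> continuous A ->
  measurable_fun setT (fun t => a_plus S (A t)).
Proof.
move=> [z0 z00] pA cA; apply/measurable_EFinP.
apply: lower_semicontinuous_measurable => t r /=; rewrite lte_fin => rt.
have [|y [z zn0 ->] ry] := sup_gt _ rt.
  by exists (Num.sqrt (qform (A t) z0) / Num.sqrt (qform S z0)), z0.
pose f s := Num.sqrt (qform (A s) z) / Num.sqrt (qform S z).
have cf : continuous f.
  apply: contM; last exact: cont_cst.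
  by apply: cont_sqrt; apply: cont_qform => //; exact: cont_cst.
exists [set s | r < f s].
  by have /cvgr_gt := cf t; exact.
by move=> s rs; rewrite lte_fin (lt_le_trans rs)//; exact: le_a_plus.
Qed.

End a_plus.

(** * Comparison of the three constants *)

Section sup0.
Context {R : realType}.

Lemma sup0_le (S S' : set (\bar R)) :
  (forall r, S r -> exists2 r', (0%E |` S') r' & (r <= r')%E) ->
  (Defs.sup0 S <= Defs.sup0 S')%E.
Proof.
move=> SS'; apply: ge_ereal_sup => r [->|/SS'[r' S'r' rr']].
  by apply: ereal_sup_ubound; left.
by apply: (le_trans rr'); exact: ereal_sup_ubound.
Qed.

Lemma sup0_ub (S : set (\bar R)) r : S r -> (r <= Defs.sup0 S)%E.
Proof. by move=> Sr; apply: ereal_sup_ubound; right. Qed.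

End sup0.

Section clamped_bounds.
Context {R : realType}.
Variables (a c : R) (ac : a < c).

Lemma eq_clamp {T} (f : R -> T) t : a <= t <= c -> f (clamp a c t) = f t.
Proof. by move=> /clamp_id ->. Qed.

Lemma clamp_measurable (f : R -> R) : continuous (fun t => f (clamp a c t)) ->
  measurable_fun `[a, c] f.
Proof.
move=> cf; apply: (@eq_measurable_fun _ _ _ _ _ (fun t => f (clamp a c t))).
  by move=> t; rewrite inE/= in_itv/= => /eq_clamp.
by apply: measurable_funTS; exact: continuous_measurable_fun.
Qed.

Lemma clamp_pos_bounds (f : R -> R) : continuous (fun t => f (clamp a c t)) ->
  (forall t, a <= t <= c -> 0 < f t) ->
  exists w0 w1 : R, 0 < w0 /\ forall t, a <= t <= c -> w0 <= f t <= w1.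
Proof.
move=> cf f0.
have [m + mf] := EVT_min (ltW ac) (continuous_subspaceT cf).
have [M _ Mf] := EVT_max (ltW ac) (continuous_subspaceT cf).
rewrite in_itv/= => mac.
exists (f (clamp a c m)), (f (clamp a c M)); split.
  by apply: f0; exact/clamp_itv/ltW.
move=> t tac; have tac' : t \in `[a, c] by rewrite in_itv.
by have := mf t tac'; have := Mf t tac'; rewrite !(clamp_id tac) => -> ->.
Qed.

End clamped_bounds.

Section energy.
Context {R : realType}.
Local Notation mu := (@lebesgue_measure R).
Variables (p : nat) (a c : R) (xi dxi : R -> 'rV[R]_p) (H : R -> 'M[R]_p).
Hypotheses (ac : a < c) (Wxi : W012 a c xi dxi)
  (cH : continuous (fun t => H (clamp a c t)))
  (pH : forall t, a <= t <= c -> posdefmx (H t)).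

Lemma energy_integrable_gt0 (w : R -> R) (w0 w1 : R) :
  measurable_fun `[a, c] w -> 0 < w0 ->
  (forall t, a <= t <= c -> w0 <= w t <= w1) ->
  mu.-integrable `[a, c] (EFin \o (fun t => qform (H t) (dxi t) * w t)) /\
  ((exists2 t, t \in `[a, c] & xi t != 0) ->
   0 < \int[mu]_(t in `[a, c]) (qform (H t) (dxi t) * w t)).
Proof.
move=> mw w00 w0w.
have pH' t : posdefmx (H (clamp a c t)).
  by apply: pH; exact/clamp_itv/ltW.
split=> [|xi0].
  have := W012_energy_integrable ac Wxi cH pH' mw w00 w0w.
  apply: eq_integrable => // t; rewrite inE/= in_itv/= => tac.
  by rewrite clamp_id.
have := W012_energy_gt0 ac Wxi cH pH' mw w00 w0w xi0.
congr (_ < _); apply: eq_Rintegral => t; rewrite inE/= in_itv/= => tac.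
by rewrite clamp_id.
Qed.

Lemma energy_integrable_gt0_continuous (w : R -> R) :
  continuous (fun t => w (clamp a c t)) ->
  (forall t, a <= t <= c -> 0 < w t) ->
  mu.-integrable `[a, c] (EFin \o (fun t => qform (H t) (dxi t) * w t)) /\
  ((exists2 t, t \in `[a, c] & xi t != 0) ->
   0 < \int[mu]_(t in `[a, c]) (qform (H t) (dxi t) * w t)).
Proof.
move=> cw w0.
have [w0' [w1 [w00 w0w]]] := clamp_pos_bounds ac cw w0.
apply: energy_integrable_gt0 w00 w0w; exact: clamp_measurable cw.
Qed.

End energy.

Section kappa_comparison.
Context {R : realType}.
Local Notation mu := (@lebesgue_measure R).
Variables (p q : nat) (b : 'rV[R]_p -> 'rV[R]_p -> 'rV[R]_q).
Hypothesis br : forall w, linear (b^~ w).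
Variables (tm tp : \bar R) (N : R -> R)
  (h : R -> 'rV[R]_p * 'rV[R]_q -> 'rV[R]_p * 'rV[R]_q ->
       'rV[R]_p * 'rV[R]_q -> R)
  (H : R -> 'M[R]_p) (A : R -> 'M[R]_q) (L : R -> 'M[R]_(p, q)).
Hypotheses (HNpos : forall t, (tm < t%:E < tp)%E -> 0 < N t)
  (HNsmooth : smooth_on tm tp N)
  (Hsmooth : forall x u w, smooth_on tm tp (fun t => h t x u w))
  (Hschur : forall t, (tm < t%:E < tp)%E -> schur_form b (h t) (H t) (A t) (L t)).
Variable (T : R).
Hypothesis HT : (tm < T%:E < tp)%E.

Section fixed_interval.
Variables (a c : R) (xi dxi : R -> 'rV[R]_p).
Hypotheses (ta : (tm < a%:E)%E) (acT : a < c < T) (Wxi : W012 a c xi dxi).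

Let ac : a < c. Proof. by case/andP: acT. Qed.
Let ctp : (c%:E < tp)%E.
Proof.
by case/andP: HT => _; apply: lt_trans; rewrite lte_fin; case/andP: acT.
Qed.

Lemma itv_dom t : a <= t <= c -> (tm < t%:E < tp)%E.
Proof.
move=> /andP[h1 h2].
by rewrite (lt_le_trans ta) ?lee_fin//= (le_lt_trans _ ctp)// lee_fin.
Qed.

Let Npos t : a <= t <= c -> 0 < N t.
Proof. by move=> /itv_dom; exact: HNpos. Qed.
Let pH t : a <= t <= c -> posdefmx (H t).
Proof. by move=> /itv_dom/Hschur[]. Qed.
Let pA t : a <= t <= c -> posdefmx (A t).
Proof. by move=> /itv_dom/Hschur[]. Qed.
Let cN : continuous (fun t => N (clamp a c t)).
Proof. exact: (smooth_on_clamp (ltW ac) ta ctp HNsmooth). Qed.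
Let cA : continuous (fun t => A (clamp a c t)).
Proof. exact: (schur_A_continuous br Hsmooth Hschur (ltW ac) ta ctp). Qed.
Let cH : continuous (fun t => H (clamp a c t)).
Proof. exact: (schur_H_continuous br Hsmooth Hschur (ltW ac) ta ctp). Qed.
Let clac t : a <= clamp a c t <= c.
Proof. exact/clamp_itv/ltW. Qed.

Lemma Qform_eq0 : ~ (exists2 t, t \in `[a, c] & xi t != 0) ->
  Qform b a c xi dxi = 0.
Proof.
move=> xi0; rewrite /Qform; apply/rowP => j; rewrite !mxE.
rewrite (@eq_Rintegral _ _ _ _ _ (fun=> 0)) ?Rintegral_itv_cst ?mul0r ?mulr0//.
  exact: ltW.
move=> t; rewrite inE => tac; have -> : xi t = 0.
  by apply/eqP; apply/negPn/negP => h1; apply: xi0; exists t.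
by rewrite (br0 br) mxE.
Qed.

Lemma opt_energy lam : lam != 0 ->
  let w t := (N t)^-1 * Num.sqrt (qform (invmx (A t)) lam^T) in
  [/\ mu.-integrable `[a, c] (EFin \o (fun t => qform (H t) (dxi t) * w t)),
   (exists2 t, t \in `[a, c] & xi t != 0) ->
   0 < \int[mu]_(t in `[a, c]) (qform (H t) (dxi t) * w t) &
   \int[mu]_(t in `[a, c]) (qform (H t) (dxi t) / N t *
                Num.sqrt (qform (invmx (A t)) lam^T)) =
   \int[mu]_(t in `[a, c]) (qform (H t) (dxi t) * w t)].
Proof.
move=> lam0 w.
have [|t tac|h1 h2] := @energy_integrable_gt0_continuous _ _ a c xi dxi H ac Wxi
    cH pH w.
- apply: contM.
    by apply: contV => // t; rewrite gt_eqF// Npos.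
  apply: cont_sqrt; apply: cont_qform; last exact: cont_cst.
  by apply: cont_invmx => // t; apply: posdefmx_unit; exact: pA.
- rewrite /w mulr_gt0 ?invr_gt0 ?Npos// sqrtr_gt0.
  apply: (posdefmx_inv (pA tac)).2; apply: contra lam0 => /eqP e.
  by rewrite -[lam]trmxK e trmx0.
- by split => //; apply: eq_Rintegral => t _; rewrite mulrA.
Qed.

Lemma an_energy z : z != 0 ->
  let w t := (N t * Num.sqrt (qform (A t) z))^-1 in
  mu.-integrable `[a, c] (EFin \o (fun t => qform (H t) (dxi t) * w t)) /\
  ((exists2 t, t \in `[a, c] & xi t != 0) ->
   0 < \int[mu]_(t in `[a, c]) (qform (H t) (dxi t) * w t)).
Proof.
move=> z0 w; have P t : a <= t <= c -> 0 < N t * Num.sqrt (qform (A t) z).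
  by move=> tac; rewrite mulr_gt0 ?Npos// sqrtr_gt0; exact: (pA tac).2.
apply: (energy_integrable_gt0_continuous ac Wxi cH pH).
- apply: contV; first by move=> t; rewrite gt_eqF// P.
  apply: contM => //; apply: cont_sqrt; apply: cont_qform => //.
  exact: cont_cst.
- by move=> t tac; rewrite /w invr_gt0 P.
Qed.

(** The weight is handled through measurability and two-sided bounds, since [a_plus] is only shown
    to be measurable in t. *)
Lemma Sch_energy (S : 'M[R]_q) : posdefmx S -> (exists z : 'rV[R]_q, z != 0) ->
  let w t := (N t * a_plus S (A t))^-1 in
  mu.-integrable `[a, c] (EFin \o (fun t => qform (H t) (dxi t) * w t)) /\
  ((exists2 t, t \in `[a, c] & xi t != 0) ->
   0 < \int[mu]_(t in `[a, c]) (qform (H t) (dxi t) * w t)).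
Proof.
move=> pS [z z0] w.
have pAc t : posdefmx (A (clamp a c t)) by exact: pA.
pose f t := Num.sqrt (qform (A t) z) / Num.sqrt (qform S z).
have Sz : 0 < Num.sqrt (qform S z) by rewrite sqrtr_gt0; exact: pS.2.
(* A single vector [z] bounds [a_plus] from below by a continuous positive function of t. *)
have [m0 [m1 [m00 mf]]] : exists m0 m1 : R, 0 < m0 /\
    forall t, a <= t <= c -> m0 <= f t <= m1.
  apply: clamp_pos_bounds => //.
  - apply: contM; last exact: cont_cst.
    by apply: cont_sqrt; apply: cont_qform => //; exact: cont_cst.
  - move=> t tac; rewrite divr_gt0// sqrtr_gt0; exact: (pA tac).2.
have [n0 [n1 [n00 nf]]] := clamp_pos_bounds ac cN Npos.
have [K1 K10 HK1] := qform_upper (ltW ac) cA.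
have aup t : a <= t <= c ->
    a_plus S (A t) <= Num.sqrt (K1 * \sum_i \sum_j `|invmx S i j|).
  move=> tac; apply: a_plus_le => //; first by exists z.
    apply: mulr_ge0; first exact: ltW.
    by do 2 apply: sumr_ge0 => ? _.
  move=> y; have := HK1 t y tac; rewrite clamp_id// => /le_trans; apply.
  rewrite -mulrA; apply: ler_wpM2l; first exact: ltW.
  exact: nsq_le_qform.
set a1 := Num.sqrt _ in aup.
have alo t : a <= t <= c -> m0 <= a_plus S (A t).
  move=> tac; have /andP[h1 _] := mf t tac.
  by apply: (le_trans h1); exact: (le_a_plus pS (pA tac) z0).
have a10 : 0 < a1.
  have aac : a <= a <= c by rewrite lexx ltW.
  by rewrite (lt_le_trans m00)// (le_trans (alo a aac))// aup.
have n10 : 0 < n1.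
  have aac : a <= a <= c by rewrite lexx ltW.
  by have /andP[h1 h2] := nf a aac; rewrite (lt_le_trans n00)// (le_trans h1).
apply: (@energy_integrable_gt0 _ _ _ _ _ _ _ ac Wxi cH pH w
          (n1 * a1)^-1 (n0 * m0)^-1).
(* The inverse is written as a power with exponent -1, which is a measurable function; the two agree
   on nonnegative numbers. *)
- apply: (@eq_measurable_fun _ _ _ _ _ (fun t =>
      powR (N (clamp a c t) * a_plus S (A (clamp a c t))) (-1))).
    move=> t; rewrite inE/= in_itv/= => tac; rewrite clamp_id// powR_inv1//.
    by rewrite mulr_ge0 ?(ltW (Npos tac))// (le_trans (ltW m00))// alo.
  apply: measurable_funTS.
  apply: (@measurableT_comp _ _ _ _ _ _ (fun x => powR x (-1))).
    exact: measurable_powR.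
  apply: measurable_funM; first exact: continuous_measurable_fun.
  by apply: a_plus_measurable => //; exists z.
- by rewrite invr_gt0 mulr_gt0.
- move=> t tac; have /andP[h1 h2] := nf t tac.
  have h3 := alo t tac; have h4 := aup t tac.
  have p1 : 0 < N t by exact: Npos.
  have p2 : 0 < a_plus S (A t) by exact: lt_le_trans h3.
  rewrite /w !lef_pV2 ?posrE ?mulr_gt0//.
  by rewrite !ler_pM// ltW.
Qed.

End fixed_interval.

(** Pointwise in t one has |lam(Q)| / |Q|_A <= |lam| in the dual norm, and integration against H / N
    compares the two quotients for the same [xi]. If Q = 0 the quotient is 0, the default element of
    [sup0]. *)
Lemma kappa_opt_le_an : (kappa_opt b tm T N H A <= kappa_an b tm T N H A)%E.
Proof.
apply: sup0_le => r [a [c [xi [dxi [lam [[ta acT] Wxi xi0 lam0 ->]]]]]].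
have [Q0|Q0] := eqVneq (Qform b a c xi dxi) 0.
  by exists 0%E; [left|rewrite Q0 mul0mx mxE normr0 mul0r].
have [i1 p1 ->] := opt_energy ta acT Wxi lam0.
have [i2 p2] := an_energy ta acT Wxi Q0.
eexists; first by right; exists a, c, xi, dxi.
rewrite lee_fin.
rewrite ler_pdivrMr ?p1// ler_pdivlMl ?p2// mulrC -RintegralZl//.
apply: le_Rintegral => //; first exact: integrable_itvZ.
move=> t; rewrite /= in_itv/= => tac.
have [pHt pAt _] := Hschur (itv_dom ta acT tac).
have Nt := HNpos (itv_dom ta acT tac).
rewrite mulrCA; apply: ler_wpM2l; first exact: qform_ge0.
have sA : 0 < Num.sqrt (qform (A t) (Qform b a c xi dxi)).
  by rewrite sqrtr_gt0; exact: pAt.2.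
rewrite invfM mulrCA ler_pM2l ?invr_gt0// ler_pdivrMr//.
exact: dual_pairing_le.
Qed.

(** Pointwise in t one has |Q|_A <= a_+ |Q| in the fixed norm. Here Q is nonzero, which forces [xi]
    to be nonzero and the energies to be positive. *)
Lemma kappa_an_le_Sch (S : 'M[R]_q) : posdefmx S ->
  (kappa_an b tm T N H A <= kappa_Sch b tm T N H A S)%E.
Proof.
move=> pS; apply: sup0_le => r [a [c [xi [dxi [[ta acT] Wxi Q0 ->]]]]].
have xi0 : exists2 t, t \in `[a, c] & xi t != 0.
  apply: contrapT => xi0; move/eqP: Q0; apply.
  exact: Qform_eq0 acT xi0.
have [i2 p2] := an_energy ta acT Wxi Q0.
have Qz : exists z : 'rV[R]_q, z != 0 by exists (Qform b a c xi dxi).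
have [i3 p3] := Sch_energy ta acT Wxi pS Qz.
eexists; first by right; exists a, c, xi, dxi.
rewrite lee_fin.
rewrite ler_pdivlMr ?p3// ler_pdivrMl ?p2// mulrC -RintegralZl//.
apply: le_Rintegral => //; first exact: integrable_itvZ.
move=> t; rewrite /= in_itv/= => tac.
have [pHt pAt _] := Hschur (itv_dom ta acT tac).
have Nt := HNpos (itv_dom ta acT tac).
rewrite [leRHS]mulrCA; apply: ler_wpM2l; first exact: qform_ge0.
have sA : 0 < Num.sqrt (qform (A t) (Qform b a c xi dxi)).
  by rewrite sqrtr_gt0; exact: pAt.2.
have sS : 0 < Num.sqrt (qform S (Qform b a c xi dxi)).
  by rewrite sqrtr_gt0; exact: pS.2.
have h1 := le_a_plus pS pAt Q0.
have ap : 0 < a_plus S (A t) by apply: lt_le_trans h1; rewrite divr_gt0.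
rewrite !invfM [leRHS]mulrCA ler_pM2l ?invr_gt0//.
by rewrite ler_pdivlMr// ler_pdivrMl// -ler_pdivrMr.
Qed.

End kappa_comparison.

(** * Duality *)

Section duality.
Context {R : realType}.
Local Notation mu := (@lebesgue_measure R).
Variables (q : nat) (a c : R) (rho : R -> R) (M : R -> 'M[R]_q) (Q : 'rV[R]_q).
Hypotheses (ac : a < c) (prho : pcont rho a c)
  (rho0 : forall t, a <= t <= c -> 0 <= rho t)
  (cM : continuous M) (pM : forall t, posdefmx (M t)).

Let I (phi : R -> R) : R := \int[mu]_(t in `[a, c]) (rho t * phi t).

Let int_rho (phi : R -> R) : continuous phi ->
  mu.-integrable `[a, c] (EFin \o (fun t => rho t * phi t)).
Proof.
move=> cphi; have : pcont (fun t => rho t * phi t) a c.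
  have := @pcont_comp R _ _ (fun t x : R => x * phi t) rho a c.
  apply => //; apply: contM; first exact/cont_snd/cont_id.
  by apply: (cont_comp cphi); exact/cont_fst/cont_id.
by move=> h; apply: (pcont_integrable ac h).
Qed.

Let ID (phi psi : R -> R) : continuous phi -> continuous psi ->
  I (fun t => phi t + psi t) = I phi + I psi.
Proof.
move=> h1 h2; rewrite /I -RintegralD//; [|exact: int_rho..].
by apply: eq_Rintegral => t _; rewrite mulrDr.
Qed.

Let IZ (k : R) (phi : R -> R) : continuous phi -> I (fun t => k * phi t) = k * I phi.
Proof.
move=> h1; rewrite /I -RintegralZl//; last exact: int_rho.
by apply: eq_Rintegral => t _; rewrite mulrCA.
Qed.

Let le_I (phi psi : R -> R) : continuous phi -> continuous psi ->
  (forall t, a <= t <= c -> phi t <= psi t) -> I phi <= I psi.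
Proof.
move=> h1 h2 h; apply: le_Rintegral => //; [exact: int_rho..|].
move=> t /=; rewrite in_itv/= => tac; apply: ler_wpM2l; first exact: rho0.
exact: h.
Qed.

Let I_sum (k : 'I_q -> R) (phi : 'I_q -> R -> R) :
  (forall j, continuous (phi j)) ->
  I (fun t => \sum_j k j * phi j t) = \sum_j k j * I (phi j).
Proof.
move=> cphi.
suff : forall s : seq 'I_q, continuous (fun t => \sum_(j <- s) k j * phi j t) /\
    I (fun t => \sum_(j <- s) k j * phi j t) = \sum_(j <- s) k j * I (phi j).
  by move=> /(_ (index_enum _))[].
elim=> [|j s [IH1 IH2]].
  rewrite big_nil; under eq_fun do rewrite big_nil.
  split; first exact: cont_cst.
  rewrite /I; under eq_Rintegral do rewrite mulr0.
  by rewrite Rintegral_itv_cst ?mul0r// ltW.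
rewrite big_cons; under eq_fun do rewrite big_cons.
have ckp : continuous (fun t => k j * phi j t).
  by apply: contM => //; exact: cont_cst.
split; first exact: contD.
by rewrite -IH2 -IZ// -ID.
Qed.

Hypothesis Qle : forall lam : 'rV[R]_q,
  (Q *m lam^T) 0 0 <=
  \int[mu]_(t in `[a, c]) (rho t * Num.sqrt (qform (M t) lam)).

Let root lam t := Num.sqrt (1 + qform (M t) lam).

Let cqf lam : continuous (fun t => qform (M t) lam).
Proof. by apply: cont_qform => //; exact: cont_cst. Qed.

Let croot lam : continuous (root lam).
Proof. by apply: cont_sqrt; apply: contD => //; exact: cont_cst. Qed.

Let root_gt0 lam t : 0 < root lam t.
Proof. by rewrite sqrtr_gt0 ltr_pwDl// qform_ge0. Qed.

Let root_ge1 lam t : 1 <= root lam t.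
Proof. by rewrite -[leLHS]sqrtr1 ler_wsqrtr// lerDl qform_ge0. Qed.

Let root_sq lam t : root lam t ^+ 2 = 1 + qform (M t) lam.
Proof. by rewrite sqr_sqrtr// addr_ge0// qform_ge0. Qed.

Let F lam : R := I (root lam) - (Q *m lam^T) 0 0.

Let grad lam : 'rV[R]_q :=
  \row_j I (fun t => (lam *m M t) 0 j / root lam t) - Q.

(** The hypothesis [Qle] enters here: replacing sqrt(x) by sqrt(1 + x) only increases the integral.
    Boundedness below is all that the choice of a near-minimizer needs. *)
Let F_ge0 lam : 0 <= F lam.
Proof.
rewrite subr_ge0 (le_trans (Qle lam))//; apply: le_I => //.
  exact: cont_sqrt.
by move=> t _; rewrite ler_wsqrtr// lerDr.
Qed.

Let cgrad lam j : continuous (fun t => (lam *m M t) 0 j / root lam t).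
Proof.
apply: contM; last by apply: contV => // t; rewrite gt_eqF.
by have /cont_mxP := cont_mulmx (@cont_cst R _ lam) cM; apply.
Qed.

Let F_step lam g (s : R) : F (lam - s *: g) <=
  F lam - s * (grad lam *m g^T) 0 0 +
  s ^+ 2 / 2 * I (fun t => qform (M t) g).
Proof.
have cbf : continuous (fun t => bform (M t) lam g / root lam t).
  apply: contM; last by apply: contV => // t; rewrite gt_eqF.
  have /cont_mxP := cont_mulmx (cont_mulmx (@cont_cst R _ lam) cM)
    (@cont_cst R _ g^T); exact.
have h1 : I (root (lam - s *: g)) <= I (fun t => root lam t +
    ((- s) * (bform (M t) lam g / root lam t) + s ^+ 2 / 2 * qform (M t) g)).
  apply: le_I => //.
    apply: contD => //; apply: contD; apply: contM => //; exact: cont_cst.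
  move=> t _; set x := root lam t; set y := root (lam - s *: g) t.
  have x0 : 0 < x by exact: root_gt0.
  have y0 : 0 < y by exact: root_gt0.
  have x1 : 1 <= x by exact: root_ge1.
  have ex : x ^+ 2 = 1 + qform (M t) lam by exact: root_sq.
  have ey : y ^+ 2 = 1 + qform (M t) lam - 2 * s * bform (M t) lam g +
                     s ^+ 2 * qform (M t) g.
    rewrite root_sq qformB ?qformZ ?bformZr; last by case: (pM t).
    ring.
  have qg : 0 <= s ^+ 2 * qform (M t) g by rewrite mulr_ge0 ?sqr_ge0// qform_ge0.
  (* tangent line bound 2 x y <= x^2 + y^2 for the square root *)
  have xy : 2 * x * y <= 2 * x ^+ 2 - 2 * s * bform (M t) lam g +
                     s ^+ 2 * qform (M t) g.
    have := sqr_ge0 (x - y); nra.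
  rewrite -(ler_pM2l (_ : 0 < 2 * x)); last by rewrite mulr_gt0.
  apply: (le_trans xy).
  have -> : 2 * x * (x + (- s * (bform (M t) lam g / x) +
      s ^+ 2 / 2 * qform (M t) g)) =
      2 * x ^+ 2 - 2 * s * bform (M t) lam g + x * (s ^+ 2 * qform (M t) g).
    by field; rewrite gt_eqF.
  rewrite lerD2l; rewrite ler_peMl//.
have h2 : I (fun t => bform (M t) lam g / root lam t) =
          (grad lam *m g^T) 0 0 + (Q *m g^T) 0 0.
  rewrite /grad mulmxBl [X in _ = X + _]mxE [in X in _ = _ + X + _]mxE subrK mxE.
  under eq_bigr do rewrite !mxE mulrC.
  rewrite -I_sum//; congr I; apply/funext => t.
  rewrite /bform mxE mulr_suml; apply: eq_bigr => j _.
  by rewrite [g^T _ _]mxE mulrAC mulrC mulrA.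
have cs1 : continuous (fun t => - s * (bform (M t) lam g / root lam t)).
  by apply: contM => //; exact: cont_cst.
have cs2 : continuous (fun t => s ^+ 2 / 2 * qform (M t) g).
  by apply: contM => //; exact: cont_cst.
move: h1; rewrite ID//; last exact: contD.
rewrite ID// !IZ// h2 => h1.
have e : (Q *m (lam - s *: g)^T) 0 0 = (Q *m lam^T) 0 0 - s * (Q *m g^T) 0 0.
  by rewrite linearB linearZ/= mulmxBr -scalemxAr [LHS]mxE [X in _ + X]mxE
             [X in _ - X]mxE.
rewrite /F e; lra.
Qed.

(* A near-minimizer of the convex functional F is almost critical. *)
Lemma dual_approximation (e : R) : 0 < e ->
  exists lam : 'rV[R]_q, nsq (\row_j \int[mu]_(t in `[a, c])
    (rho t * ((lam *m M t) 0 j / Num.sqrt (1 + qform (M t) lam))) - Q) <= e.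
Proof.
move=> e0.
have [K K0 HK] := qform_upper (ltW ac) cM.
(* Chosen so that the quadratic term for [g] is at most 2 C times its Euclidean square; adding 1
   makes [C] positive even if [rho] vanishes. *)
pose C := K * I (fun=> 1) / 2 + 1.
have I1 : 0 <= I (fun=> 1).
  rewrite /I; apply: Rintegral_ge0 => t /=; rewrite in_itv/= => tac.
  by rewrite mulr1 rho0.
have C0 : 0 < C by rewrite ltr_wpDl// divr_ge0// mulr_ge0// ltW.
have hinf : has_inf (range F).
  split; first by exists (F 0), 0.
  by exists 0 => _ [lam _ <-].
(* A gradient step of length 1 / (2 C) lowers [F] by at least |g|^2 / (4 C). A point within e / (4
   C) of the infimum therefore has |g|^2 <= e. *)
have d0 : 0 < e / (4 * C) by rewrite divr_gt0// mulr_gt0.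
have [_ [lam _ <-] Flam] := inf_adherent d0 hinf.
exists lam; rewrite -/(root lam).
have -> : \row_j \int[mu]_(t in `[a, c])
    (rho t * ((lam *m M t) 0 j / Num.sqrt (1 + qform (M t) lam))) - Q =
    grad lam by [].
set g := grad lam.
have h1 : inf (range F) <= F (lam - (2 * C)^-1 *: g).
  by apply: ge_inf; [case: hinf|exists (lam - (2 * C)^-1 *: g)].
have h2 := F_step lam g (2 * C)^-1; rewrite -/g -nsqE in h2.
have h3 : I (fun t => qform (M t) g) <= 2 * C * nsq g.
  apply: (@le_trans _ _ (I (fun=> K * nsq g * 1))).
    apply: le_I => //; first exact: cont_cst.
    by move=> t tac; rewrite mulr1; exact: HK.
  rewrite IZ; last exact: cont_cst.
  have := nsq_ge0 g; rewrite /C; nra.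
have h4 : (2 * C)^-1 ^+ 2 / 2 * I (fun t => qform (M t) g) <= nsq g / (4 * C).
  apply: (@le_trans _ _ ((2 * C)^-1 ^+ 2 / 2 * (2 * C * nsq g))).
    by apply: ler_wpM2l => //; rewrite divr_ge0// sqr_ge0.
  by rewrite le_eqVlt; apply/orP; left; apply/eqP; field; rewrite gt_eqF.
have h5 : (2 * C)^-1 * nsq g = nsq g / (4 * C) + nsq g / (4 * C).
  by field; rewrite gt_eqF.
have : nsq g / (4 * C) <= e / (4 * C) by lra.
by rewrite ler_pM2r// invr_gt0 mulr_gt0.
Qed.

End duality.

(** * Deformation of graphs *)

Section piecewise_operations.
Context {R : realType}.

Lemma C1_rderive {V : normedModType R} (f c c' : R -> V) (u d : R) :
  0 < d -> C1 c c' -> (forall w, u <= w < u + d -> f w = c w) ->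
  rderive f u = c' u.
Proof. by move=> d0 [cc' _]; exact: rderiveE. Qed.

(** The operation acts on values and derivatives by the same formula, so it is linear in effect. The
    resulting constraint remembers the constraints on both arguments, and a unary operation is the
    case where one argument is ignored. *)
Lemma pwC1_op {U V W : normedModType R} (op : U -> V -> W)
    (C : R -> U -> U -> Prop) (D : R -> V -> V -> Prop) f g (a b : R) :
  (forall c c' e e', C1 c c' -> C1 e e' ->
     C1 (fun t => op (c t) (e t)) (fun t => op (c' t) (e' t))) ->
  pwC1 C f a b -> pwC1 D g a b ->
  pwC1 (fun t z d => exists x x' y y', [/\ C t x x', D t y y', z = op x y &
                                          d = op x' y'])
    (fun t => op (f t) (g t)) a b /\
  forall t, a <= t < b ->
    rderive (fun t => op (f t) (g t)) t = op (rderive f t) (rderive g t).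
Proof.
move=> opC [fr fl] [gr gl].
have RG u : a <= u < b -> exists (d : R) (c c' : R -> U) (e e' : R -> V),
    [/\ 0 < d, u + d <= b, C1 c c', C1 e e' &
        forall w, u <= w <= u + d -> [/\ f w = c w, C w (c w) (c' w),
                                        g w = e w & D w (e w) (e' w)]].
  move=> uab; have [d [c [c' [d0 db cc' fc]]]] := fr u uab.
  have [d' [e [e' [d'0 d'b ee' ge]]]] := gr u uab.
  exists (Num.min d d'), c, c', e, e'; split => //.
  - by rewrite lt_min d0.
  - by rewrite -lerBrDl ge_min lerBrDl db.
  - move=> w /andP[uw]; rewrite -lerBlDl le_min !lerBlDl => /andP[w1 w2].
    by have [] := fc w _; rewrite ?uw//; have [] := ge w _; rewrite ?uw.
split; first split=> u uab.
- have [d [c [c' [e [e' [d0 db cc' ee' h]]]]]] := RG u uab.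
  exists d, (fun t => op (c t) (e t)), (fun t => op (c' t) (e' t)).
  split => //; first exact: opC.
  by move=> w /h[-> ? -> ?]; split => //; exists (c w), (c' w), (e w), (e' w).
- have [d [c [c' [d0 db cc' fc]]]] := fl u uab.
  have [d' [e [e' [d'0 d'b ee' ge]]]] := gl u uab.
  exists (Num.min d d'), (fun t => op (c t) (e t)), (fun t => op (c' t) (e' t)).
  split => //.
  - by rewrite lt_min d0.
  - by rewrite lerBrDr -lerBrDl ge_min lerBrDl -lerBrDr db.
  - exact: opC.
  - move=> w /andP[+ wu]; rewrite lerBlDr -lerBlDl le_min !lerBlDl -!lerBlDr.
    move=> /andP[w1 w2].
    have [|-> ?] := fc w; first by rewrite w1.
    have [|-> ?] := ge w; first by rewrite w2.
    by split => //; exists (c w), (c' w), (e w), (e' w).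
- move=> u uab; have [d [c [c' [e [e' [d0 db cc' ee' h]]]]]] := RG u uab.
  have le w : u <= w < u + d -> u <= w <= u + d.
    by move=> /andP[-> /ltW ->].
  rewrite (C1_rderive d0 cc'); last by move=> w /le/h[].
  rewrite (C1_rderive d0 ee'); last by move=> w /le/h[].
  apply: (C1_rderive d0 (opC _ _ _ _ cc' ee')).
  by move=> w /le/h[-> _ ->].
Qed.

(** On each germ the strict inequality holds up to the closed end points, so the continuous
    left-hand side has a negative maximum there; interval induction takes the smaller of the two
    margins. *)
Lemma pwC1_uniform {V : normedModType R} (Phi : R -> V -> V -> R) f (a b : R) :
  a < b -> continuous (fun x : R * (V * V) => Phi x.1 x.2.1 x.2.2) ->
  pwC1 (fun t x d => Phi t x d < 0) f a b ->
  exists2 e : R, 0 < e &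
    forall t, a <= t < b -> Phi t (f t) (rderive f t) <= - e.
Proof.
move=> ab cPhi fP.
pose P x y := exists2 e : R, 0 < e &
    forall t, x <= t < y -> Phi t (f t) (rderive f t) <= - e.
have loc x y (c c' : R -> V) : x < y -> C1 c c' ->
    (forall w, x <= w <= y -> f w = c w /\ Phi w (c w) (c' w) < 0) -> P x y.
  move=> xy cc' fc.
  have cpsi : continuous (fun w => Phi w (c w) (c' w)).
    have cc := cont_pair cont_id (cont_pair (C1_continuous cc') cc'.2).
    by have := cont_comp cPhi cc.
  have [m + mM] := EVT_max (ltW xy) (continuous_subspaceT cpsi).
  rewrite in_itv/= => mxy.
  exists (- Phi m (c m) (c' m)); first by rewrite oppr_gt0; exact: (fc m mxy).2.
  move=> t /andP[xt ty]; rewrite opprK.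
  have txy : x <= t <= y by rewrite xt ltW.
  rewrite (fc t txy).1.
  rewrite (@C1_rderive _ f c c' t (y - t)) ?subr_gt0//.
  - by apply: mM; rewrite in_itv.
  - move=> w /andP[tw]; rewrite subrKC => wy; apply: (fc w _).1.
    by rewrite (le_trans xt tw) ltW.
apply: (@interval_induction R P a b) => //.
- move=> x y z _ xy yz _ [e1 e10 h1] [e2 e20 h2].
  exists (Num.min e1 e2); first by rewrite lt_min e10.
  move=> t /andP[xt tz]; case: (ltP t y) => ty.
    by rewrite (le_trans (h1 t _)) ?xt// lerN2 ge_min lexx.
  by rewrite (le_trans (h2 t _)) ?ty// lerN2 ge_min lexx orbT.
- move=> u /fP.1[d [c [c' [d0 db cc' fc]]]]; exists d => // w /andP[uw wd] wb.
  apply: (loc _ _ c c') => // t /andP[ut tw]; apply: fc.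
  by rewrite ut (le_trans tw).
- move=> u /fP.2[d [c [c' [d0 db cc' fc]]]]; exists d => // w /andP[uw wd] wb.
  apply: (loc _ _ c c') => // t /andP[ut tw]; apply: fc.
  by rewrite tw andbT (le_trans uw).
Qed.

End piecewise_operations.

(** * Pointwise estimates for the interpolated velocity *)

Section speed.
Context {R : realType}.

(** Since k <= 1/4, the bound N be <= 2 e gives 2 N k be <= e. So [m] is at most N^2 - 2 N r with r
    = k (rho + be), and completing the square gives (N - r)^2; nonnegativity of [m] forces 2 r <=
    N. *)
Lemma speed_slack (N e k rho be m : R) :
  0 < N -> 0 <= rho -> 0 < be -> 0 <= k <= 4^-1 -> N * be <= 2 * e ->
  0 <= m -> m <= N ^+ 2 - e - k * (2 * N * rho) ->
  0 <= N - k * (rho + be) /\ m <= (N - k * (rho + be)) ^+ 2.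
Proof.
move=> N0 rho0 be0 /andP[k0 k4] Nbe m0 mle.
have kbe : 2 * N * (k * be) <= e.
  have : k * (N * be) <= 4^-1 * (2 * e).
    by apply: ler_pM => //; rewrite mulr_ge0// ltW.
  lra.
have h : m <= N ^+ 2 - 2 * N * (k * (rho + be)) by lra.
set r := k * (rho + be) in h *.
have r0 : 0 <= r by rewrite mulr_ge0// addr_ge0// ltW.
split; last by have := sqr_ge0 r; nra.
rewrite subr_ge0; have : 0 <= N * (N - 2 * r) by nra.
rewrite pmulr_rge0//; lra.
Qed.

(** The triangle inequality for the norm of the orthogonal sum V + Z, when the added vector lies in
    Z and [hu] is the fixed contribution of V. *)
Lemma qform_shift_bound n (M : 'M[R]_n) (hu al s : R) (u v : 'rV[R]_n) :
  posdefmx M -> 0 <= hu -> 0 <= al -> 0 <= s ->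
  hu + qform M u <= al ^+ 2 -> qform M v <= s ^+ 2 ->
  hu + qform M (u + v) <= (al + s) ^+ 2.
Proof.
move=> pM hu0 al0 s0 ual vs.
have q0 := qform_ge0 u pM.
pose r := Num.sqrt (al ^+ 2 - hu).
have r0 : 0 <= r by exact: sqrtr_ge0.
have r2 : r ^+ 2 = al ^+ 2 - hu by rewrite sqr_sqrtr//; lra.
have ral : r <= al.
  by rewrite -(@ler_pXn2r _ 2) ?nnegrE// r2; lra.
have h : qform M (u + v) <= (r + s) ^+ 2.
  by apply: qform_triangle => //; rewrite r2; lra.
nra.
Qed.

End speed.

Lemma affine_regroup {R : realType} p q (s : R) (w0 w1 y z : 'rV[R]_q)
    (v0 v1 : 'rV[R]_p) (L : 'M[R]_(p, q)) :
  ((1 - s) *: w0 + s *: w1) + (s * (1 - s)) *: (y + z) +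
    ((1 - s) *: v0 + s *: v1) *m L =
  ((1 - s) *: (w0 + v0 *m L) + s *: (w1 + v1 *m L)) +
    ((s * (1 - s)) *: y + (s * (1 - s)) *: z).
Proof.
rewrite mulmxDl -!scalemxAl; move: (v0 *m L) (v1 *m L) => a b.
by apply/rowP => j; rewrite !mxE; ring.
Qed.

Lemma mul_onem_le {R : realType} (s : R) : s * (1 - s) <= 4^-1.
Proof. have := sqr_ge0 (s - 2^-1); nra. Qed.

Lemma sqr_shift_lt {R : realType} (n r : R) : 0 < n -> 0 < r -> r <= n ->
  (n - r) ^+ 2 < n ^+ 2.
Proof. nra. Qed.

(** With k = s(1-s), convexity and slack lower the bound by k (rho + be); the correction [eta] costs
    k rho and the error [er] costs k be / 2. A margin k be / 2 remains. Only the H-part of the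
    convexity defect is used, the A-part being dropped as nonnegative. *)
Lemma speed_estimate {R : realType} p q (H : 'M[R]_p) (A : 'M[R]_q)
    (n rho be e s : R) (v0 v1 : 'rV[R]_p) (z0 z1 eta er : 'rV[R]_q) :
  posdefmx H -> posdefmx A -> 0 < n -> 0 <= rho -> 0 < be -> n * be <= 2 * e ->
  0 < s < 1 ->
  qform H v0 + qform A z0 <= n ^+ 2 - e ->
  qform H v1 + qform A z1 <= n ^+ 2 - e ->
  qform H (v1 - v0) = 2 * n * rho ->
  qform A eta <= rho ^+ 2 -> qform A er <= (be / 2) ^+ 2 ->
  qform H ((1 - s) *: v0 + s *: v1) +
  qform A (((1 - s) *: z0 + s *: z1) +
           ((s * (1 - s)) *: eta + (s * (1 - s)) *: er)) <=
  (n - s * (1 - s) * (be / 2)) ^+ 2.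
Proof.
move=> pH pA n0 rho0 be0 nbe /andP[s0 s1] b0 b1 Erho q1 q2.
set k := s * (1 - s).
have k0 : 0 < k by rewrite mulr_gt0// subr_gt0.
have k4 : k <= 4^-1 by exact: mul_onem_le.
set u := (1 - s) *: v0 + s *: v1; set z := (1 - s) *: z0 + s *: z1.
have sH := pH.1; have sA := pA.1.
have hu0 : 0 <= qform H u by exact: qform_ge0.
have hz0 : 0 <= qform A z by exact: qform_ge0.
have m1 : qform H u + qform A z <= n ^+ 2 - e - k * (2 * n * rho).
  rewrite /u /z (qform_convex _ _ _ sH) (qform_convex _ _ _ sA) Erho -/k.
  have h1 : 0 <= k * qform A (z1 - z0).
    by rewrite mulr_ge0 ?qform_ge0// ltW.
  have h2 : (1 - s) * (qform H v0 + qform A z0) <= (1 - s) * (n ^+ 2 - e).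
    by apply: ler_wpM2l => //; rewrite subr_ge0 ltW.
  have h3 : s * (qform H v1 + qform A z1) <= s * (n ^+ 2 - e).
    by apply: ler_wpM2l => //; exact: ltW.
  lra.
have k04 : 0 <= k <= 4^-1 by rewrite k4 ltW.
have [al0 ual] := speed_slack n0 rho0 be0 k04 nbe (addr_ge0 hu0 hz0) m1.
have q12 : qform A (k *: eta + k *: er) <= (k * (rho + be / 2)) ^+ 2.
  rewrite mulrDr; apply: qform_triangle => //.
  - by rewrite mulr_ge0// ltW.
  - by rewrite mulr_ge0 ?divr_ge0// ltW.
  - by rewrite qformZ [leRHS]exprMn; apply: ler_wpM2l => //; exact: sqr_ge0.
  - by rewrite qformZ [leRHS]exprMn; apply: ler_wpM2l => //; exact: sqr_ge0.
have kr0 : 0 <= k * (rho + be / 2).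
  by rewrite mulr_ge0 ?addr_ge0 ?divr_ge0// ltW.
have := qform_shift_bound pA hu0 al0 kr0 ual q12.
by congr (_ <= _ ^+ 2); field.
Qed.

Section deformation.
Context {R : realType}.
Local Notation mu := (@lebesgue_measure R).
Variables (p q : nat) (b : 'rV[R]_p -> 'rV[R]_p -> 'rV[R]_q).
Hypotheses (bl : forall v, linear (b v)) (br : forall w, linear (b^~ w)).
Variables (a c : R) (N : R -> R)
  (H : R -> 'M[R]_p) (A : R -> 'M[R]_q) (L : R -> 'M[R]_(p, q)).
Hypotheses (ac : a < c) (cN : continuous N) (N0 : forall t, 0 < N t)
  (cH : continuous H) (pH : forall t, posdefmx (H t))
  (cA : continuous A) (pA : forall t, posdefmx (A t)) (cL : continuous L).

Local Notation E := ('rV[R]_p * 'rV[R]_q)%type.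

(* The value of h_t on the velocity [d] at the point [x], in Schur form. *)
Definition speed (t : R) (x d : E) : R :=
  qform (H t) d.1 + qform (A t) (Theta b x d + d.1 *m L t).

Lemma speed_continuous :
  continuous (fun x : R * (E * E) => speed x.1 x.2.1 x.2.2).
Proof.
have c1 : continuous (fun x : R * (E * E) => x.1) by exact/cont_fst/cont_id.
have cd : continuous (fun x : R * (E * E) => x.2.2).
  exact/cont_snd/cont_snd/cont_id.
have cx : continuous (fun x : R * (E * E) => x.2.1).
  exact/cont_fst/cont_snd/cont_id.
have cv := cont_fst cd; have cz := cont_snd cd; have cx1 := cont_fst cx.
have cT := contB cz (contZ (@cont_cst _ _ (2^-1 : R))
  (bilinear_continuous bl br cx1 cv)).
have cvL := cont_mulmx cv (cont_comp cL c1).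
exact: (contD (cont_qform (cont_comp cH c1) cv)
              (cont_qform (cont_comp cA c1) (contD cT cvL))).
Qed.

(** The interpolation is affine in the coordinates, not in the values of [Theta]. The factor s(1-s)
    on [Y] matches the bilinear defect of [Theta], so that a single [Y] serves all s. *)
Definition deform (X0 X1 : R -> E) (Y : R -> 'rV[R]_q) (s t : R) : E :=
  ((1 - s) *: X0 t + s *: X1 t) + (s * (1 - s)) *: ((0, Y t) : E).

(** The bilinear counterpart of [qform_convex]: interpolating both arguments of [b] leaves the
    defect s(1-s) b(x1 - x0, d1 - d0). *)
Lemma Theta_deform (s : R) (x0 x1 d0 d1 : E) (y y' : 'rV[R]_q) :
  Theta b (((1 - s) *: x0 + s *: x1) + (s * (1 - s)) *: ((0, y) : E))
          (((1 - s) *: d0 + s *: d1) + (s * (1 - s)) *: ((0, y') : E)) =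
  ((1 - s) *: Theta b x0 d0 + s *: Theta b x1 d1) +
  (s * (1 - s)) *: (y' + 2^-1 *: b (x1.1 - x0.1) (d1.1 - d0.1)).
Proof.
rewrite /Theta /= !scaler0 !addr0.
have bN v w : b (- v) w = - b v w by rewrite -scaleN1r (brZ br) scaleN1r.
have bN' v w : b v (- w) = - b v w by rewrite -scaleN1r (blZ bl) scaleN1r.
rewrite !(brD br) !(blD bl) !(brZ br) !(blZ bl) !bN !bN'.
apply/rowP => j; rewrite !mxE; ring.
Qed.

Variables (X0 X1 : R -> E).
Hypotheses
  (T0 : pwC1 (fun t x d => speed t x d - N t ^+ 2 < 0) X0 a c)
  (T1 : pwC1 (fun t x d => speed t x d - N t ^+ 2 < 0) X1 a c)
  (Xa : X0 a = X1 a) (Xc : X0 c = X1 c).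

Definition xi t : 'rV[R]_p := (X1 t).1 - (X0 t).1.
Definition dxi t : 'rV[R]_p := (rderive X1 t).1 - (rderive X0 t).1.

Lemma xi_pwC1 : pwC1 (fun _ _ _ => True) xi a c /\
  forall t, a <= t < c -> rderive xi t = dxi t.
Proof.
have opC (e e' f f' : R -> E) : C1 e e' -> C1 f f' ->
    C1 (fun t => (f t).1 - (e t).1) (fun t => (f' t).1 - (e' t).1).
  move=> ee' ff'; have := C1D (C1_fst ff') (C1Z (-1) (C1_fst ee')).
  by congr C1; apply/funext => t; rewrite scaleN1r.
have [h1 h2] := @pwC1_op R _ _ _ (fun x y : E => y.1 - x.1) _ _ X0 X1 a c opC
  T0 T1.
by split => //; apply: pwC1_impl h1.
Qed.

Lemma dxi_pcont : pcont dxi a c.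
Proof.
have h := pcont_pair (pcont_rderive T0) (pcont_rderive T1).
have := @pcont_comp R _ _ (fun _ (x : E * E) => x.2.1 - x.1.1) _ a c _ h.
apply; apply: contB.
  exact/cont_fst/cont_snd/cont_snd/cont_id.
exact/cont_fst/cont_fst/cont_snd/cont_id.
Qed.

Lemma xi_W012 : W012 a c xi dxi.
Proof.
have [xiC xid] := xi_pwC1.
have pj i := pcont_coord i dxi_pcont.
split.
- by move=> i; have [] := pcont_bounded_measurable ac (pj i).
- move=> i; have h := @pcont_comp R _ _ (fun _ x : R => x ^+ 2) _ a c _ (pj i).
  apply: (@pcont_integrable R (fun t => dxi t 0 i ^+ 2) a c) => //; apply: h.
  by under eq_fun do rewrite expr2; apply: contM; exact/cont_snd/cont_id.
- move=> t; rewrite in_itv/= => tac; apply/rowP => i; rewrite mxE.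
  have [h1 h2] := @pwC1_op R _ _ _ (fun x _ : 'rV[R]_p => x 0 i) _ _ xi xi a c
    (fun _ _ _ _ h _ => C1_coord i h) xiC xiC.
  have := pwC1_Rintegral ac h1 tac.
  have -> : xi a 0 i = 0 by rewrite /xi Xa subrr mxE.
  rewrite subr0 => <-.
  have /andP[a_t tc] := tac.
  apply: eq_Rintegral_co => //.
  + exact: (pcont_integrable ac (pcont_rderive h1)).
  + exact: (pcont_integrable ac (pj i)).
  + move=> s /andP[as_ st]; have sac : a <= s < c by rewrite as_ (lt_le_trans st).
    by rewrite h2// xid.
- by rewrite /xi Xc subrr.
Qed.

Local Notation Q := (Qform b a c xi dxi).
Local Notation rho := (fun t => qform (H t) (dxi t) / (2 * N t)).

Hypothesis Qle : forall lam : 'rV[R]_q, (Q *m lam^T) 0 0 <=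
  \int[mu]_(t in `[a, c]) (rho t * Num.sqrt (qform (invmx (A t)) lam)).

Lemma deformation : exists Y : R -> 'rV[R]_q,
  [/\ pwC1 (fun _ _ _ => True) Y a c, Y a = 0, Y c = 0 &
    forall s, 0 < s < 1 ->
      pwC1 (fun t x d => speed t x d < N t ^+ 2) (deform X0 X1 Y s) a c].
Proof.
have cPhi : continuous (fun x : R * (E * E) =>
    speed x.1 x.2.1 x.2.2 - N x.1 ^+ 2).
  apply: contB; first exact: speed_continuous.
  under eq_fun do rewrite expr2.
  by apply: contM; apply: (cont_comp cN); exact/cont_fst/cont_id.
have [e0 e00 he0] := pwC1_uniform ac cPhi T0.
have [e1 e10 he1] := pwC1_uniform ac cPhi T1.
pose e := Num.min e0 e1.
have ep : 0 < e by rewrite lt_min e00.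
have he0' t : a <= t < c -> speed t (X0 t) (rderive X0 t) <= N t ^+ 2 - e.
  move=> tac; rewrite [leRHS]addrC -lerBlDr (le_trans (he0 t tac))// lerN2.
  by rewrite ge_min lexx.
have he1' t : a <= t < c -> speed t (X1 t) (rderive X1 t) <= N t ^+ 2 - e.
  move=> tac; rewrite [leRHS]addrC -lerBlDr (le_trans (he1 t tac))// lerN2.
  by rewrite ge_min lexx orbT.
have [n0 [n1 [n00 nN]]] : exists n0 n1 : R, 0 < n0 /\
    forall t, a <= t <= c -> n0 <= N t <= n1.
  apply: clamp_pos_bounds => //.
  by apply: (cont_comp cN); exact: clamp_continuous.
have n10 : 0 < n1.
  have aac : a <= a <= c by rewrite lexx ltW.
  by have /andP[h1 h2] := nN a aac; rewrite (lt_le_trans n00)// (le_trans h1).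
(* The first bound gives N be <= 2 e for the speed estimate; the second keeps the final margin below
   N. *)
pose be := Num.min (2 * e / n1) n0.
have be0 : 0 < be by rewrite lt_min n00 divr_gt0// mulr_gt0.
have Nbe t : a <= t <= c -> N t * be <= 2 * e.
  move=> tac; have /andP[h1 h2] := nN t tac.
  apply: (@le_trans _ _ (n1 * (2 * e / n1))).
    by apply: ler_pM; rewrite ?(ltW (N0 t)) ?(ltW be0)// ge_min lexx.
  by rewrite mulrC divfK// gt_eqF.
have [KA KA0 HKA] := qform_upper (ltW ac) cA.
pose M t := invmx (A t).
have pM t : posdefmx (M t) by exact: posdefmx_inv.
have cM : continuous M.
  by apply: cont_invmx => // t; exact: posdefmx_unit.
have prho : pcont rho a c.
  have := @pcont_comp R _ _ (fun t v => qform (H t) v / (2 * N t)) _ a c _ dxi_pcont.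
  apply; apply: contM.
    apply: cont_qform; last exact/cont_snd/cont_id.
    by apply: (cont_comp cH); exact/cont_fst/cont_id.
  apply: contV; first by move=> x; rewrite gt_eqF// mulr_gt0.
  apply: contM; first exact: cont_cst.
  by apply: (cont_comp cN); exact/cont_fst/cont_id.
have rho0 t : 0 <= rho t.
  by rewrite divr_ge0 ?qform_ge0// mulr_ge0// ltW.
(* Chosen so that the error of the dual approximation, divided by c - a, has A-norm at most be /
   2. *)
pose ed := (be / 2 * (c - a)) ^+ 2 / KA.
have ca0 : 0 < c - a by rewrite subr_gt0.
have ed0 : 0 < ed by rewrite divr_gt0// exprn_gt0// mulr_gt0// divr_gt0.
have [lam hlam] := dual_approximation ac prho (fun t _ => rho0 t) cM pM Qle ed0.
pose g := \row_j \int[mu]_(t in `[a, c])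
    (rho t * ((lam *m M t) 0 j / Num.sqrt (1 + qform (M t) lam))) - Q.
rewrite -/g in hlam.
pose rt t := Num.sqrt (1 + qform (M t) lam).
have rt0 t : 0 < rt t by rewrite sqrtr_gt0 ltr_pwDl// qform_ge0.
have crt : continuous rt.
  apply: cont_sqrt; apply: contD; first exact: cont_cst.
  by apply: cont_qform => //; exact: cont_cst.
(* The gradient of the integrand at [lam], of A-norm at most [rho]. The constant [er] spreads the
   error [g] of its integral evenly over [a, c], and [f] is the derivative of [Y] that makes the
   correction to [Theta] equal to [eta1 + er]. *)
pose eta1 t := (rho t / rt t) *: (lam *m M t).
pose er := - (c - a)^-1 *: g.
pose f t := (eta1 t + er) - 2^-1 *: b (xi t) (dxi t).
have peta : pcont (fun t => eta1 t + er) a c.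
  have := @pcont_comp R _ _ (fun t x : R => (x / rt t) *: (lam *m M t) + er)
    _ a c _ prho.
  apply; apply: contD; last exact: cont_cst.
  apply: contZ.
    apply: contM; first exact/cont_snd/cont_id.
    apply: contV; first by move=> x; rewrite gt_eqF.
    by apply: (cont_comp crt); exact/cont_fst/cont_id.
  apply: cont_mulmx; first exact: cont_cst.
  by apply: (cont_comp cM); exact/cont_fst/cont_id.
have pb : pcont (fun t => b (xi t) (dxi t)) a c.
  have h := pcont_pair (pcont_pwC1 xi_pwC1.1) dxi_pcont.
  have := @pcont_comp R _ _ (fun _ (x : 'rV[R]_p * 'rV[R]_p) => b x.1 x.2) _ a c _ h.
  apply; apply: (bilinear_continuous bl br).
    exact/cont_fst/cont_snd/cont_id.
  exact/cont_snd/cont_snd/cont_id.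
have pf : pcont f a c.
  have := @pcont_comp R _ _ (fun _ (x : 'rV[R]_q * 'rV[R]_q) => x.1 - 2^-1 *: x.2)
    _ a c _ (pcont_pair peta pb).
  apply; apply: contB; first exact/cont_fst/cont_snd/cont_id.
  by apply: contZ; [exact: cont_cst|exact/cont_snd/cont_snd/cont_id].
have [YC Yd] := pwC1_row_primitive ac pf.
pose Y := row_primitive f a.
have Ya : Y a = 0.
  by apply/rowP => j; rewrite !mxE set_itv1 Rintegral_set1.
(* The integrals of [eta1], [er] and b(xi, dxi) / 2 are Q + g, -g and Q. *)
have Yc : Y c = 0.
  apply/rowP => j; rewrite !mxE.
  have i1 : mu.-integrable `[a, c] (EFin \o (fun t => eta1 t 0 j)).
    have i0 : mu.-integrable `[a, c] (EFin \o (fun=> - er 0 j)).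
      exact: continuous_itv_integrable (@cont_cst R _ (- er 0 j)).
    have := integrable_itvD i0
      (pcont_integrable ac (pcont_coord j peta) (lexx a) (lexx c)).
    by congr integrable; apply/funext => t /=; rewrite !mxE addrCA addNr addr0.
  have i2 : mu.-integrable `[a, c] (EFin \o (fun=> er 0 j)).
    exact: continuous_itv_integrable (@cont_cst R _ (er 0 j)).
  have i3 := pcont_integrable ac (pcont_coord j pb) (lexx a) (lexx c).
  transitivity (\int[mu]_(t in `[a, c])
    ((eta1 t 0 j + er 0 j) + (- 2^-1) * b (xi t) (dxi t) 0 j)).
    apply: eq_Rintegral => t _.
    by rewrite /f [LHS]mxE [X in X + _]mxE [X in _ + X]mxE [X in - X]mxE mulNr.
  rewrite RintegralD//; last 2 first.
  - exact: integrable_itvD.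
  - exact: integrable_itvZ.
  rewrite RintegralD// RintegralZl// Rintegral_itv_cst; last exact: ltW.
  have -> : er 0 j * (c - a) = - g 0 j.
    by rewrite mxE mulrAC mulNr mulVf ?gt_eqF// mulN1r.
  rewrite /g /Qform !mxE.
  have -> : \int[mu]_(t in `[a, c]) eta1 t 0 j = \int[mu]_(t in `[a, c]) (rho t *
      ((lam *m M t) 0 j / Num.sqrt (1 + qform (M t) lam))).
    by apply: eq_Rintegral => t _; rewrite /eta1 [LHS]mxE -/(rt t) mulrAC mulrA.
  ring.
exists Y; split => // s /andP[s0 s1].
pose k := s * (1 - s).
have k0 : 0 < k by rewrite mulr_gt0// subr_gt0.
have k4 : k <= 4^-1 by exact: mul_onem_le.
have opC1 (x x' y y' : R -> E) : C1 x x' -> C1 y y' ->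
    C1 (fun t => (1 - s) *: x t + s *: y t)
       (fun t => (1 - s) *: x' t + s *: y' t).
  by move=> h1 h2; apply: C1D; exact: C1Z.
have opC2 (x x' : R -> E) (y y' : R -> 'rV[R]_q) : C1 x x' -> C1 y y' ->
    C1 (fun t => x t + k *: ((0, y t) : E)) (fun t => x' t + k *: ((0, y' t) : E)).
  move=> h1 h2; apply: C1D => //; apply: C1Z; apply: C1_pair => //.
  exact: C1_cst.
have [Z1 Z1d] := @pwC1_op R _ _ _ (fun x y : E => (1 - s) *: x + s *: y) _ _
  X0 X1 a c opC1 T0 T1.
have [Z2 Z2d] := @pwC1_op R _ _ _ (fun (x : E) y => x + k *: ((0, y) : E)) _ _
  _ Y a c opC2 Z1 YC.
(* The constraint is imposed with the margin k be / 2, because [pwC1_closed] transfers only a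
   non-strict inequality to the closed germs. *)
pose Phi t (x d : E) := speed t x d - (N t - k * (be / 2)) ^+ 2.
have cPhi2 : continuous (fun x : R * (E * E) => Phi x.1 x.2.1 x.2.2).
  apply: contB; first exact: speed_continuous.
  under eq_fun do rewrite expr2.
  have cNk : continuous (fun x : R * (E * E) => N x.1 - k * (be / 2)).
    apply: contB; last exact: cont_cst.
    by apply: (cont_comp cN); exact/cont_fst/cont_id.
  exact: contM.
have fin := pwC1_closed cPhi2 Z2.
apply: pwC1_impl; last first.
  apply: fin => t tac; have /andP[a_t tc] := tac.
  have tac' : a <= t <= c by rewrite a_t ltW.
  rewrite Z2d// Z1d// subr_le0 /speed Theta_deform.
  rewrite (Yd t tac) {1}/f subrK.
  have eu : (((1 - s) *: rderive X0 t + s *: rderive X1 t) +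
      k *: ((0, f t) : E)).1 =
      (1 - s) *: (rderive X0 t).1 + s *: (rderive X1 t).1.
    by rewrite /= scaler0 addr0.
  rewrite eu; set v0 := (rderive X0 t).1; set v1 := (rderive X1 t).1.
  set w0 := Theta b (X0 t) _; set w1 := Theta b (X1 t) _.
  pose z0 := w0 + v0 *m L t; pose z1 := w1 + v1 *m L t.
  have -> : (1 - s) *: w0 + s *: w1 + s * (1 - s) *: (eta1 t + er) +
      ((1 - s) *: v0 + s *: v1) *m L t =
      ((1 - s) *: z0 + s *: z1) + (k *: eta1 t + k *: er).
    exact: affine_regroup.
  have b0 := he0' t tac; have b1 := he1' t tac.
  have Erho : qform (H t) (v1 - v0) = 2 * N t * rho t.
    by rewrite -/(dxi t) mulrC divfK// gt_eqF// mulr_gt0.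
  (* The A-norm of [lam *m M t] is the dual norm of [lam], and x / (1 + x) <= 1. *)
  have q1 : qform (A t) (eta1 t) <= rho t ^+ 2.
    rewrite /eta1 qformZ qform_invmx// exprMn exprVn sqr_sqrtr; last first.
      by rewrite addr_ge0// qform_ge0.
    have qm := qform_ge0 lam (pM t).
    rewrite -mulrA ler_piMr ?sqr_ge0// mulrC ler_pdivrMr ?ltr_pwDl// mul1r.
    by rewrite lerDr.
  have q2 : qform (A t) er <= (be / 2) ^+ 2.
    rewrite /er qformZ sqrrN exprVn mulrC ler_pdivrMr ?exprn_gt0//.
    apply: (le_trans (HKA t g tac')); rewrite -exprMn.
    by rewrite mulrC -ler_pdivlMr.
  apply: (speed_estimate (pH t) (pA t) (N0 t) (rho0 t) be0 (Nbe t tac') _ b0 b1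
            Erho q1 q2).
  by rewrite s0.
move=> t x d tac [_]; rewrite /Phi subr_le0 => /le_lt_trans; apply.
have /andP[h1 h2] := nN t tac.
apply: sqr_shift_lt => //; first by rewrite mulr_gt0// divr_gt0.
apply: le_trans h1; apply: (@le_trans _ _ (1 * be)).
  apply: ler_pM; rewrite ?(ltW k0) ?divr_ge0 ?(ltW be0)//.
    by rewrite (le_trans k4)// invf_le1// ler1n.
  by rewrite ler_piMr ?(ltW be0)// invf_le1// ler1n.
by rewrite mul1r ge_min lexx orbT.
Qed.

End deformation.

(** * Curves and their graphs over the time axis *)

Section reparametrization.
Context {R : realType} {E : normedModType R}.
Variables (dom : R -> Prop) (N : R -> R) (W : R -> E -> E -> R).
Hypothesis WZ : forall t, dom t -> forall k x d,
  W t x (k *: d) = k ^+ 2 * W t x d.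

(** The condition does not depend on the curve parameter; its first argument is there to fit the
    shape of constraints in [pwC1]. The condition [slow] below is the same one after division by the
    time component. *)
Definition timelike (_ : R) (P w : R * E) : Prop :=
  [/\ dom P.1, W P.1 P.2 w.2 < N P.1 ^+ 2 * w.1 ^+ 2 & 0 < w.1].

Definition slow (t : R) (x d : E) : Prop := dom t /\ W t x d < N t ^+ 2.

Lemma pwC1_increasing (f : R -> R) (a b : R) :
  pwC1 (fun _ (_ d : R) => 0 < d) f a b ->
  forall x y, a <= x -> x < y -> y <= b -> f x < f y.
Proof.
move=> fC x y ax xy yb; have {}fC := pwC1_sub ax yb fC.
have loc u v (c c' : R -> R) : u < v -> C1 c c' ->
    (forall w, u <= w <= v -> f w = c w /\ 0 < c' w) -> f u < f v.
  move=> uv cc' fc.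
  have [|-> _] := fc u; first by rewrite lexx ltW.
  have [|-> _] := fc v; first by rewrite lexx ltW.
  rewrite -subr_gt0.
  have [|z zuv ->] := @MVT R c c' u v uv (fun z _ => cc'.1 z).
    by apply: continuous_subspaceT; exact: C1_continuous cc'.
  rewrite mulr_gt0 ?subr_gt0//; apply: (fc z _).2.
  by move: zuv; rewrite in_itv/= => /andP[/ltW -> /ltW ->].
apply: (@interval_induction R (fun u v => f u < f v) x y) => //.
- by move=> u v w _ _ _ _; exact: lt_trans.
- move=> u /fC.1[d [c [c' [d0 db cc' fc]]]]; exists d => // w /andP[uw wd] _.
  apply: (loc _ _ c c') => // t /andP[ut tw]; apply: fc.
  by rewrite ut (le_trans tw).
- move=> u /fC.2[d [c [c' [d0 db cc' fc]]]]; exists d => // w /andP[uw wd] _.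
  apply: (loc _ _ c c') => // t /andP[ut tw]; apply: fc.
  by rewrite tw andbT (le_trans uw).
Qed.

Lemma pwC1_time (gam : R -> R * E) :
  pwC1 timelike gam 0 1 -> pwC1 (fun _ (_ d : R) => 0 < d) (fun u => (gam u).1) 0 1.
Proof.
move=> gC.
have [h _] := @pwC1_op R _ _ _ (fun x _ : R * E => x.1) _ _ gam gam 0 1
  (fun _ _ _ _ h _ => C1_fst h) gC gC.
by apply: pwC1_impl h => u x d _ [y [y' [_ [_ [[_ _ h] _ _ ->]]]]].
Qed.

Lemma slow_of_timelike P w : timelike 0 P w ->
  slow P.1 P.2 (w.1^-1 *: w.2).
Proof.
move=> [dP lt w0]; split => //; rewrite WZ// exprVn mulrC.
by rewrite ltr_pdivrMr// exprn_gt0.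
Qed.

(** The time component is strictly increasing and continuous, hence has an inverse [sig] on [a, c].
    Its germs have C^1 inverses, so those of the graph are compositions, and homogeneity of [W]
    turns timelike into slow. *)
Lemma graph_of_curve (gam : R -> R * E) : pwC1 timelike gam 0 1 ->
  (gam 0).1 < (gam 1).1 /\
  exists X : R -> E, [/\ pwC1 slow X (gam 0).1 (gam 1).1,
    (forall u, 0 <= u <= 1 -> gam u = ((gam u).1, X (gam u).1)) &
    (forall u, 0 <= u <= 1 -> (gam 0).1 <= (gam u).1 <= (gam 1).1)].
Proof.
move=> gC; set a := (gam 0).1; set c := (gam 1).1.
pose tau u := (gam u).1.
have tinc : forall x y, 0 <= x -> x < y -> y <= 1 -> tau x < tau y.
  exact: pwC1_increasing (pwC1_time gC).
have tle x y : 0 <= x -> x <= y -> y <= 1 -> tau x <= tau y.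
  move=> x0; rewrite le_eqVlt => /predU1P[->//|xy y1]; exact/ltW/tinc.
have tlt x y : 0 <= x <= 1 -> 0 <= y <= 1 -> tau x < tau y -> x < y.
  move=> /andP[x0 x1] /andP[y0 y1]; apply: contraTT; rewrite -!leNgt => yx.
  exact: tle.
have tle' x y : 0 <= x <= 1 -> 0 <= y <= 1 -> tau x <= tau y -> x <= y.
  move=> /andP[x0 x1] /andP[y0 y1]; apply: contraTT; rewrite -!ltNge => yx.
  exact: tinc.
have ac : a < c by apply: tinc; rewrite ?ltr01 ?lexx.
have tac u : 0 <= u <= 1 -> a <= tau u <= c.
  by move=> /andP[u0 u1]; rewrite !tle ?lexx.
have ct : continuous (fun u => tau (clamp 0 1 u)).
  exact: (cont_fst (pwC1_clamp_continuous ltr01 gC)).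
(* Stated for every t, with an arbitrary value outside [a, c], so that choice yields a total
   function. *)
have surj t : exists u, a <= t <= c -> 0 <= u <= 1 /\ tau u = t.
  have [tin|//] := pselect (a <= t <= c); last by exists 0.
  have [|u] := @IVT R (fun u => tau (clamp 0 1 u)) 0 1 t ler01
                 (continuous_subspaceT ct).
    rewrite !clamp_id ?lexx ?ler01// /Num.min /Num.max.
    by rewrite -/a -/c ac.
  rewrite in_itv/= => u01 e; exists u => _; split => //.
  by rewrite clamp_id in e.
have /choice[sig sigP] := surj.
have s01 t : a <= t <= c -> 0 <= sig t <= 1 by move=> /sigP[].
have tsig t : a <= t <= c -> tau (sig t) = t by move=> /sigP[].
have sigt u : 0 <= u <= 1 -> sig (tau u) = u.
  move=> u01; have h := tac u u01.
  by apply/le_anti/andP; split; apply: tle'; rewrite ?s01 ?tsig.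
split => //; exists (fun t => (gam (sig t)).2); split; last exact: tac.
- have loc u v (e e' : R -> R * E) : 0 <= u -> u < v -> v <= 1 -> C1 e e' ->
      (forall w, u <= w <= v -> gam w = e w /\ timelike w (e w) (e' w)) ->
      exists x x' : R -> E, C1 x x' /\ forall t, tau u <= t <= tau v ->
        (gam (sig t)).2 = x t /\ slow t (x t) (x' t).
    move=> u0 uv v1 ee' ge.
    have [|g [g' [gg' gK]]] := @C1_inverse R _ _ u v (ltW uv) (C1_fst ee').
      by move=> w /ge[_ []].
    exists (fun t => (e (g t)).2), (fun t => g' t *: (e' (g t)).2); split.
      exact: (C1_comp (C1_snd ee') gg').
    move=> t /andP[ut tv].
    have u01 : 0 <= u <= 1 by rewrite u0 (ltW (lt_le_trans uv v1)).
    have v01 : 0 <= v <= 1 by rewrite v1 (ltW (le_lt_trans u0 uv)).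
    have t_ac : a <= t <= c.
      have /andP[h1 _] := tac u u01; have /andP[_ h2] := tac v v01.
      by rewrite (le_trans h1 ut) (le_trans tv h2).
    have suv : u <= sig t <= v.
      by apply/andP; split; apply: tle' => //; rewrite ?(s01 t t_ac) ?(tsig t t_ac).
    have [ge1 ge2] := ge _ suv.
    have te : (e (sig t)).1 = t by rewrite -ge1; exact: tsig.
    have [gt g't] := gK _ suv; rewrite te in gt g't.
    rewrite gt g't ge1; split => //.
    by have := slow_of_timelike ge2; rewrite te.
  split=> t /andP[a_t tc].
    have t_ac : a <= t <= c by rewrite a_t ltW.
    have u01 := s01 t t_ac; have tu := tsig t t_ac.
    have u1 : sig t < 1.
      by apply: tlt => //; rewrite ?ler01 ?lexx// tu.
    have [|d [e [e' [d0 db ee' ge]]]] := gC.1 (sig t).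
      by rewrite u1 andbT; case/andP: u01.
    have [||x [x' [xx' h]]] := loc (sig t) (sig t + d) e e' _ _ db ee' ge.
    - by case/andP: u01.
    - by rewrite ltrDl.
    have v01 : 0 <= sig t + d <= 1.
      by rewrite db andbT addr_ge0 ?(ltW d0)//; case/andP: u01.
    exists (tau (sig t + d) - t), x, x'; split => //.
    - rewrite subr_gt0 -{1}tu; apply: tinc => //; first by case/andP: u01.
      by rewrite ltrDl.
    - by rewrite subrKC; case/andP: (tac _ v01).
    - by move=> w; rewrite subrKC -{1}tu => /h.
  have t_ac : a <= t <= c by rewrite tc ltW.
  have u01 := s01 t t_ac; have tu := tsig t t_ac.
  have u0 : 0 < sig t.
    by apply: tlt => //; rewrite ?ler01 ?lexx// tu.
  have [|d [e [e' [d0 db ee' ge]]]] := gC.2 (sig t).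
    by rewrite u0; case/andP: u01.
  have [||x [x' [xx' h]]] := loc (sig t - d) (sig t) e e' db _ _ ee' ge.
  - by rewrite ltrBlDr ltrDl.
  - by case/andP: u01.
  have v01 : 0 <= sig t - d <= 1.
    rewrite db/= lerBlDr (le_trans (proj2 (andP u01)))// lerDl ltW//.
  exists (t - tau (sig t - d)), x, x'; split => //.
  - rewrite subr_gt0 -[ltRHS]tu; apply: tinc => //; last by case/andP: u01.
    by rewrite ltrBlDr ltrDl.
  - by rewrite subKr; case/andP: (tac _ v01).
  - by move=> w; rewrite subKr -[X in _ <= w <= X]tu => /h.
- move=> u u01; have := sigt u u01; rewrite /tau => ->.
  exact: surjective_pairing.
Qed.

(** The chain rule multiplies the velocity by the time derivative, and homogeneity of [W] gives the
    timelike condition back. Monotonicity of [tau] sends one-sided germs to germs on the same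
    side. *)
Lemma curve_of_graph (tau : R -> R) (X : R -> E) (a c : R) :
  pwC1 (fun _ (_ d : R) => 0 < d) tau 0 1 -> tau 0 = a -> tau 1 = c ->
  pwC1 slow X a c -> pwC1 timelike (fun u => (tau u, X (tau u))) 0 1.
Proof.
move=> tC t0 t1 XC.
have tinc := pwC1_increasing tC.
have key e e' u x x' w : 0 < e' -> e = tau w -> x = X e -> slow e x x' ->
    timelike u (e, x) (e', e' *: x').
  move=> e'0 _ _ [de lt]; split => //=; rewrite WZ// mulrC.
  by rewrite ltr_pM2r// exprn_gt0.
split=> u /[dup] uab /andP[u0 u1].
- have [d [e [e' [d0 db ee' te]]]] := tC.1 u uab.
  have tuac : a <= tau u < c.
    rewrite -t0 -t1 tinc// andbT; move: u0; rewrite le_eqVlt => /predU1P[<-//|u0].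
    by apply/ltW/tinc => //; exact: ltW.
  have [r [x [x' [r0 rb xx' Xx]]]] := XC.1 _ tuac.
  have etu : e u = tau u by rewrite (te u _).1// lexx lerDl ltW.
  have : \forall w \near u, e w < tau u + r.
    have /cvgr_lt := C1_continuous ee' (x := u); apply.
    by rewrite etu ltrDl.
  move=> /nbhs_ballP[m /= m0 hm].
  (* The germ of [tau] is shortened until its image lies in the germ of [X] at [tau u]; halving [m]
     passes from an open ball to a closed interval. *)
  exists (Num.min d (m / 2)), (fun w => (e w, x (e w))),
    (fun w => (e' w, e' w *: x' (e w))).
  have m2 : m / 2 < m by rewrite ltr_pdivrMr// ltr_pMr// ltr1n.
  split.
  + by rewrite lt_min d0 divr_gt0.
  + by rewrite (le_trans _ db)// lerD2l ge_min lexx.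
  + exact: C1_pair ee' (C1_comp xx' ee').
  + move=> w /andP[uw]; rewrite -lerBlDl le_min => /andP[wd wm].
    have wud : u <= w <= u + d by rewrite uw -lerBlDl.
    have [tw e'0] := te w wud.
    have ew : tau u <= e w <= tau u + r.
      rewrite -tw; apply/andP; split.
        move: uw; rewrite le_eqVlt => /predU1P[->//|uw].
        apply/ltW/tinc => //; case/andP: wud => _ h; exact: le_trans db.
      rewrite tw; apply/ltW/hm; rewrite /ball/= distrC ger0_norm ?subr_ge0//.
      exact: le_lt_trans m2.
    have [Xe sl] := Xx _ ew; rewrite tw Xe; split => //.
    by apply: (key _ _ _ _ _ w).
- have [d [e [e' [d0 db ee' te]]]] := tC.2 u uab.
  have tuac : a < tau u <= c.
    rewrite -t0 -t1 tinc//=; move: u1; rewrite le_eqVlt => /predU1P[->//|u1].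
    by apply/ltW/tinc => //; exact: ltW.
  have [r [x [x' [r0 rb xx' Xx]]]] := XC.2 _ tuac.
  have etu : e u = tau u by rewrite (te u _).1// lexx lerBlDr lerDl ltW.
  have : \forall w \near u, tau u - r < e w.
    have /cvgr_gt := C1_continuous ee' (x := u); apply.
    by rewrite etu ltrBlDr ltrDl.
  move=> /nbhs_ballP[m /= m0 hm].
  exists (Num.min d (m / 2)), (fun w => (e w, x (e w))),
    (fun w => (e' w, e' w *: x' (e w))).
  have m2 : m / 2 < m by rewrite ltr_pdivrMr// ltr_pMr// ltr1n.
  split.
  + by rewrite lt_min d0 divr_gt0.
  + by rewrite (le_trans db)// lerD2l lerN2 ge_min lexx.
  + exact: C1_pair ee' (C1_comp xx' ee').
  + move=> w /andP[+ wu]; rewrite lerBlDr -lerBlDl le_min => /andP[wd wm].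
    have wud : u - d <= w <= u by rewrite wu andbT lerBlDr -lerBlDl.
    have [tw e'0] := te w wud.
    have ew : tau u - r <= e w <= tau u.
      rewrite -tw; apply/andP; split; last first.
        move: wu; rewrite le_eqVlt => /predU1P[->//|wu].
        apply/ltW/tinc => //; case/andP: wud => h _; exact: le_trans db h.
      rewrite tw; apply/ltW/hm; rewrite /ball/= ger0_norm ?subr_ge0//.
      exact: le_lt_trans m2.
    have [Xe sl] := Xx _ ew; rewrite tw Xe; split => //.
    by apply: (key _ _ _ _ _ w).
Qed.

End reparametrization.

(** * One-connectedness *)

Section future_curves.
Context {R : realType} {p q : nat}.
Local Notation E := ('rV[R]_p * 'rV[R]_q)%type.
Variables (N : R -> R) (h : R -> E -> E -> E -> R) (lo hi : \bar R).

Local Notation dom := (fun t : R => (lo < t%:E < hi)%E : Prop).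
Local Notation tl := (@timelike R E dom N (fun t x d => h t x d d)).

Lemma future_timelike_curveP (gam : R -> R * E) :
  future_timelike_curve N h lo hi gam <-> pwC1 tl gam 0 1.
Proof.
have formE P w : spacetime_form N h P w < 0 <->
    h P.1 P.2 w.2 w.2 < N P.1 ^+ 2 * w.1 ^+ 2.
  by rewrite /spacetime_form addrC subr_lt0.
split=> [[k [s [s0 sk hs]]]|].
  apply/(pwC1_partition _ _ ltr01); exists k, s; split => // i ik.
  have [ss [c [dc cc hc]]] := hs i ik; split => //.
  have CC := C1P dc cc.
  exists c, (derive1 c); split; first exact CC.
  move=> u us; have [|h1 h2 h3 h4] := hc u; first by rewrite in_itv.
  by split => //; split => //; apply/formE.
move=> /(pwC1_partition _ _ ltr01)[k [s [s0 sk hs]]].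
exists k, s; split => // i ik; have [ss [c [c' [cc' hc]]]] := hs i ik.
split => //; exists c; rewrite (C1_derive1 cc'); split.
- by move=> u; have [] := cc'.1 u.
- exact: cc'.2.
- move=> u; rewrite in_itv/= => us; have [h1 [h2 h3 h4]] := hc u us.
  by split => //; apply/formE.
Qed.

End future_curves.

Section one_connected.
Context {R : realType}.
Local Notation mu := (@lebesgue_measure R).
Variables (p q : nat) (b : 'rV[R]_p -> 'rV[R]_p -> 'rV[R]_q).
Hypotheses (bl : forall v, linear (b v)) (br : forall w, linear (b^~ w)).
Local Notation E := ('rV[R]_p * 'rV[R]_q)%type.
Variables (tm tp : \bar R) (N : R -> R) (h : R -> E -> E -> E -> R)
  (H : R -> 'M[R]_p) (A : R -> 'M[R]_q) (L : R -> 'M[R]_(p, q)).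
Hypotheses (HNpos : forall t, (tm < t%:E < tp)%E -> 0 < N t)
  (HNsmooth : smooth_on tm tp N)
  (Hsmooth : forall x u w, smooth_on tm tp (fun t => h t x u w))
  (Hschur : forall t, (tm < t%:E < tp)%E -> schur_form b (h t) (H t) (A t) (L t)).
Variable (T : R).
Hypothesis HT : (tm < T%:E < tp)%E.
Hypothesis Hopt : (kappa_opt b tm T N H A <= (2^-1)%:E)%E.

Local Notation dom := (fun t : R => (tm < t%:E < T%:E)%E : Prop).
Local Notation W := (fun t x d => h t x d d).

Let dom_tp t : (tm < t%:E < T%:E)%E -> (tm < t%:E < tp)%E.
Proof.
by move=> /andP[-> tT]; case/andP: HT => _; exact: lt_trans.
Qed.

Let WE t : (tm < t%:E < tp)%E -> forall x d, h t x d d = speed b H A L t x d.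
Proof. by move=> /Hschur[_ _ hE] x d; rewrite hE. Qed.

Let WZ t : dom t -> forall k x d, W t x (k *: d) = k ^+ 2 * W t x d.
Proof.
move=> /dom_tp dt k x d; rewrite !WE// /speed /Theta /= -scalemxAl.
rewrite (blZ bl) !scalerA mulrC -scalerA -scalerBr -scalerDr !qformZ.
by rewrite mulrDr.
Qed.

(** The bound 1/2 on [kappa_opt], cleared of its denominator and with the factor 1/2 absorbed in 2
    N. The supremum excludes [lam] = 0 and [xi] = 0, where the left side vanishes. *)
Lemma Qform_dual_le (a c : R) (xi dxi : R -> 'rV[R]_p) (lam : 'rV[R]_q) :
  (tm < a%:E)%E -> a < c < T -> W012 a c xi dxi ->
  (Qform b a c xi dxi *m lam^T) 0 0 <=
  \int[mu]_(t in `[a, c]) (qform (H t) (dxi t) / (2 * N t) *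
                           Num.sqrt (qform (invmx (A t)) lam)).
Proof.
move=> ta acT Wxi.
have Nt t : a <= t <= c -> 0 < N t.
  by move=> /(itv_dom HT ta acT); exact: HNpos.
have pHt t : a <= t <= c -> posdefmx (H t).
  by move=> /(itv_dom HT ta acT)/Hschur[].
have rhs0 : 0 <= \int[mu]_(t in `[a, c]) (qform (H t) (dxi t) / (2 * N t) *
                           Num.sqrt (qform (invmx (A t)) lam)).
  apply: Rintegral_ge0 => t /=; rewrite in_itv/= => tac.
  apply: mulr_ge0; last exact: sqrtr_ge0.
  apply: divr_ge0; first exact/qform_ge0/pHt.
  by rewrite mulr_ge0// ltW// Nt.
have [l0|lam0] := eqVneq lam 0; first by rewrite {1}l0 trmx0 mulmx0 mxE.
have [xi0|xi0] := pselect (exists2 t, t \in `[a, c] & xi t != 0); last first.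
  by rewrite (Qform_eq0 br dxi acT xi0) mul0mx mxE.
have lamT0 : lam^T != 0.
  by apply: contra lam0 => /eqP e; rewrite -[lam]trmxK e trmx0.
have [i1 p1 e1] := opt_energy br HNpos HNsmooth Hsmooth Hschur HT ta acT Wxi lamT0.
have := le_trans (sup0_ub _) Hopt.
move=> /(_ _ (ex_intro _ a (ex_intro _ c (ex_intro _ xi (ex_intro _ dxi
  (ex_intro _ lam^T (And5 (conj ta acT) Wxi xi0 lamT0 erefl))))))).
rewrite lee_fin e1 ler_pdivrMr ?p1//.
move=> hle; apply: (le_trans (ler_norm _)); apply: (le_trans hle).
rewrite -RintegralZl// le_eqVlt; apply/orP; left; apply/eqP.
apply: eq_Rintegral => t _; rewrite trmxK invfM; ring.
Qed.

Lemma kappa_opt_one_connected : future_one_connected N h tm T%:E.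
Proof.
move=> gam0 gam1 /future_timelike_curveP g0C /future_timelike_curveP g1C e0 e1.
have [ac [X0 [X0C gX0 t0ac]]] := graph_of_curve WZ g0C.
have [_ [X1 [X1C gX1 t1ac]]] := graph_of_curve WZ g1C.
rewrite -e0 -e1 in X1C t1ac.
set a := (gam0 0).1 in ac X0C t0ac X1C t1ac.
set c := (gam0 1).1 in ac X0C t0ac X1C t1ac.
(* The germs at the two ends place [a] and [c] in the open time interval, and everything between
   them follows. *)
have domac t : a <= t <= c -> dom t.
  have aac : a <= a < c by rewrite lexx.
  have cac : a < c <= c by rewrite lexx andbT.
  have [/andP[da _] _] := pwC1_rderive X0C aac.
  have [d [x [x' [d0 _ _ hx]]]] := X0C.2 c cac.
  have [|_ [/andP[_ dc] _]] := hx c; first by rewrite lexx lerBlDr lerDl ltW.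
  move=> /andP[a_t tc].
  by rewrite (lt_le_trans da) ?lee_fin//= (le_lt_trans _ dc)// lee_fin.
have aac : a <= a <= c by rewrite lexx ltW.
have cac : a <= c <= c by rewrite lexx ltW.
have ta : (tm < a%:E)%E by have /andP[] := domac a aac.
have acT : a < c < T.
  by rewrite ac/= -lte_fin; have /andP[] := domac c cac.
have ctp : (c%:E < tp)%E by have /andP[] := dom_tp (domac c cac).
have acle := ltW ac.
(* Clamped data are continuous and positive definite on the whole line, as the deformation
   requires. *)
pose cl := clamp a c.
have cldom t : (tm < (cl t)%:E < tp)%E by exact: clamp_dom.
have cN := smooth_on_clamp acle ta ctp HNsmooth.
have cH := schur_H_continuous br Hsmooth Hschur acle ta ctp.
have cA := schur_A_continuous br Hsmooth Hschur acle ta ctp.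
have cL := schur_L_continuous br Hsmooth Hschur acle ta ctp.
have N0 t : 0 < N (cl t) by exact: HNpos.
have pH t : posdefmx (H (cl t)) by have [] := Hschur (cldom t).
have pA t : posdefmx (A (cl t)) by have [] := Hschur (cldom t).
pose sp := speed b (fun t => H (cl t)) (fun t => A (cl t)) (fun t => L (cl t)).
have spE t x d : a <= t <= c -> sp t x d = h t x d d.
  move=> tac; rewrite WE; last exact/dom_tp/domac.
  by rewrite /sp /speed /cl clamp_id.
have slow_speed X : pwC1 (slow dom N W) X a c ->
    pwC1 (fun t x d => sp t x d - N (cl t) ^+ 2 < 0) X a c.
  apply: pwC1_impl => t x d tac [_]; rewrite spE// /cl clamp_id//.
  by rewrite subr_lt0.
have T0 := slow_speed _ X0C; have T1 := slow_speed _ X1C.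
have i0 : 0 <= (0 : R) <= 1 by rewrite lexx ler01.
have i1 : 0 <= (1 : R) <= 1 by rewrite lexx ler01.
have Xa : X0 a = X1 a.
  have := gX1 0 i0; rewrite -e0 -/a => /(congr1 snd) /= <-.
  by have := gX0 0 i0 => /(congr1 snd).
have Xc : X0 c = X1 c.
  have := gX1 1 i1; rewrite -e1 -/c => /(congr1 snd) /= <-.
  by have := gX0 1 i1 => /(congr1 snd).
have Wxi := xi_W012 ac T0 T1 Xa Xc.
have Qle lam := Qform_dual_le lam ta acT Wxi.
have {}Qle (lam : 'rV[R]_q) :
    (Qform b a c (xi X0 X1) (dxi X0 X1) *m lam^T) 0 0 <=
    \int[mu]_(t in `[a, c])
      (qform (H (cl t)) (dxi X0 X1 t) / (2 * N (cl t)) *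
       Num.sqrt (qform (invmx (A (cl t))) lam)).
  apply: (le_trans (Qle lam)); rewrite le_eqVlt; apply/orP; left; apply/eqP.
  by apply: eq_Rintegral => t; rewrite inE/= in_itv/= => tac; rewrite /cl clamp_id.
have [Y [YC Ya Yc hY]] := deformation bl br ac cN N0 cH pH cA pA cL T0 T1 Qle.
(* Clamping both the parameter and the time makes [G] continuous on the whole plane; on the unit
   square it agrees with the deformed graph at the interpolated time. *)
pose t0 u := (gam0 (clamp 0 1 u)).1; pose t1 u := (gam1 (clamp 0 1 u)).1.
pose ts (P : R * R) := (1 - P.1) * t0 P.2 + P.1 * t1 P.2.
pose G (P : R * R) : R * E :=
  (ts P, deform (fun t => X0 (cl t)) (fun t => X1 (cl t)) (fun t => Y (cl t))
           P.1 (ts P)).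
have ct0 : continuous t0 := cont_fst (pwC1_clamp_continuous ltr01 g0C).
have ct1 : continuous t1 := cont_fst (pwC1_clamp_continuous ltr01 g1C).
have cs : continuous (fun P : R * R => P.1) by exact/cont_fst/cont_id.
have cu : continuous (fun P : R * R => P.2) by exact/cont_snd/cont_id.
have c1s : continuous (fun P : R * R => 1 - P.1).
  by apply: contB => //; exact: cont_cst.
have cts : continuous ts.
  exact: (contD (contM c1s (cont_comp ct0 cu)) (contM cs (cont_comp ct1 cu))).
have cG : continuous G.
  have cX0 := cont_comp (pwC1_clamp_continuous ac X0C) cts.
  have cX1 := cont_comp (pwC1_clamp_continuous ac X1C) cts.
  have cY := cont_comp (pwC1_clamp_continuous ac YC) cts.
  have c0Y := cont_pair (@cont_cst _ _ (0 : 'rV[R]_p)) cY.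
  exact: (cont_pair cts (contD (contD (contZ c1s cX0) (contZ cs cX1))
                               (contZ (contM cs c1s) c0Y))).
pose tu s u := (1 - s) * (gam0 u).1 + s * (gam1 u).1.
have tuac s u : 0 <= s <= 1 -> 0 <= u <= 1 -> a <= tu s u <= c.
  move=> /andP[s0 s1] u01.
  have /andP[h1 h2] := t0ac u u01; have /andP[h3 h4] := t1ac u u01.
  rewrite /tu; apply/andP; split.
    have -> : a = (1 - s) * a + s * a by ring.
    by apply: lerD; apply: ler_wpM2l => //; rewrite subr_ge0.
  have -> : c = (1 - s) * c + s * c by ring.
  by apply: lerD; apply: ler_wpM2l => //; rewrite subr_ge0.
have GE s u : 0 <= s <= 1 -> 0 <= u <= 1 ->
    G (s, u) = (tu s u, deform X0 X1 Y s (tu s u)).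
  move=> s01 u01; have h1 := tuac s u s01 u01.
  have e : ts (s, u) = tu s u by rewrite /ts /tu /t0 /t1 /= clamp_id.
  by rewrite /G e /deform /cl clamp_id.
have deform_end s t : X0 t = X1 t -> Y t = 0 -> deform X0 X1 Y s t = X0 t.
  rewrite /deform => <- ->; rewrite -scalerDl subrK scale1r.
  by rewrite [X in _ + X](_ : _ = 0) ?addr0//; exact: scaler0.
have G0 u : 0 <= u <= 1 -> G (0, u) = gam0 u.
  move=> u01; rewrite GE// /tu /deform subr0 mul1r !mul0r addr0 scale1r !scale0r.
  by rewrite !addr0 -gX0.
have G1 u : 0 <= u <= 1 -> G (1, u) = gam1 u.
  move=> u01; rewrite GE// /tu /deform subrr !mul0r !mul1r add0r scale1r.
  by rewrite !scale0r add0r addr0 -gX1.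
exists G; split.
- exact: continuous_subspaceT.
- by move=> u; rewrite in_itv/= => u01; rewrite G0// G1.
- move=> s; rewrite in_itv/= => s01.
  rewrite !GE// /tu -e0 -e1 -/a -/c -!mulrDl subrK !mul1r.
  by rewrite !deform_end// -gX0// -gX0.
- move=> s; rewrite in_itv/= => /andP[s0 s1].
  apply/future_timelike_curveP.
  (* The deformation has a positive margin only for 0 < s < 1; at the two extreme values [G] is a
     given curve. *)
  move: s0; rewrite le_eqVlt => /predU1P[<-|s0].
    by apply: eq_pwC1 g0C => u u01; rewrite G0.
  move: s1; rewrite le_eqVlt => /predU1P[->|s1].
    by apply: eq_pwC1 g1C => u u01; rewrite G1.
  have s01 : 0 < s < 1 by rewrite s0.
  have opC (x x' y y' : R -> R * E) : C1 x x' -> C1 y y' ->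
      C1 (fun t => (1 - s) * (x t).1 + s * (y t).1)
         (fun t => (1 - s) * (x' t).1 + s * (y' t).1).
    by move=> hx hy; exact: C1D (C1Z (1 - s) (C1_fst hx)) (C1Z s (C1_fst hy)).
  have [tC _] := @pwC1_op R _ _ _ (fun x y : R * E => (1 - s) * x.1 + s * y.1)
    _ _ gam0 gam1 0 1 opC g0C g1C.
  have {}tC : pwC1 (fun _ (_ d : R) => 0 < d) (tu s) 0 1.
    apply: pwC1_impl tC => t x d _ [y [y' [z [z' [[_ _ y0] [_ _ z0] _ ->]]]]].
    by rewrite addr_gt0// mulr_gt0// subr_gt0.
  have dC : pwC1 (slow dom N W) (deform X0 X1 Y s) a c.
    apply: pwC1_impl (hY s s01) => t x d tac; rewrite -/(sp t x d) spE// /cl.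
    by rewrite clamp_id// => hlt; split => //; exact: domac.
  have ts0 : tu s 0 = a by rewrite /tu -e0 -/a -mulrDl subrK mul1r.
  have ts1 : tu s 1 = c by rewrite /tu -e1 -/c -mulrDl subrK mul1r.
  apply: eq_pwC1 (curve_of_graph WZ tC ts0 ts1 dC) => u u01.
  by rewrite GE// !ltW.
Qed.

End one_connected.

Theorem proposition5p4 (R : realType)
  (n : vectType R) (br : n -> n -> n)
  (Hlie : is_lie_bracket br) (Hstep : two_step br)
  (p q : nat) (sigma : 'rV[R]_p -> n) (iota : 'rV[R]_q -> n)
  (b : 'rV[R]_p -> 'rV[R]_p -> 'rV[R]_q)
  (Hsplit : central_splitting br sigma iota b)
  (tm tp : \bar R) (Htmp : (tm < tp)%E)
  (N : R -> R)
  (HNpos : forall t, (tm < t%:E < tp)%E -> 0 < N t)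
  (HNsmooth : smooth_on tm tp N)
  (h : R -> 'rV[R]_p * 'rV[R]_q -> 'rV[R]_p * 'rV[R]_q ->
       'rV[R]_p * 'rV[R]_q -> R)
  (Hinv : forall t, (tm < t%:E < tp)%E -> left_invariant_metric b (h t))
  (Hsmooth : forall x u w, smooth_on tm tp (fun t => h t x u w))
  (H : R -> 'M[R]_p) (A : R -> 'M[R]_q) (L : R -> 'M[R]_(p, q))
  (Hschur : forall t, (tm < t%:E < tp)%E ->
              schur_form b (h t) (H t) (A t) (L t))
  (S : 'M[R]_q) (HS : posdefmx S)
  (T : R) (HT : (tm < T%:E < tp)%E) :
  [/\ (kappa_opt b tm T N H A <= (2^-1)%:E)%E ->
        future_one_connected N h tm T%:E,
      (kappa_opt b tm T N H A <= kappa_an b tm T N H A)%E,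
      (kappa_an b tm T N H A <= kappa_Sch b tm T N H A S)%E,
      (kappa_an b tm T N H A <= (2^-1)%:E)%E ->
        future_one_connected N h tm T%:E &
      (kappa_Sch b tm T N H A S <= (2^-1)%:E)%E ->
        future_one_connected N h tm T%:E].
Proof.
have [bl br_] := central_splitting_bilinear Hlie Hsplit.
have oc : (kappa_opt b tm T N H A <= (2^-1)%:E)%E ->
    future_one_connected N h tm T%:E.
  exact: (kappa_opt_one_connected bl br_ HNpos HNsmooth Hsmooth Hschur HT).
have le1 : (kappa_opt b tm T N H A <= kappa_an b tm T N H A)%E.
  exact: (kappa_opt_le_an br_ HNpos HNsmooth Hsmooth Hschur HT).
have le2 : (kappa_an b tm T N H A <= kappa_Sch b tm T N H A S)%E.
  exact: (kappa_an_le_Sch br_ HNpos HNsmooth Hsmooth Hschur HT HS).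
split => // h1; apply: oc; apply: le_trans h1 => //.
exact: le_trans le2.
Qed.
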